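(* Let $\Gamma$ be a metric graph and let $(D,M)$ be a $\mathfrak g^1_d$ on $\Gamma$, with $D$ a divisor of degree $d$. Suppose that the constant functions are in $M$. Then there exist a tropical modification $\alpha\colon\widetilde\Gamma\to\Gamma$ of $\Gamma$ and a finite harmonic morphism $\varphi\colon\widetilde\Gamma\to T$ of degree $d$ to a metric tree $T$ such that $M$ is the preimage of the unique $\mathfrak g^1_1$ on $T$, restricted to $\Gamma$; that is, for some point $y_0\in T$, $$M=\{(g\circ\varphi)|_\Gamma \;:\; g\in \mathrm{Rat}(T,(y_0))\},\qquad \mathrm{Rat}(T,(y_0))=\{g\in\mathrm{Rat}(T): (y_0)+\mathrm{div}(g)\ge 0\}.$$
   Context: Metric graphs. A metric graph $\Gamma$ is the metric realization of a pair $(G,\ell)$, where $G=(V,E)$ is a finite connected graph with at least one edge and $\ell\colon E\to\mathbb R_{>0}$: each edge $e$ is replaced by a closed interval of length $\ell(e)$, glued according to $G$, with the path metric. $G$ (with $\ell$) is called a model of $\Gamma$; a model is simple if it has no loops and no parallel edges. A metric tree is a metric graph without cycles. $\mathrm T_x(\Gamma)$ is the finite set of outgoing unit tangent vectors at $x$, and $d_x=|\mathrm T_x(\Gamma)|$. $\mathrm{Rat}(\Gamma)$ is the set of continuous piecewise affine functions $f\colon\Gamma\to\mathbb R$ with integral slopes; $\mathrm{slope}_\nu(f)$ is the outgoing slope of $f$ along $\nu$. A divisor $D$ is a finite formal integer combination of points of $\Gamma$, $D(x)$ is its coefficient at $x$, $D\ge 0$ (effective) means all coefficients are $\geq 0$.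 $\mathrm{div}(f)=\sum_x \mathrm{ord}_x(f)(x)$ with $\mathrm{ord}_x(f)=-\sum_{\nu\in \mathrm T_x(\Gamma)}\mathrm{slope}_\nu(f)$. $\mathrm{Rat}(D)=\{f\in\mathrm{Rat}(\Gamma): D+\mathrm{div}(f)\ge 0\}$. Hypercube rank functions. Put $[r]=\{0,\dots,r\}$ for an integer $r\ge 0$. The hypercube $[r]^\delta$ ($\delta\geq 1$) carries the coordinatewise order $\preceq$ and coordinatewise max $\vee$ and min $\wedge$; $\underline e_i$ is the $i$-th unit vector. A rank function is a map $\rho\colon[r]^\delta\to\mathbb Z$ such that: (1) $\rho(t\,\underline e_i)=r-t$ for all $i$ and $t\in[r]$; (2) $\underline a\preceq\underline b$ implies $\rho(\underline b)\le\rho(\underline a)$; (3) $\rho(\underline a)+\rho(\underline b)\le\rho(\underline a\vee\underline b)+\rho(\underline a\wedge\underline b)$; (4) $\rho$ takes values in $\{-1,0,\dots,r\}$. A jump of $\rho$ is a point $\underline a$ with $\rho(\underline a)\ge 0$ and $\rho(\underline a+\underline e_i)=\rho(\underline a)-1$ for every $i$ with $\underline a+\underline e_i\in[r]^\delta$. The standard rank function is $\rho(\underline a)=\max\{-1,r-a_1-\dots-a_\delta\}$. Slope structures. A slope structure $\mathfrak S$ of width $r$ on $\Gamma$ is the data, on some simple graph model $G=(V,E)$ of $\Gamma$, of: for every oriented edge $uv$, a set $S^{uv}$ of integers $s_0^{uv}<\dots<s_r^{uv}$ with $s_i^{uv}+s_{r-i}^{vu}=0$; for every $v\in V$, a rank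 function $\rho_v$ on $[r]^{d_v}$, whose coordinates are indexed by the oriented edges with tail $v$ (equivalently by $\mathrm T_v(\Gamma)$). It is extended to all of $\Gamma$: for $\nu\in \mathrm T_x(\Gamma)$, $S^\nu=\{s_0^\nu<\dots<s_r^\nu\}$ is $S^{uv}$ for the oriented edge $uv$ parallel to $\nu$; for $x\in\Gamma\setminus V$, $\rho_x$ is the standard rank function on $[r]^2$. For $\underline a=(a_\nu)_\nu\in[r]^{\mathrm T_x(\Gamma)}$ put $s_{\underline a}=(s^\nu_{a_\nu})_\nu$, and let $S^x=\{s_{\underline a}:\underline a\text{ a jump of }\rho_x\}$. A function $f\in\mathrm{Rat}(\Gamma)$ is compatible with $\mathfrak S$ if for every $x\in\Gamma$, $\mathrm{slope}_\nu(f)\in S^\nu$ for all $\nu\in\mathrm T_x(\Gamma)$, and $\partial_x(f):=(\mathrm{slope}_\nu(f))_{\nu\in \mathrm T_x(\Gamma)}\in S^x$. If $\partial_x(f)=s_{\underline a}$, write $\rho_x(\partial_x(f)):=\rho_x(\underline a)$. $\mathrm{Rat}(D,\mathfrak S)$ is the set of $f\in\mathrm{Rat}(D)$ compatible with $\mathfrak S$. Linear series. A semimodule is a subset of $\mathrm{Rat}(\Gamma)$ stable under $(f,g)\mapsto\min(f,g)$ and $f\mapsto f+c$, $c\in\mathbb R$. A semimodule $M\subseteq\mathrm{Rat}(D)$ is admissible of rank $r$ if it is closed for the topology of $\|\cdot\|_\infty$ and there is a slope structure $\mathfrak S$ of width $r$ with $M\subseteq\mathrm{Rat}(D,\mathfrak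 S)$ such that for every effective divisor $E$ of degree $r$ there is $f\in M$ with $\rho_x(\partial_x(f))\ge E(x)$ for all $x\in\Gamma$ and $D+\mathrm{div}(f)-E\ge 0$. $M$ is finitely generated if there are $f_1,\dots,f_n\in M$ such that every $g\in M$ is of the form $\min_i(f_i+c_i)$ with $c_i\in\mathbb R$. The tropical rank of $M$ is the least integer $r\ge 0$ such that for all $f_0,\dots,f_{r+1}\in M$ there are $c_0,\dots,c_{r+1}\in\mathbb R$ such that for every $x\in\Gamma$ the minimum $\min_i(f_i(x)+c_i)$ is attained for at least two indices. A $\mathfrak g^r_d$ on $\Gamma$ is a pair $(D,M)$ with $D$ a divisor of degree $d$ and $M\subseteq\mathrm{Rat}(D)$ an admissible semimodule of rank $r$ that is finitely generated and has tropical rank $r$. On a metric tree $T$, up to linear equivalence the unique $\mathfrak g^1_1$ containing the constants is $((y_0),\mathrm{Rat}(T,(y_0)))$, $y_0\in T$. Tropical modifications and harmonic morphisms. A tropical modification $\alpha\colon\widetilde\Gamma\to\Gamma$ is obtained by gluing finitely many metric trees to $\Gamma$, each at one point; $\Gamma\subseteq\widetilde\Gamma$ and $\alpha$ contracts each attached tree to its attaching point. A finite morphism $\varphi\colon\widetilde\Gamma\to T$ of metric graphs is a continuous map such that, for suitable models, vertices map to vertices and each edge is mapped affinely onto an edge with positive integer dilation factor (preimages of points are finite). It is harmonic if for every $x$ the integer $m_\varphi(x)=\sum_{\mu\in \mathrm T_x(\widetilde\Gamma),\,\varphi_*(\mu)=\nu}(\text{dilation factor along }\mu)$ does not depend on $\nu\in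 \mathrm T_{\varphi(x)}(T)$; its degree is $\sum_{x\in\varphi^{-1}(y)}m_\varphi(x)$, independent of $y\in T$. *)

(* Defs.v *)
From HB Require Import structures.
From mathcomp Require Import all_boot all_order all_algebra.
From mathcomp Require Import all_classical all_reals all_analysis.

Set Implicit Arguments.
Unset Strict Implicit.
Unset Printing Implicit Defensive.

Import Order.TTheory GRing.Theory Num.Theory.
Import numFieldNormedType.Exports.

Local Open Scope classical_set_scope.
Local Open Scope ring_scope.

(** * Metric graphs *)

(* A metric graph is given by one of its models (G, len); loops and parallel
   edges are allowed.  The space itself is the type [realization] below, and the
   other models of the same space are described by [model].  The orientation
   (src, tgt) of an edge only serves to parametrize it by [0, len e]. *)
Record metric_graph (R : realType) := MetricGraph {
  vertex : finType;
  edge : finType;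
  src : edge -> vertex;
  tgt : edge -> vertex;
  len : edge -> R;
  len_gt0 : forall e, 0 < len e;
  edge_gt0 : (0 < #|edge|)%N;
  graph_connected : forall u v : vertex,
    connect (fun a b => [exists e, ((src e == a) && (tgt e == b))
                                || ((src e == b) && (tgt e == a))]) u v
}.

Inductive realization (R : realType) (G : metric_graph R) : Type :=
| AtVertex of vertex G
| InEdge (e : edge G) (t : R) of 0 < t < len e.

HB.instance Definition _ (R : realType) (G : metric_graph R) :=
  gen_eqMixin (realization G).
HB.instance Definition _ (R : realType) (G : metric_graph R) :=
  gen_choiceMixin (realization G).

Section Realization.
Variables (R : realType) (G : metric_graph R).

(* The characteristic map [0, len e] -> G of the edge e, extended constantly
   outside of [0, len e]. *)
Definition epoint (e : edge G) (t : R) : realization G :=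
  match boolP (0 < t < len e) with
  | AltTrue h => InEdge h
  | AltFalse _ => if t <= 0 then AtVertex (src e) else AtVertex (tgt e)
  end.

(* Oriented edges: (e, false) is e from src e to tgt e, (e, true) its reverse. *)
Definition dart : finType := (edge G * bool)%type.
Definition drev (a : dart) : dart := (a.1, ~~ a.2).
Definition dtail (a : dart) : vertex G := if a.2 then tgt a.1 else src a.1.
Definition dhead (a : dart) : vertex G := dtail (drev a).

(* The point at distance t from the tail of a along a. *)
Definition dpoint (a : dart) (t : R) : realization G :=
  epoint a.1 (if a.2 then len a.1 - t else t).

(* The path metric: a walk is a concatenation of segments (e, s, t), going
   inside the closed edge e from the parameter s to the parameter t. *)
Fixpoint is_walk (x : realization G) (w : seq (edge G * R * R))
    (y : realization G) : Prop :=
  if w is (e, s, t) :: w' then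
    [/\ 0 <= s <= len e, 0 <= t <= len e, x = epoint e s
      & is_walk (epoint e t) w' y]
  else x = y.

Definition walk_len (w : seq (edge G * R * R)) : R :=
  \sum_(a <- w) `|a.2 - a.1.2|.

Definition path_dist (x y : realization G) : R :=
  inf [set walk_len w | w in [set w | is_walk x w y]].

Definition simple_graph : Prop :=
  (forall e : edge G, src e <> tgt e) /\
  (forall a b : dart, dtail a = dtail b -> dhead a = dhead b -> a = b).

Definition is_cycle (c : seq dart) : bool :=
  [&& (0 < size c)%N, cycle (fun a b => dhead a == dtail b) c,
      uniq [seq a.1 | a <- c] & uniq [seq dtail a | a <- c]].

Definition is_tree : Prop := forall c : seq dart, ~~ is_cycle c.

(* A unit tangent vector at x is an oriented edge: one with tail x if x is a
   vertex, one of the two orientations of the edge carrying x otherwise. *)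
Definition tangent (x : realization G) : {set dart} :=
  match x with
  | AtVertex v => [set a | dtail a == v]
  | InEdge e _ _ => [set a | a.1 == e]
  end%SET.

Definition tangent_type (x : realization G) : finType :=
  {a : dart | a \in tangent x}.

(* The point at (small) distance t from x in the direction a. *)
Definition move (x : realization G) (a : dart) (t : R) : realization G :=
  match x with
  | AtVertex _ => dpoint a t
  | InEdge e s _ => epoint e (if a.2 then s - t else s + t)
  end.

(** * Rational functions and divisors *)

(* Continuity is built in: f is affine on closed segments, whose endpoints
   (vertices of G included) are shared by neighbouring segments. *)
Definition Rat : set (realization G -> R) := [set f | forall e : edge G,
  exists (n : nat) (t : nat -> R) (s : nat -> int),
    [/\ t 0%N = 0, t n = len e &
      forall i, (i < n)%N -> t i < t i.+1 /\
        forall u, t i <= u <= t i.+1 ->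
          f (epoint e u) = f (epoint e (t i)) + (s i)%:~R * (u - t i)]].

Definition is_slope (f : realization G -> R) (x : realization G) (a : dart)
    (s : int) : Prop :=
  exists2 eps : R, 0 < eps &
    forall t, 0 <= t <= eps -> f (move x a t) = f x + s%:~R * t.

Definition slope (f : realization G -> R) (x : realization G) (a : dart) : int :=
  xget 0 [set s | is_slope f x a s].

Definition ord_at (f : realization G -> R) (x : realization G) : int :=
  - \sum_(a in tangent x) slope f x a.

Record divisor := Divisor {
  dcoef :> realization G -> int;
  dcoef_finite : finite_set [set x | dcoef x != 0]
}.

Definition deg (D : divisor) : int := \sum_(x \in [set: realization G]) D x.

Definition effective (D : divisor) : Prop := forall x, 0 <= D x.

Lemma point_div_finite (y : realization G) :
  finite_set [set x | ((x == y)%:Z : int) != 0].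
Proof.
apply: (@sub_finite_set _ _ [set y]); last exact: finite_set1.
by move=> x /=; have [-> //|_] := eqVneq x y; rewrite eqxx.
Qed.

Definition point_div (y : realization G) : divisor :=
  Divisor (point_div_finite y).

Definition RatD (D : divisor) : set (realization G -> R) :=
  Rat `&` [set f | forall x, 0 <= D x + ord_at f x].

End Realization.

Definition isometric_embedding (R : realType) (G H : metric_graph R)
    (h : realization G -> realization H) : Prop :=
  forall x y, path_dist (h x) (h y) = path_dist x y.

(* model_map is injective since path_dist separates points. *)
Record model (R : realType) (G : metric_graph R) := Model {
  model_graph : metric_graph R;
  model_map : realization model_graph -> realization G;
  model_isometric : isometric_embedding model_map;
  model_surj : forall x, exists y, model_map y = x
}.
Arguments model_map {R G} m x.

(** * Rank functions on hypercubes *)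

Section Hypercube.
Variables (r : nat) (I : finType).

Definition cube : finType := {ffun I -> 'I_r.+1}.

Implicit Types (a b : cube) (rho : cube -> int).

Definition axis (i : I) (t : 'I_r.+1) : cube :=
  [ffun j => if j == i then t else ord0].
Definition cube_le a b : Prop := forall i, (a i <= b i)%N.
Definition cube_max a b : cube := [ffun i => Order.max (a i) (b i)].
Definition cube_min a b : cube := [ffun i => Order.min (a i) (b i)].

(* b = a + e_i *)
Definition cube_succ (i : I) a b : Prop :=
  (b i = (a i).+1 :> nat) /\ (forall j, j != i -> b j = a j).

Record is_rank_function rho : Prop := IsRankFunction {
  rank_axis : forall i (t : 'I_r.+1), rho (axis i t) = r%:Z - t%:Z;
  rank_decr : forall a b, cube_le a b -> rho b <= rho a;
  rank_supermod : forall a b,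
    rho a + rho b <= rho (cube_max a b) + rho (cube_min a b);
  rank_range : forall a, -1 <= rho a <= r%:Z
}.

Definition is_jump rho a : Prop :=
  0 <= rho a /\ forall i b, cube_succ i a b -> rho b = rho a - 1.

Definition standard_rank a : int :=
  Num.max (-1) (r%:Z - \sum_i (a i : nat)%:Z).

End Hypercube.

(** * Slope structures *)

Record graph_slopes (R : realType) (r : nat) (G : metric_graph R) := GraphSlopes {
  gs_slope : dart G -> 'I_r.+1 -> int;
  gs_slope_incr : forall a (i j : 'I_r.+1),
    (i < j)%N -> gs_slope a i < gs_slope a j;
  gs_slope_rev : forall a i, gs_slope a i + gs_slope (drev a) (rev_ord i) = 0;
  gs_rank : forall v : vertex G, cube r (tangent_type (AtVertex v)) -> int;
  gs_rankP : forall v, is_rank_function (@gs_rank v)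
}.

Record slope_structure (R : realType) (r : nat) (G : metric_graph R) :=
  SlopeStructure {
    ss_model : model G;
    ss_simple : simple_graph (model_graph ss_model);
    ss_data :> graph_slopes r (model_graph ss_model)
  }.

Section GraphSlopes.
Variables (R : realType) (r : nat) (G : metric_graph R) (S : graph_slopes r G).

Definition rank_at (x : realization G) : cube r (tangent_type x) -> int :=
  match x with
  | AtVertex v => @gs_rank R r G S v
  | InEdge _ _ _ => @standard_rank r _
  end.

Definition slope_vector (x : realization G) (a : cube r (tangent_type x)) :
    {ffun tangent_type x -> int} :=
  [ffun nu => gs_slope S (val nu) (a nu)].

Definition allowed (x : realization G) : set {ffun tangent_type x -> int} :=
  [set slope_vector a | a in [set a | is_jump (@rank_at x) a]].

(* The tuple of outgoing slopes of f at x, usually denoted by a partial sign. *)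
Definition bd (f : realization G -> R) (x : realization G) :
    {ffun tangent_type x -> int} :=
  [ffun nu => slope f x (val nu)].

Definition graph_compatible (f : realization G -> R) : Prop :=
  forall x : realization G,
    (forall nu, nu \in tangent x -> exists i, slope f x nu = gs_slope S nu i) /\
    @allowed x (bd f x).

(* rho_x(bd_x f); the default value is irrelevant for compatible f, and the
   underlying a is unique since the slopes along each edge are increasing. *)
Definition bd_rank (f : realization G -> R) (x : realization G) : int :=
  if [pick a : cube r (tangent_type x) | slope_vector a == bd f x] is Some a
  then rank_at a else -1.

End GraphSlopes.

Section LinearSeries.
Variables (R : realType) (G : metric_graph R).
Implicit Types (D E : divisor G) (M : set (realization G -> R)).

Definition compatible r (S : slope_structure r G) (f : realization G -> R) : Prop :=
  Rat f /\ graph_compatible S (f \o model_map (ss_model S)).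

Definition RatDS D r (S : slope_structure r G) : set (realization G -> R) :=
  RatD D `&` [set f | compatible S f].

(** * Linear series *)

Definition semimodule M : Prop :=
  [/\ M `<=` @Rat R G,
      (forall f g, M f -> M g -> M (fun x => Num.min (f x) (g x))) &
      (forall f (c : R), M f -> M (fun x => f x + c))].

(* The topology of the sup norm is that of uniform convergence; Rat(D) is closed
   in the space of all functions, so the ambient space does not matter. *)
Definition admissible r D M : Prop :=
  [/\ semimodule M,
      M `<=` RatD D,
      closed (M : set {uniform realization G -> R}) &
      exists S : slope_structure r G,
        M `<=` RatDS D S /\
        forall E, effective E -> deg E = r%:Z ->
          exists f, [/\ M f,
            (forall x : realization (model_graph (ss_model S)),
               E (model_map (ss_model S) x) <=
                 bd_rank S (f \o model_map (ss_model S)) x) &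
            (forall x, 0 <= D x + ord_at f x - E x)]].

Definition finitely_generated M : Prop :=
  exists (n : nat) (f : 'I_n.+1 -> realization G -> R), (forall i, M (f i)) /\
    forall g, M g -> exists c : 'I_n.+1 -> R, forall x,
      g x = \big[Num.min/f ord0 x + c ord0]_(i < n.+1) (f i x + c i).

Definition tropically_dependent n (f : 'I_n -> realization G -> R) : Prop :=
  exists c : 'I_n -> R, forall x, exists i j, [/\ i != j,
    f i x + c i = f j x + c j & forall k, f i x + c i <= f k x + c k].

Definition rank_bound M (r : nat) : Prop :=
  forall f : 'I_r.+2 -> realization G -> R,
    (forall i, M (f i)) -> tropically_dependent f.

Definition tropical_rank M (r : nat) : Prop :=
  rank_bound M r /\ forall k, rank_bound M k -> (r <= k)%N.

Definition linear_series (r : nat) (d : int) D M : Prop :=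
  [/\ deg D = d, admissible r D M, finitely_generated M & tropical_rank M r].

End LinearSeries.

(** * Tropical modifications *)

(* G' is covered by isometric copies of G and of the trees, meeting only at the
   attaching points, so that its path metric is the gluing metric. *)
Record tropical_modification (R : realType) (G G' : metric_graph R) :=
  TropicalModification {
    tm_incl : realization G -> realization G';
    tm_count : nat;
    tm_tree : 'I_tm_count -> metric_graph R;
    tm_emb : forall i, realization (tm_tree i) -> realization G';
    tm_root : forall i, realization (tm_tree i);
    tm_attach : 'I_tm_count -> realization G;
    tm_retract : realization G' -> realization G;
    tm_treeP : forall i, is_tree (tm_tree i);
    tm_incl_isometric : isometric_embedding tm_incl;
    tm_emb_isometric : forall i, isometric_embedding (@tm_emb i);
    tm_glue : forall i, tm_emb (tm_root i) = tm_incl (tm_attach i);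
    tm_cover : forall z,
      (exists x, z = tm_incl x) \/
      (exists i (y : realization (tm_tree i)), z = tm_emb y);
    tm_meet_base : forall i (y : realization (tm_tree i)) x,
      tm_emb y = tm_incl x -> y = tm_root i;
    tm_meet_tree : forall i j (y : realization (tm_tree i))
        (y' : realization (tm_tree j)),
      i != j -> tm_emb y = tm_emb y' -> y = tm_root i /\ y' = tm_root j;
    tm_retract_incl : forall x, tm_retract (tm_incl x) = x;
    tm_retract_emb : forall i (y : realization (tm_tree i)),
      tm_retract (tm_emb y) = tm_attach i
  }.

(** * Finite harmonic morphisms *)

Section Morphisms.
Variables (R : realType) (G T : metric_graph R).
Implicit Type phi : realization G -> realization T.

(* Continuity of phi follows from its being affine on the closed edges. *)
Definition finite_morphism phi : Prop :=
  exists (A : model G) (B : model T),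
    (forall v : vertex (model_graph A), exists w : vertex (model_graph B),
       phi (model_map A (AtVertex v)) = model_map B (AtVertex w)) /\
    (forall e : edge (model_graph A),
       exists (b : dart (model_graph B)) (m : int),
         [/\ 0 < m, len b.1 = m%:~R * len e &
           forall t, 0 <= t <= len e ->
             phi (model_map A (epoint e t)) = model_map B (dpoint b (m%:~R * t))]).

(* phi_* mu = nu, with dilation factor m along mu. *)
Definition is_dilation phi (x : realization G) (mu : dart G) (nu : dart T) (m : int) :
    Prop :=
  0 < m /\ exists2 eps : R, 0 < eps &
    forall t, 0 <= t <= eps -> phi (move x mu t) = move (phi x) nu (m%:~R * t).

Definition pushes phi (x : realization G) (mu : dart G) (nu : dart T) : Prop :=
  exists m, is_dilation phi x mu nu m.

Definition dilation phi (x : realization G) (mu : dart G) (nu : dart T) : int :=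
  xget 0 [set m | is_dilation phi x mu nu m].

Definition dir_degree phi (x : realization G) (nu : dart T) : int :=
  \sum_(mu in tangent x | `[< pushes phi x mu nu >]) dilation phi x mu nu.

Definition harmonic_morphism phi : Prop := forall x nu nu',
  nu \in tangent (phi x) -> nu' \in tangent (phi x) ->
  dir_degree phi x nu = dir_degree phi x nu'.

(* The default value is irrelevant: tangent sets are nonempty. *)
Definition local_degree phi (x : realization G) : int :=
  if [pick nu in tangent (phi x)] is Some nu then dir_degree phi x nu else 0.

Definition has_degree phi (d : int) : Prop :=
  forall y : realization T, \sum_(x \in phi @^-1` [set y]) local_degree phi x = d.

End Morphisms.

(* Main.v *)
Require Import Defs.
From HB Require Import structures.
From mathcomp Require Import all_boot all_order all_algebra.
From mathcomp Require Import all_classical all_reals all_analysis.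
From mathcomp Require Import ring lra.
Set Implicit Arguments.
Unset Strict Implicit.
Unset Printing Implicit Defensive.
Import Order.TTheory GRing.Theory Num.Theory.
Local Open Scope classical_set_scope.
Local Open Scope ring_scope.

(** The obstacle is that a finite morphism must be given on models in which every edge covers a
    whole edge. So the tree is built as a finite object: its nodes are the truncations of the
    generators at finitely many levels, the values of the generators at vertices. The graph is
    subdivided three times. After the first time [D] lives on vertices and the generators are affine
    on edges. After the second the pairwise minima are affine too, so that a single generator is the
    largest one on a whole edge. After the third a largest generator takes a level as its value only
    at vertices, so that an edge passes over no node. The third subdivision adds no new level, which
    is why it need not be repeated. The comparison of [M] with [Rat(T, (y_0))] rests on an explicit
    description of the latter: up to constants its members grow with slope 1 along the path from the
    root to one point of the tree and are constant in all other directions. The function belonging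
    to a point of [T] pulls back to the truncation which that point stands for. *)

(* Since the constants lie in M, dependence of 0, g, h for g, h in M with minimum 0 gives a
   t >= 0 with min (g, h) = min (g, t) = min (h, t).  Hence the functions in M with minimum 0
   form a rooted tree T with root 0 and meet min, in which the ancestors of g are its
   truncations min (g, t).  By finite generation every such function is a truncation of one of
   finitely many generators f_i.  A point x is sent to the smallest g for which
   g (x) = max_i f_i (x); then any g in M with minimum 0 takes at x the height of the meet of
   g with the image of x, so M is pulled back from T.

   The rank condition at the midpoint of an edge shows that max_i f_i is not constant on it, so
   no edge is contracted.  At x let p be the sum of the dilation factors of the directions
   leading towards the root.  Applying D + div (g) >= 0 to constants and to functions g growing
   in a given direction, one sees that m = D (x) + p bounds the total dilation over each
   direction of T at the image of x.  Attaching the missing number of copies of the branch of T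
   in that direction makes the map harmonic of local degree m at x.  Exactly D (x) of the
   branches attached at x contain the root, unless x lies over the root, where p = 0; so the
   degree is the degree of D. *)

(** * Points and the path metric *)

Section Points.
Variables (R : realType) (G : metric_graph R).
Implicit Types (e : edge G) (v : vertex G) (x y z : realization G).

Lemma InEdge_eq e t t' (h : 0 < t < len e) (h' : 0 < t' < len e) :
  t = t' -> InEdge h = InEdge h'.
Proof. by move=> ett'; subst t'; congr InEdge; exact: bool_irrelevance. Qed.

Lemma epoint_in e t (h : 0 < t < len e) : epoint e t = InEdge h.
Proof.
rewrite /epoint; case: {-}_ / (boolP _) => [h'|nh]; first exact: (InEdge_eq _ _ erefl).
by rewrite h in nh.
Qed.

Lemma epoint_src e t : t <= 0 -> epoint e t = AtVertex (src e).
Proof.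
move=> t0; rewrite /epoint; case: {-}_ / (boolP _) => [h'|nh].
  by exfalso; move: h'; rewrite ltNge t0.
by rewrite t0.
Qed.

Lemma epoint_tgt e t : len e <= t -> epoint e t = AtVertex (tgt e).
Proof.
move=> t0; rewrite /epoint; case: {-}_ / (boolP _) => [h'|nh].
  by exfalso; move: h'; rewrite [t < _]ltNge t0 andbF.
by rewrite leNgt (lt_le_trans (len_gt0 e) t0).
Qed.

Lemma epoint0 e : epoint e 0 = AtVertex (src e).
Proof. exact: epoint_src. Qed.

Lemma epoint_len e : epoint e (len e) = AtVertex (tgt e).
Proof. exact: epoint_tgt. Qed.

Lemma realizationP x :
  (exists v, x = AtVertex v) \/ (exists e t, 0 < t < len e /\ x = epoint e t).
Proof.
case: x => [v|e t h]; first by left; exists v.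
by right; exists e, t; split=> //; rewrite (epoint_in h).
Qed.

Variant epoint_spec e t : realization G -> Type :=
| EpointSrc of t = 0 : epoint_spec e t (AtVertex (src e))
| EpointTgt of t = len e : epoint_spec e t (AtVertex (tgt e))
| EpointIn (h : 0 < t < len e) : epoint_spec e t (InEdge h).

Lemma epointP e t : 0 <= t <= len e -> epoint_spec e t (epoint e t).
Proof.
move=> /andP[t0 tl].
have [->|tn0] := eqVneq t 0; first by rewrite epoint0; constructor.
have [->|tnl] := eqVneq t (len e); first by rewrite epoint_len; constructor.
have h : 0 < t < len e by rewrite !lt_def t0 tn0 tl eq_sym tnl.
by rewrite (epoint_in h); constructor.
Qed.

Lemma InEdge_inj e e' t t' (h : 0 < t < len e) (h' : 0 < t' < len e') :
  InEdge h = InEdge h' -> e = e' /\ t = t'.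
Proof. by case. Qed.

Lemma AtVertex_inj : injective (@AtVertex R G).
Proof. by move=> v v' []. Qed.

Lemma epoint_inj e e' t t' : 0 < t < len e -> epoint e t = epoint e' t' ->
  e = e' /\ t = t'.
Proof.
move=> h; rewrite (epoint_in h) /epoint.
case: {-}_ / (boolP _) => [h'|nh]; first exact: InEdge_inj.
by case: ifP.
Qed.

Lemma epointNvertex e t v : 0 < t < len e -> epoint e t <> AtVertex v.
Proof. by move=> h; rewrite (epoint_in h). Qed.

Lemma mid_in e : 0 < len e / 2 < len e.
Proof. have := len_gt0 e; lra. Qed.

(** Connectedness and the existence of an edge exclude isolated vertices. This keeps the default
    value in [local_degree] from being taken at a vertex. *)
Lemma exists_dart v : exists a : dart G, dtail a = v.
Proof.
have [e0 _] : exists e0 : edge G, true.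
  by have /card_gt0P[e _] := edge_gt0 G; exists e.
have [<-|ne] := eqVneq (src e0) v; first by exists (e0, false).
have /connectP[[|u p]] := graph_connected v (src e0).
  by move=> _ /= E; rewrite E eqxx in ne.
rewrite /= => /andP[/existsP[e /orP[|]/andP[/eqP h1 /eqP h2]] _] _.
  by exists (e, false).
by exists (e, true).
Qed.

End Points.

Section Distance.
Variables (R : realType) (G : metric_graph R).
Implicit Types (e : edge G) (v : vertex G) (x y z : realization G).

Lemma walk_len_ge0 (w : seq (edge G * R * R)) : 0 <= walk_len w.
Proof. by rewrite /walk_len sumr_ge0. Qed.

Lemma walk_cat x y z w w' : is_walk x w y -> is_walk y w' z -> is_walk x (w ++ w') z.
Proof.
elim: w x => [|[[e s] t] w IH] x /=; first by move=> ->.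
by move=> [? ? ? h] h'; split=> //; exact: IH.
Qed.

Lemma walk_len_cat (w w' : seq (edge G * R * R)) :
  walk_len (w ++ w') = walk_len w + walk_len w'.
Proof. by rewrite /walk_len big_cat. Qed.

Lemma walk_rev x y w : is_walk x w y -> exists w', is_walk y w' x.
Proof.
elim: w x => [|[[e s] t] w IH] x /=; first by move=> ->; exists [::].
move=> [hs ht -> /IH[w' hw']]; exists (w' ++ [:: (e, t, s)]).
by apply: (walk_cat hw').
Qed.

Lemma walk_vertices u v : exists w, is_walk (AtVertex u) w (@AtVertex R G v).
Proof.
have := graph_connected u v => /connectP[p].
elim: p u => [|u' p IH] u /=; first by move=> _ ->; exists [::].
move=> /andP[/existsP[e he] hp] hl.
have [w hw] := IH _ hp hl.
have l0 : 0 <= len e := ltW (len_gt0 e).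
case/orP: he => /andP[/eqP h1 /eqP h2].
  by exists ((e, 0, len e) :: w); split; rewrite ?lexx ?l0 ?epoint0 ?epoint_len ?h1 ?h2.
by exists ((e, len e, 0) :: w); split; rewrite ?lexx ?l0 ?epoint0 ?epoint_len ?h1 ?h2.
Qed.

Lemma walk_to_vertex x : exists v w, is_walk x w (AtVertex v).
Proof.
have [[v ->]|[e [t [/andP[t0 tl] ->]]]] := realizationP x; first by exists v, [::].
exists (src e), [:: (e, t, 0)]; have l0 := ltW (len_gt0 e).
by split; rewrite ?lexx ?l0 ?(ltW t0) ?(ltW tl) //= epoint0.
Qed.

Lemma walk_exists x y : exists w, is_walk x w y.
Proof.
have [u [w hw]] := walk_to_vertex x.
have [v [w' hw']] := walk_to_vertex y.
have [w2 h2] := walk_vertices u v.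
have [w3 h3] := walk_rev hw'.
by exists (w ++ (w2 ++ w3)); apply: (walk_cat hw); apply: walk_cat h3.
Qed.

Lemma path_dist_le x y w : is_walk x w y -> path_dist x y <= walk_len w.
Proof.
move=> h; apply: ge_inf; last by exists w.
by exists 0 => _ [w' _ <-]; exact: walk_len_ge0.
Qed.

Lemma path_dist_glb x y (c : R) :
  (forall w, is_walk x w y -> c <= walk_len w) -> c <= path_dist x y.
Proof.
move=> h; apply: lb_le_inf; last by move=> _ [w hw <-]; exact: h.
by have [w hw] := walk_exists x y; exists (walk_len w), w.
Qed.

Lemma path_dist_triangle x y z : path_dist x z <= path_dist x y + path_dist y z.
Proof.
rewrite -lerBlDr; apply: path_dist_glb => w hw.
rewrite lerBlDl -lerBlDr; apply: path_dist_glb => w' hw'.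
rewrite lerBlDr addrC -walk_len_cat; apply: path_dist_le; exact: walk_cat hw hw'.
Qed.

Lemma path_distxx x : path_dist x x <= 0.
Proof. by have := @path_dist_le x x [::] erefl; rewrite /walk_len big_nil. Qed.

Lemma path_dist_edge e s t : 0 <= s <= len e -> 0 <= t <= len e ->
  path_dist (epoint e s) (epoint e t) <= `|s - t|.
Proof.
move=> hs ht; have := @path_dist_le (epoint e s) (epoint e t) [:: (e, s, t)].
by rewrite /walk_len big_seq1 /= distrC => h; apply: h.
Qed.

End Distance.

Section Lipschitz.
Variables (R : realType) (G H : metric_graph R).

(** The triangle inequality along a walk reduces the bound to single closed edges. *)
Lemma lipschitz_from_edges (F : realization G -> realization H) :
  (forall e s t, 0 <= s <= len e -> 0 <= t <= len e ->
     path_dist (F (epoint e s)) (F (epoint e t)) <= `|s - t|) ->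
  forall x y, path_dist (F x) (F y) <= path_dist x y.
Proof.
move=> hF x y; apply: path_dist_glb => w.
elim: w x => [|[[e s] t] w IH] x /=.
  by move=> ->; rewrite (le_trans (path_distxx _)) ?walk_len_ge0.
move=> [hs ht -> hw]; rewrite /walk_len big_cons /=.
apply: (le_trans (path_dist_triangle _ (F (epoint e t)) _)).
by apply: lerD; [rewrite distrC; exact: hF|exact: IH].
Qed.

(** A left inverse that does not increase distances turns the Lipschitz bound into an equality, so
    no infimum over walks has to be computed for subdivisions and attached trees. *)
Lemma isometric_from_retraction (F : realization G -> realization H)
    (K : realization H -> realization G) : cancel F K ->
  (forall x y, path_dist (F x) (F y) <= path_dist x y) ->
  (forall x y, path_dist (K x) (K y) <= path_dist x y) ->
  isometric_embedding F.
Proof.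
move=> FK hF hK x y; apply/eqP; rewrite eq_le hF /=.
by rewrite -{1}(FK x) -{1}(FK y).
Qed.

End Lipschitz.

(** * Slopes *)

Section Slopes.
Variables (R : realType) (G : metric_graph R).
Implicit Types (f g : realization G -> R) (e : edge G) (x y : realization G).

Lemma dpoint0 (a : dart G) : dpoint a 0 = AtVertex (dtail a).
Proof.
by case: a => e [] /=; rewrite /dpoint /dtail /= ?subr0 ?epoint_len ?epoint0.
Qed.

Lemma is_slope_uniq f x a s s' : is_slope f x a s -> is_slope f x a s' -> s = s'.
Proof.
move=> [eps e0 h] [eps' e0' h'].
have m0 : 0 < Num.min eps eps' by rewrite lt_min e0 e0'.
have := h (Num.min eps eps'); rewrite h' ?(ltW m0) ?ge_min ?lexx ?orbT //.
move=> /(_ isT) /addrI /(mulIf (lt0r_neq0 m0)).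
by move=> /eqP; rewrite eqr_int => /eqP.
Qed.

Lemma slopeE f x a s : is_slope f x a s -> slope f x a = s.
Proof.
move=> h; rewrite /slope; apply: (xget_unique 0 h) => s' h'.
exact: is_slope_uniq h' h.
Qed.

Lemma eq_slope (H : metric_graph R) f x a (g : realization H -> R) z b :
  (forall s, is_slope f x a s <-> is_slope g z b s) -> slope f x a = slope g z b.
Proof.
move=> h; rewrite /slope; congr xget; apply/seteqP.
by split => s /h.
Qed.

Lemma is_slope_const (c : R) x a : is_slope (fun=> c) x a 0.
Proof. by exists 1 => // t _; rewrite mul0r addr0. Qed.

Lemma ord_const (c : R) x : ord_at (fun=> c) x = 0.
Proof.
rewrite /ord_at big1 ?oppr0 // => a _; exact/slopeE/is_slope_const.
Qed.

Lemma ord_addc f (c : R) x : ord_at (fun y => f y + c) x = ord_at f x.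
Proof.
congr (- _); apply: eq_bigr => a _; apply: eq_slope => s.
split=> -[eps e0 h]; exists eps => // t /h E; last by rewrite E addrAC.
by apply: (addIr c); rewrite E addrAC.
Qed.

Lemma sum_tangent_vertex (V : nmodType) v (F : dart G -> V) :
  \sum_(a in tangent (AtVertex v)) F a =
  \sum_(e | src e == v) F (e, false) + \sum_(e | tgt e == v) F (e, true).
Proof.
have E : \sum_(a in tangent (AtVertex v)) F a =
   \sum_(e : edge G) \sum_(b : bool | dtail (e, b) == v) F (e, b).
  rewrite pair_big_dep /=; apply: eq_big; first by case=> e b; rewrite inE.
  by case.
rewrite E !(big_mkcond (fun e => _ == v)) /= -big_split /=.
apply: eq_bigr => e _; rewrite big_mkcond /= big_bool addrC.
by rewrite /dtail /=.
Qed.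

Lemma sum_tangent_edge (V : nmodType) e t (h : 0 < t < len e) (F : dart G -> V) :
  \sum_(a in tangent (InEdge h)) F a = F (e, false) + F (e, true).
Proof.
rewrite (bigD1 (e, false)) /=; last by rewrite inE eqxx.
rewrite (big_pred1 (e, true)) // => -[e' b].
by rewrite inE /= !xpair_eqE; case: (e' == e); case: b.
Qed.

(** The data hidden in the existential of [Rat], named so that slopes can be read off from them. *)
Definition pieces f e (n : nat) (t : nat -> R) (s : nat -> int) :=
  [/\ t 0%N = 0, t n = len e &
    forall i, (i < n)%N -> t i < t i.+1 /\
      forall u, t i <= u <= t i.+1 ->
        f (epoint e u) = f (epoint e (t i)) + (s i)%:~R * (u - t i)].

Section Pieces.
Variables (f : realization G -> R) (e : edge G) (n : nat) (t : nat -> R) (s : nat -> int).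
Hypothesis P : pieces f e n t s.

Let t0 : t 0%N = 0. Proof. by case: P. Qed.
Let tn : t n = len e. Proof. by case: P. Qed.

Lemma pieces_lt i j : (i < j)%N -> (j <= n)%N -> t i < t j.
Proof.
case: P => _ _ h; elim: j => // j IH; rewrite ltnS leq_eqVlt => /predU1P[->|ij] jn.
  by case: (h _ jn).
by apply: lt_trans (IH ij (ltnW jn)) _; case: (h _ jn).
Qed.

Lemma pieces_le i j : (i <= j)%N -> (j <= n)%N -> t i <= t j.
Proof. by rewrite leq_eqVlt => /predU1P[->//|ij] jn; exact/ltW/pieces_lt. Qed.

Lemma pieces_gt0 : (0 < n)%N.
Proof.
case: n tn => // h; have := len_gt0 e; by rewrite -h t0 ltxx.
Qed.

Lemma pieces_aff i u : (i < n)%N -> t i <= u <= t i.+1 ->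
  f (epoint e u) = f (epoint e (t i)) + (s i)%:~R * (u - t i).
Proof. by case: P => _ _ h /h[_]; apply. Qed.

Lemma pieces_aff2 i u u' : (i < n)%N -> t i <= u <= t i.+1 -> t i <= u' <= t i.+1 ->
  f (epoint e u) = f (epoint e u') + (s i)%:~R * (u - u').
Proof.
by move=> hi hu hu'; rewrite (pieces_aff hi hu) (pieces_aff hi hu'); ring.
Qed.

Lemma pieces_locate u : 0 <= u < len e -> exists i, (i < n)%N /\ t i <= u < t i.+1.
Proof.
move=> /andP[u0 ul].
have ex : exists j, u < t j by exists n; rewrite tn.
case: (ex_minnP ex) => -[|j] hj hmin; first by move: hj; rewrite t0 ltNge u0.
exists j; have jn : (j < n)%N by apply: hmin; rewrite tn.
split=> //; rewrite hj andbT leNgt; apply/negP => /hmin; by rewrite ltnn.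
Qed.

Lemma pieces_slope_up i u (h : 0 < u < len e) : (i < n)%N -> t i <= u < t i.+1 ->
  is_slope f (InEdge h) (e, false) (s i).
Proof.
move=> hi /andP[h1 h2]; exists (t i.+1 - u); first by rewrite subr_gt0.
move=> r /andP[r0 r1]; rewrite /= -(epoint_in h).
rewrite (@pieces_aff2 i _ u) //; first (by rewrite addrAC subrr add0r);
by apply/andP; split; lra.
Qed.

Lemma pieces_slope_down i u (h : 0 < u < len e) : (i < n)%N -> t i < u <= t i.+1 ->
  is_slope f (InEdge h) (e, true) (- s i).
Proof.
move=> hi /andP[h1 h2]; exists (u - t i); first by rewrite subr_gt0.
move=> r /andP[r0 r1]; rewrite /= -(epoint_in h).
rewrite (@pieces_aff2 i _ u) //; first (by rewrite addrAC subrr add0r mulrN intrN mulNr);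
by apply/andP; split; lra.
Qed.

Lemma pieces_slope_src : is_slope f (AtVertex (src e)) (e, false) (s 0%N).
Proof.
have n0 := pieces_gt0; exists (t 1%N); first by rewrite -t0 pieces_lt.
move=> r hr; rewrite /= /dpoint /= -epoint0 (@pieces_aff2 0%N _ 0) ?subr0 ?t0 //.
by rewrite lexx -t0 pieces_le.
Qed.

Lemma pieces_slope_tgt : is_slope f (AtVertex (tgt e)) (e, true) (- s n.-1).
Proof.
have n0 := pieces_gt0; have hn : (n.-1 < n)%N by rewrite prednK.
have tl : t n.-1.+1 = len e by rewrite prednK.
have hl : t n.-1 < len e by rewrite -tn pieces_lt.
exists (len e - t n.-1); first by rewrite subr_gt0.
move=> r /andP[r0 r1]; rewrite /= /dpoint /= -epoint_len.
rewrite (@pieces_aff2 n.-1 _ (len e)) ?tl //; first (by rewrite addrAC subrr add0r mulrN intrN mulNr);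
by apply/andP; split; lra.
Qed.

Lemma pieces_ord_break i (h : 0 < t i.+1 < len e) : (i.+1 < n)%N ->
  ord_at f (InEdge h) = s i - s i.+1.
Proof.
move=> hi; rewrite /ord_at sum_tangent_edge.
rewrite (slopeE (pieces_slope_up h hi _)); last by rewrite lexx pieces_lt.
rewrite (slopeE (pieces_slope_down h (ltnW hi) _)); last by rewrite lexx pieces_lt // ltnW.
by rewrite opprD opprK addrC.
Qed.

Lemma pieces_break_in i : (i.+1 < n)%N -> 0 < t i.+1 < len e.
Proof. by move=> hi; rewrite -{1}t0 -tn !pieces_lt // ltnW. Qed.

Lemma pieces_ord_in i u (h : 0 < u < len e) : (i < n)%N -> t i < u < t i.+1 ->
  ord_at f (InEdge h) = 0.
Proof.
move=> hi /andP[h1 h2]; rewrite /ord_at sum_tangent_edge.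
rewrite (slopeE (pieces_slope_up h hi _)); last by rewrite (ltW h1).
rewrite (slopeE (pieces_slope_down h hi _)); last by rewrite h1 (ltW h2).
by rewrite subrr oppr0.
Qed.

End Pieces.

Lemma Rat_pieces f e : Defs.Rat f -> exists n t s, pieces f e n t s.
Proof. by move=> /(_ e)[n [t [s h]]]; exists n, t, s. Qed.

Lemma Rat_slope f x a : Defs.Rat f -> a \in tangent x -> exists s, is_slope f x a s.
Proof.
move=> hf; case: x => [v|e u h]; rewrite inE; case: a => e' b /=.
  move=> /eqP hv; have [n [t [s P]]] := Rat_pieces e' hf.
  move: hv; rewrite /dtail /=; case: b => <-.
    by exists (- s n.-1); exact: pieces_slope_tgt P.
  by exists (s 0%N); exact: pieces_slope_src P.
move=> /eqP ->; have [n [t [s P]]] := Rat_pieces e hf.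
have hu : 0 <= u < len e by move: h => /andP[/ltW -> ->].
have [i [hi /andP[h1 h2]]] := pieces_locate P hu.
case: b; last by exists (s i); apply: (pieces_slope_up P) => //; rewrite h1.
(* At the left end of its piece, the slope backwards is read off from the preceding piece. *)
have [E|ne] := eqVneq (t i) u; last first.
  exists (- s i); apply: (pieces_slope_down P) => //; by rewrite lt_def eq_sym ne h1 ltW.
case: i hi E h1 h2 => [|i] hi E h1 h2.
  by exfalso; move: h; rewrite -E; case: P => -> _ _; rewrite ltxx.
exists (- s i); apply: (pieces_slope_down P); first exact: ltnW.
by rewrite -E lexx (pieces_lt P) // ltnW.
Qed.

Definition edge_affine f e (s : int) := forall u, 0 <= u <= len e ->
  f (epoint e u) = f (AtVertex (src e)) + s%:~R * u.

(** The order at a breakpoint is the drop of the slope there, so all pieces have the slope of the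
    first. *)
Lemma Rat_affine f : Defs.Rat f ->
  (forall e u (h : 0 < u < len e), ord_at f (InEdge h) = 0) ->
  forall e, exists s, edge_affine f e s.
Proof.
move=> hf h0 e; have [n [t [s P]]] := Rat_pieces e hf.
have hs i : (i < n)%N -> s i = s 0%N.
  elim: i => // i IH hi; rewrite -IH ?(ltnW hi) //.
  have := h0 e _ (pieces_break_in P hi); rewrite (pieces_ord_break P) //.
  by move=> /subr0_eq.
exists (s 0%N) => u /andP[u0 u1].
have n0 := pieces_gt0 P.
have [t0 tn _] := P.
have key i : (i <= n)%N -> f (epoint e (t i)) = f (AtVertex (src e)) + (s 0%N)%:~R * t i.
  elim: i => [|i IH] hi; first by rewrite t0 mulr0 addr0 epoint0.
  rewrite (@pieces_aff _ _ _ _ _ P i) //; last by rewrite lexx (pieces_le P).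
  by rewrite IH ?(ltnW hi) // hs //; ring.
have [ul|ul] := ltP u (len e); last first.
  by rewrite (le_anti (introT andP (conj u1 ul))) -tn key.
have hu : 0 <= u < len e by rewrite u0.
have [i [hi /andP[h1 h2]]] := pieces_locate P hu.
rewrite (@pieces_aff _ _ _ _ _ P i) ?h1 ?(ltW h2) // key ?(ltnW hi) // hs //; ring.
Qed.

(** Inside an edge only breakpoints can have nonzero order. Finiteness is what allows all these
    points to be made vertices. *)
Lemma Rat_ord_finite f : Defs.Rat f -> finite_set [set x | ord_at f x != 0].
Proof.
move=> hf.
apply: (@sub_finite_set _ _ (range (@AtVertex R G) `|`
   \bigcup_(e in [set: edge G]) [set x | exists u (h : 0 < u < len e), x = InEdge h /\ ord_at f x != 0])).
  case=> [v|e u h] /= ho; first by left; exists v.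
  by right; exists e => //=; exists u, h.
rewrite finite_setU; split; first exact: finite_image (@finite_finset _ _).
apply: bigcup_finite; first exact: finite_finset.
move=> e _; have [n [t [s P]]] := Rat_pieces e hf.
apply: (@sub_finite_set _ _ ((fun i => epoint e (t i)) @` `I_n)); last exact/finite_image/finite_II.
move=> x /= [u [h [-> ho]]].
have hu : 0 <= u < len e by case/andP: (h) => /ltW -> ->.
have [i [hi /andP[h1 h2]]] := pieces_locate P hu.
exists i => //; rewrite -(epoint_in h); congr epoint.
apply/eqP; apply: contraNT ho => ne; apply/eqP/(pieces_ord_in P h hi).
by rewrite lt_def eq_sym ne h1.
Qed.

End Slopes.

(** * Subdivisions *)

Section Adjacency.
Variables (V E : finType) (s t : E -> V).

(** Unfolds to the relation in [graph_connected], so that results on it serve as that field of a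
    constructed graph. *)
Definition graph_adj : rel V := fun a b =>
  [exists e, ((s e == a) && (t e == b)) || ((s e == b) && (t e == a))].

Lemma graph_adj_sym : symmetric graph_adj.
Proof. by move=> a b; apply: eq_existsb => e; rewrite orbC. Qed.

Lemma graph_adj_edge e : graph_adj (s e) (t e).
Proof. by apply/existsP; exists e; rewrite !eqxx. Qed.

Lemma connect_edge e : connect graph_adj (s e) (t e).
Proof. exact/connect1/graph_adj_edge. Qed.

Lemma connected_to_root r : (forall v, connect graph_adj v r) ->
  forall u v, connect graph_adj u v.
Proof.
move=> h u v; apply: connect_trans (h u) _.
by rewrite (sym_connect_sym graph_adj_sym).
Qed.

End Adjacency.

Lemma connect_morph (V E V' E' : finType) (s t : E -> V) (s' t' : E' -> V') (F : V -> V') :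
  (forall e, connect (graph_adj s' t') (F (s e)) (F (t e))) ->
  forall u v, connect (graph_adj s t) u v -> connect (graph_adj s' t') (F u) (F v).
Proof.
move=> hF u v /connectP[p]; elim: p u => [|w p IH] u /=; first by move=> _ ->.
move=> /andP[/existsP[e he] hp] hl; apply: connect_trans (IH _ hp hl).
case/orP: he => /andP[/eqP <- /eqP <-]; first exact: hF.
by rewrite (sym_connect_sym (graph_adj_sym _ _)).
Qed.

Section Refinement.
Variable R : realType.

(* [p] identifies [G'] with [G] so that functions and their divisors correspond. *)
Definition refines (G' G : metric_graph R) (p : realization G' -> realization G) :=
  [/\ bijective p, isometric_embedding p,
      forall f, Defs.Rat f -> Defs.Rat (f \o p) &
      forall f x, ord_at (f \o p) x = ord_at f (p x)].

Lemma refines_id (G : metric_graph R) : refines (@id (realization G)).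
Proof. by split=> //; exists id. Qed.

Lemma refines_comp (G1 G2 G3 : metric_graph R) (p : realization G1 -> realization G2)
  (q : realization G2 -> realization G3) : refines p -> refines q -> refines (q \o p).
Proof.
move=> [p1 p2 p3 p4] [q1 q2 q3 q4]; split.
- exact: bij_comp.
- by move=> x y; rewrite /= q2 p2.
- by move=> f /q3/p3.
- by move=> f x; exact: etrans (p4 (f \o q) x) (q4 f (p x)).
Qed.

Lemma is_slope_transfer (G' G : metric_graph R) (p : realization G' -> realization G)
    x a y b (eps0 : R) f s : 0 < eps0 -> p x = y ->
  (forall r, 0 <= r <= eps0 -> p (move x a r) = move y b r) ->
  is_slope (f \o p) x a s <-> is_slope f y b s.
Proof.
move=> e0 hx hp; split=> -[eps he h]; exists (Num.min eps eps0); rewrite ?lt_min ?he ?e0 // => r.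
  move=> /andP[r0]; rewrite le_min => /andP[r1 r2].
  by rewrite -hp ?r0 // -hx; apply: h; rewrite r0.
move=> /andP[r0]; rewrite le_min => /andP[r1 r2].
by rewrite /= hp ?r0 // hx; apply: h; rewrite r0.
Qed.

End Refinement.

Section Split.
Variables (R : realType) (G : metric_graph R) (e0 : edge G) (t0 : R).
Hypothesis h0 : 0 < t0 < len e0.

(* The edge [Some e0] of the split graph is the lower part of [e0] and [None] its upper part;
   the new vertex is [None]. *)
Definition split_src (e : option (edge G)) : option (vertex G) :=
  if e is Some e then Some (src e) else None.
Definition split_tgt (e : option (edge G)) : option (vertex G) :=
  if e is Some e then (if e == e0 then None else Some (tgt e)) else Some (tgt e0).
Definition split_len (e : option (edge G)) : R :=
  if e is Some e then (if e == e0 then t0 else len e) else len e0 - t0.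

Lemma split_len_gt0 e : 0 < split_len e.
Proof.
case: e => [e|] /=; last by rewrite subr_gt0; case/andP: h0.
by case: ifP => _; [case/andP: h0|exact: len_gt0].
Qed.

Lemma split_edge_gt0 : (0 < #|{: option (edge G)}|)%N.
Proof. by apply/card_gt0P; exists None. Qed.

Lemma split_connected u v : connect (graph_adj split_src split_tgt) u v.
Proof.
have h1 : connect (graph_adj split_src split_tgt) (Some (src e0)) None.
  by have := connect_edge split_src split_tgt (Some e0); rewrite /= eqxx.
have h2 : connect (graph_adj split_src split_tgt) None (Some (tgt e0)).
  exact: (connect_edge split_src split_tgt None).
apply: (@connected_to_root _ _ _ _ (Some (src e0))) => {u v} -[v|]; last first.
  by rewrite (sym_connect_sym (graph_adj_sym _ _)).
apply: (connect_morph (s := @src R G) (t := @tgt R G)); last exact: graph_connected.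
move=> e; have [->|ne] := eqVneq e e0; first exact: connect_trans h2.
by have := connect_edge split_src split_tgt (Some e); rewrite /= (negPf ne).
Qed.

Definition split_graph : metric_graph R :=
  MetricGraph split_len_gt0 split_edge_gt0 split_connected.

Notation G' := split_graph.

Definition split_map (x : realization G') : realization G :=
  match x with
  | AtVertex v => if v is Some v then AtVertex v else epoint e0 t0
  | InEdge e t _ => if e is Some e then epoint e t else epoint e0 (t0 + t)
  end.

(** At [t = t0] the lower part is used, where [epoint] at full length already is the new vertex. *)
Definition split_inv (x : realization G) : realization G' :=
  match x with
  | AtVertex v => @AtVertex R G' (Some v)
  | InEdge e t _ => if e == e0 then
      if t <= t0 then @epoint R G' (Some e) t else @epoint R G' None (t - t0)
      else @epoint R G' (Some e) t
  end.

Lemma split_map_some e t : 0 <= t <= split_len (Some e) ->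
  split_map (@epoint R G' (Some e) t) = epoint e t.
Proof.
move=> h; case: (@epointP R G' (Some e) t h) => [->|->|//] /=; first by rewrite epoint0.
by case: eqP => [->|_]; rewrite ?epoint_len.
Qed.

Lemma split_map_none t : 0 <= t <= len e0 - t0 ->
  split_map (@epoint R G' None t) = epoint e0 (t0 + t).
Proof.
move=> h; case: (@epointP R G' None t h) => [->|->|//] /=; first by rewrite addr0.
by rewrite addrC subrK epoint_len.
Qed.

Lemma split_inv_other e t : e != e0 -> 0 <= t <= len e ->
  split_inv (epoint e t) = @epoint R G' (Some e) t.
Proof.
move=> ne ht; case: epointP => // [->|->|h] /=; first by rewrite (@epoint0 R G').
  by have := @epoint_len R G' (Some e); rewrite /= /split_len (negPf ne) => ->.
by rewrite (negPf ne).
Qed.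

Lemma split_inv_low t : 0 <= t <= t0 ->
  split_inv (epoint e0 t) = @epoint R G' (Some e0) t.
Proof.
move=> /andP[t1 t2]; case/andP: h0 => h1 h2.
case: epointP => [|E|E|h] /=.
- by rewrite t1 (le_trans t2 (ltW h2)).
- by rewrite E (@epoint0 R G').
- by move: h2; rewrite -E ltNge t2.
- by rewrite eqxx t2.
Qed.

Lemma split_inv_high t : t0 <= t <= len e0 ->
  split_inv (epoint e0 t) = @epoint R G' None (t - t0).
Proof.
move=> /andP[t1 t2]; case/andP: (h0) => h1 h2.
case: epointP => [|E|E|h] /=.
- by rewrite t2 (le_trans (ltW h1) t1).
- by move: h1; rewrite -E ltNge t1.
- by rewrite E; rewrite (@epoint_len R G' None).
- rewrite eqxx; case: ifP => // t3.
  have -> : t = t0 by apply/eqP; rewrite eq_le t1 t3.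
  rewrite subrr (@epoint0 R G' None) /=.
  by have := @epoint_len R G' (Some e0); rewrite /= eqxx.
Qed.

Lemma split_mapK : cancel split_map split_inv.
Proof.
move=> x; case: (realizationP x) => [[[v|] ->] //=|[[e|] [t [/andP[t1 t2] ->]]]].
- rewrite split_inv_low; last by case/andP: h0 => /ltW-> _; rewrite lexx.
  by have := @epoint_len R G' (Some e0); rewrite /= eqxx.
- rewrite split_map_some ?(ltW t1) ?(ltW t2) //.
  move: t2; rewrite /= ; case: eqP => [-> t2|/eqP ne t2].
    by rewrite split_inv_low // (ltW t1) ltW.
  by rewrite split_inv_other // (ltW t1) ltW.
- move: t2 => /= t2; rewrite split_map_none ?(ltW t1) ?(ltW t2) // split_inv_high.
    by rewrite addrAC subrr add0r.
  by rewrite lerDl (ltW t1) -lerBrDl ltW.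
Qed.

Lemma split_invK : cancel split_inv split_map.
Proof.
move=> x; case: (realizationP x) => [[v ->] //=|[e [t [/andP[t1 t2] ->]]]].
have [Ee|ne] := eqVneq e e0; last first.
  by rewrite split_inv_other ?(ltW t1) ?(ltW t2) // split_map_some //= (negPf ne) !ltW.
subst e; have [t3|t3] := leP t t0.
  by rewrite split_inv_low ?(ltW t1) // split_map_some //= eqxx (ltW t1).
rewrite split_inv_high ?(ltW t3) ?(ltW t2) // split_map_none; first by rewrite addrC subrK.
by rewrite subr_ge0 (ltW t3) lerB // ltW.
Qed.

Lemma split_map_lipschitz x y : path_dist (split_map x) (split_map y) <= path_dist x y.
Proof.
apply: lipschitz_from_edges => -[e|] s t hs ht.
  rewrite !split_map_some //; apply: path_dist_edge.
    move: hs => /=; case: eqP => [->|//] /andP[-> /le_trans]; apply.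
    by case/andP: h0 => _ /ltW.
  move: ht => /=; case: eqP => [->|//] /andP[-> /le_trans]; apply.
  by case/andP: h0 => _ /ltW.
move: hs ht => /= hs ht; rewrite !split_map_none //.
have -> : s - t = (t0 + s) - (t0 + t) by ring.
by case/andP: h0 => h1 h2; apply: path_dist_edge; lra.
Qed.

Lemma split_inv_lipschitz x y : path_dist (split_inv x) (split_inv y) <= path_dist x y.
Proof.
apply: lipschitz_from_edges => e s t hs ht.
have [Ee|ne] := eqVneq e e0; last first.
  rewrite !split_inv_other //.
  by apply: path_dist_edge; rewrite /= (negPf ne).
subst e; case/andP: (h0) => h1 h2.
have low s1 t1 : 0 <= s1 <= t0 -> 0 <= t1 <= t0 ->
    path_dist (split_inv (epoint e0 s1)) (split_inv (epoint e0 t1)) <= `|s1 - t1|.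
  move=> hs1 ht1; rewrite !split_inv_low //.
  by apply: path_dist_edge; rewrite /= eqxx.
have high s1 t1 : t0 <= s1 <= len e0 -> t0 <= t1 <= len e0 ->
    path_dist (split_inv (epoint e0 s1)) (split_inv (epoint e0 t1)) <= `|s1 - t1|.
  move=> hs1 ht1; rewrite !split_inv_high //.
  have -> : s1 - t1 = (s1 - t0) - (t1 - t0) by ring.
  by apply: path_dist_edge => /=; lra.
case/andP: hs => s0 s1; case/andP: ht => t1 t2.
have [st|st] := leP s t0; have [tt|tt] := leP t t0.
- by apply: low; rewrite ?s0 ?t1.
(* The points lie on different parts of [e0]; the distance is split at the new vertex. *)
- apply: (le_trans (path_dist_triangle _ (split_inv (epoint e0 t0)) _)).
  have := low s t0; have := high t0 t; rewrite !lexx s0 st (ltW h1) (ltW h2) (ltW tt) t2.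
  move=> /(_ isT isT) A /(_ isT isT) B; apply: (le_trans (lerD B A)).
  by rewrite (ler0_norm (x := s - t0)) ?(ler0_norm (x := t0 - t)) ?(ler0_norm (x := s - t)); lra.
- apply: (le_trans (path_dist_triangle _ (split_inv (epoint e0 t0)) _)).
  have := low t0 t; have := high s t0; rewrite !lexx t1 tt (ltW h1) (ltW h2) (ltW st) s1.
  move=> /(_ isT isT) A /(_ isT isT) B; apply: (le_trans (lerD A B)).
  by rewrite (ger0_norm (x := s - t0)) ?(ger0_norm (x := t0 - t)) ?(ger0_norm (x := s - t)); lra.
- by apply: high; rewrite ?(ltW st) ?(ltW tt).
Qed.

Lemma split_map_isometric : isometric_embedding split_map.
Proof.
exact: isometric_from_retraction split_mapK split_map_lipschitz split_inv_lipschitz.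
Qed.

Lemma split_Rat f : Defs.Rat f -> Defs.Rat (f \o split_map).
Proof.
move=> hf; case/andP: (h0) => h1 h2; case=> [e|].
  have [n [t [s P]]] := Rat_pieces e hf; case: (P) => t00 tn hp.
  have [Ee|ne] := eqVneq e e0; last first.
    exists n, t, s; split=> //=; rewrite ?(negPf ne) // => i hi.
    have [hlt haff] := hp i hi; split=> // u /andP[u1 u2].
    have l1 := pieces_le P (leq0n i) (ltnW hi); rewrite t00 in l1.
    have l2 := pieces_le P hi (leqnn n); rewrite tn in l2.
    rewrite /= !split_map_some /= ?(negPf ne); first by apply: haff; rewrite u1.
      by rewrite l1 (le_trans (ltW hlt)).
    by rewrite (le_trans l1 u1) (le_trans u2).
  subst e; have [k [hk /andP[k1 k2]]] : exists k, (k < n)%N /\ t k < t0 <= t k.+1.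
    have ex : exists j, t0 <= t j by exists n; rewrite tn ltW.
    case: (ex_minnP ex) => -[|j] hj hmin; first by move: hj; rewrite t00 leNgt h1.
    exists j; split; first by apply: hmin; rewrite tn ltW.
    by rewrite hj andbT ltNge; apply/negP => /hmin; rewrite ltnn.
  (* Piece [k] reaches or crosses [t0]; the lower part keeps the pieces up to it and cuts it off at
     [t0]. *)
  exists k.+1, (fun i => if (i <= k)%N then t i else t0), s.
  split; rewrite //= ?ltnn ?eqxx // => i hi; rewrite ltnS in hi; rewrite hi.
  have hin : (i < n)%N by exact: leq_ltn_trans hk.
  have [hlt haff] := hp i hin.
  have l1 := pieces_le P (leq0n i) (ltnW hin); rewrite t00 in l1.
  have l3 : t i < t0 by exact: le_lt_trans (pieces_le P hi (ltnW hk)) k1.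
  have b1 : t i < (if (i < k)%N then t i.+1 else t0) by case: ifP.
  have b2 : (if (i < k)%N then t i.+1 else t0) <= t i.+1.
    by case: ltnP => // ki; rewrite (_ : i = k) //; apply/eqP; rewrite eqn_leq hi.
  have b3 : (if (i < k)%N then t i.+1 else t0) <= t0.
    by case: ltnP => // ki; rewrite (le_trans (pieces_le P ki (ltnW hk))) // ltW.
  split=> // u /andP[u1 u2]; rewrite /= !split_map_some /= ?eqxx ?l1 ?(ltW l3) //.
    by apply: haff; rewrite u1 (le_trans u2).
  by rewrite (le_trans l1 u1) (le_trans u2).
have [n [t [s P]]] := Rat_pieces e0 hf; case: (P) => t00 tn hp.
have hu : 0 <= t0 < len e0 by rewrite (ltW h1).
have [k [hk /andP[k1 k2]]] := pieces_locate P hu.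
(* The upper part starts inside piece [k]. Since [t k - t0] may be negative, the first subdivision
   point is set to 0 separately. *)
exists (n - k)%N, (fun i => if i == 0%N then 0 else t (k + i)%N - t0), (fun i => s (k + i)%N).
split=> //=.
  by rewrite subn_eq0 leqNgt hk /= subnKC ?tn //; exact: ltnW.
move=> i hi; have hin : (k + i < n)%N by rewrite -ltn_subRL.
have [hlt haff] := hp _ hin.
have l0 : t0 < t (k + i).+1.
  by apply: lt_le_trans k2 _; apply: (pieces_le P) => //; rewrite ltnS leq_addr.
have l2 := pieces_le P hin (leqnn n); rewrite tn in l2.
have l3 : t (k + i)%N <= t0 + (if i == 0%N then 0 else t (k + i)%N - t0).
  by case: eqP => [->|_]; [rewrite addn0 addr0|rewrite addrC subrK].
have l4 : 0 <= (if i == 0%N then 0 else t (k + i)%N - t0).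
  case: eqP => // /eqP i0; rewrite subr_ge0 (le_trans (ltW k2)) //.
  by apply: (pieces_le P); [rewrite -addn1 leq_add2l lt0n|exact: ltnW].
rewrite addnS; split.
  by case: eqP => _; [rewrite subr_gt0|rewrite ltrD2r].
move=> u /andP[u1 u2].
have l5 : t0 + (if i == 0%N then 0 else t (k + i)%N - t0) <= t (k + i).+1.
  by case: eqP => [_|_]; [rewrite addr0 ltW|rewrite addrC subrK ltW].
rewrite /= !split_map_none; first last.
- by rewrite (le_trans l4 u1) (le_trans u2) // lerD2r.
- by rewrite l4 lerBrDl (le_trans l5).
rewrite (pieces_aff2 P (i := (k + i)%N) (u' := t0 + (if i == 0%N then 0 else t (k + i)%N - t0))) //.
- by congr (_ + _ * _); rewrite opprD addrACA subrr add0r.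
- by rewrite (le_trans l3) ?lerD2l // -lerBrDl.
- by rewrite l3 l5.
Qed.

Definition split_dart (a : dart G') : dart G :=
  if a.1 is Some e then (e, a.2) else (e0, a.2).

Lemma split_move x a : a \in tangent x ->
  exists2 eps : R, 0 < eps &
    forall r, 0 <= r <= eps -> split_map (move x a r) = move (split_map x) (split_dart a) r.
Proof.
case/andP: (h0) => h1 h2.
case: x => [[v|]|[e|] t h]; rewrite inE /=.
- case: a => -[e|] [] /=; rewrite /dtail /=.
  + case: ifP => // /negbT ne _; exists (len e); first exact: len_gt0.
    move=> r /andP[r0 r1]; rewrite /dpoint /= (negPf ne) split_map_some //=.
    by rewrite (negPf ne) subr_ge0 r1 lerBlDr lerDl.
  + move=> _; exists (split_len (Some e)); first exact: split_len_gt0.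
    by move=> r hr; rewrite /dpoint /= split_map_some.
  + move=> _; exists (len e0 - t0); first by rewrite subr_gt0.
    move=> r /andP[r0 r1]; rewrite /dpoint /= split_map_none; last by lra.
    by congr epoint; ring.
  + by [].
- rewrite (epoint_in h0); case: a => -[e|] [] /=; rewrite /dtail //=.
  + case: ifP => // /eqP -> _; exists t0 => // r /andP[r0 r1].
    rewrite /dpoint /= eqxx split_map_some //= eqxx; lra.
  + move=> _; exists (len e0 - t0); first by rewrite subr_gt0.
    by move=> r hr; rewrite /dpoint /= split_map_none.
- case: a => e' b /= /eqP ->; case/andP: (h) => t1 t2.
  have h3 : 0 < t < len e.
    rewrite t1 /=; move: t2 => /=; case: eqP => [->|//] /lt_trans; exact.
  rewrite (epoint_in h3); exists (Num.min t (split_len (Some e) - t)).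
    by rewrite lt_min t1 subr_gt0.
  move=> r /andP[r0]; rewrite le_min => /andP[r1 r2].
  by rewrite /split_dart /=; case: b; rewrite split_map_some //; apply/andP; split; lra.
- case: a => e' b /= /eqP ->; case/andP: (h) => t1 t2; move: (t2) => /= t2'.
  have h3 : 0 < t0 + t < len e0 by lra.
  rewrite (epoint_in h3); exists (Num.min t (len e0 - t0 - t)).
    by rewrite lt_min t1 subr_gt0.
  move=> r /andP[r0]; rewrite le_min => /andP[r1 r2].
  by rewrite /split_dart /=; case: b; rewrite split_map_none ?addrA //; lra.
Qed.

Lemma split_tangent x : tangent (split_map x) = split_dart @: tangent x.
Proof.
apply/setP => b; apply/idP/imsetP; last first.
  move=> [a ha ->]; move: ha.
  case: x => [[v|]|[e|] t h]; rewrite ?inE /=.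
  + by case: a => -[e|] [] /=; rewrite ?inE /dtail /=; try case: ifP.
  + rewrite (epoint_in h0) ?inE.
    by case: a => -[e|] [] /=; rewrite /dtail /=; try case: ifP.
  + have h3 : 0 < t < len e.
      case/andP: h => -> /=; case: eqP => [->|//] /lt_trans; apply.
      by case/andP: h0.
    by rewrite (epoint_in h3) ?inE; case: a => a1 a2 /= /eqP ->.
  + have h3 : 0 < t0 + t < len e0 by move: (h) (h0) => /=; lra.
    by rewrite (epoint_in h3) ?inE; case: a => a1 a2 /= /eqP ->.
case: b => e b.
case: x => [[v|]|[e'|] t h]; rewrite ?inE /=.
- rewrite ?inE /dtail /=; case: b => hv.
    have [E|ne] := eqVneq e e0.
      by exists (None, true); rewrite ?inE /dtail /split_dart /= ?E // -E.
    by exists (Some e, true); rewrite ?inE /dtail /split_dart /= ?(negPf ne).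
  by exists (Some e, false); rewrite ?inE /dtail /split_dart /=.
- rewrite (epoint_in h0) ?inE /= => /eqP ->; case: b.
    by exists (Some e0, true); rewrite ?inE /dtail /split_dart /= ?eqxx.
  by exists (None, false); rewrite ?inE /dtail /split_dart /= ?eqxx.
- have h3 : 0 < t < len e'.
    case/andP: h => -> /=; case: eqP => [->|//] /lt_trans; apply.
    by case/andP: h0.
  by rewrite (epoint_in h3) ?inE /= => /eqP ->; exists (Some e', b); rewrite ?inE.
- have h3 : 0 < t0 + t < len e0 by move: (h) (h0) => /=; lra.
  by rewrite (epoint_in h3) ?inE /= => /eqP ->; exists (None, b); rewrite ?inE.
Qed.

Lemma split_dart_inj x : {in tangent x &, injective split_dart}.
Proof.
move=> [a b] [a' b']; case: x => [v|e t h]; rewrite !inE /split_dart /=; last first.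
  by move=> /eqP -> /eqP ->; case: e h => [e|] h [->].
rewrite /dtail /=.
case: a a' => [a|] [a'|] /= h1 h2 /eqP; rewrite xpair_eqE => /andP[/eqP E1 /eqP E2]; subst => //.
  by case: b' h1 h2; rewrite ?eqxx => /eqP <-.
by case: b' h1 h2; rewrite ?eqxx => /eqP <-.
Qed.

Lemma split_ord f x : ord_at (f \o split_map) x = ord_at f (split_map x).
Proof.
rewrite /ord_at split_tangent big_imset /=; last exact: split_dart_inj.
congr (- _); apply: eq_bigr => a ha; apply: eq_slope => s.
have [eps e1 h] := split_move ha.
exact: is_slope_transfer h.
Qed.

Lemma split_refines : refines split_map.
Proof.
split; [|exact: split_map_isometric|exact: split_Rat|exact: split_ord].
by exists split_inv; [exact: split_mapK|exact: split_invK].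
Qed.

End Split.

(** * Series of rank one *)

(** A point that is not yet a vertex becomes one by splitting its edge. The clause saying where
    vertices of [G'] come from is what later shows that the last subdivision creates no new
    level. *)
Lemma refine_points (R : realType) (G : metric_graph R) (s : seq (realization G)) :
  exists (G' : metric_graph R) (p : realization G' -> realization G),
  [/\ refines p,
    forall v', (exists v, p (AtVertex v') = AtVertex v) \/ p (AtVertex v') \in s,
    forall x, x \in s -> exists v', p (AtVertex v') = x &
    forall v, exists v', p (AtVertex v') = AtVertex v].
Proof.
elim: s => [|x s [G1 [p [hp h1 h2 h3]]]].
  exists G, id; split=> //; [exact: refines_id|by move=> v; left; exists v|by move=> v; exists v].
have [[k pk kp] _ _ _] := hp.
case E : (k x) => [v|e t h].
  exists G1, p; split=> //.
    by move=> v'; have [?|hs] := h1 v'; [left|right; rewrite inE hs orbT].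
  by move=> y; rewrite inE => /predU1P[->|/h2//]; exists v; rewrite -E kp.
exists (split_graph h), (p \o split_map (h0 := h)); split.
- exact: refines_comp (split_refines h) hp.
- move=> [v'|] /=; last first.
    by right; rewrite (epoint_in h) -E kp inE eqxx.
  by have [?|hs] := h1 v'; [left|right; rewrite inE hs orbT].
- move=> y; rewrite inE => /predU1P[->|/h2[v' hv']]; last by exists (Some v').
  by exists None; rewrite /= (epoint_in h) -E kp.
- by move=> v; have [v' hv'] := h3 v; exists (Some v').
Qed.

Section Series.
Variable R : realType.

(* [r1_rank] is the rank condition for E = (x), [r1_span] finite generation, and [r1_dep] the
   tropical dependence of g, h and the constant 0. *)
Record rank1_series (G : metric_graph R) (D : realization G -> int)
    (M : set (realization G -> R)) (n : nat) (f : 'I_n.+1 -> realization G -> R) : Prop :=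
  Rank1Series {
  r1_const : forall c : R, M (fun=> c);
  r1_min : forall g h, M g -> M h -> M (fun x => Num.min (g x) (h x));
  r1_add : forall g (c : R), M g -> M (fun x => g x + c);
  r1_Rat : M `<=` @Defs.Rat R G;
  r1_div : forall g x, M g -> 0 <= D x + ord_at g x;
  r1_rank : forall x, exists2 g, M g & 1 <= D x + ord_at g x;
  r1_gen : forall i, M (f i);
  r1_span : forall g, M g -> exists c : 'I_n.+1 -> R,
    forall x, (exists i, g x = f i x + c i) /\ forall i, g x <= f i x + c i;
  r1_dep : forall g h, M g -> M h -> exists a b : R, forall x,
    [\/ g x + a = 0 /\ 0 <= h x + b, h x + b = 0 /\ 0 <= g x + a |
        g x + a = h x + b /\ g x + a <= 0]
}.

(** The conclusion of the theorem, separated so that it can be carried back along subdivisions of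
    [G]. *)
Definition pulled_from_tree (G : metric_graph R) (d : int) (M : set (realization G -> R)) : Prop :=
  exists (G' T : metric_graph R) (alpha : tropical_modification G G')
         (phi : realization G' -> realization T),
    [/\ is_tree T, finite_morphism phi, harmonic_morphism phi, has_degree phi d &
      exists y0 : realization T,
        M = [set ((g \o phi) \o tm_incl alpha) | g in RatD (point_div y0)]].

Lemma linear_series_rank1 (G : metric_graph R) (d : int) (D : divisor G)
    (M : set (realization G -> R)) : linear_series 1 d D M -> (forall c : R, M (fun=> c)) ->
  exists n f, @rank1_series G D M n f.
Proof.
move=> [_ [[MR Mmin Madd] MD _ [S [_ hS]]] [n [f [hf hspan]]] [hdep _]] hc.
exists n, f; split=> //.
- by move=> g x /MD[_]; exact.
- move=> x; have eff : effective (point_div x) by move=> y /=; case: eqP.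
  have dg : deg (point_div x) = 1%N%:Z.
    rewrite /deg (fsbigE [:: x]) //=; first by rewrite big_mkcond big_seq1 /= in_setT eqxx.
    by move=> y _; rewrite inE => /negPf ->.
  have [g [Mg _ h]] := hS _ eff dg; exists g => //.
  by have := h x; rewrite /= eqxx subr_ge0.
- move=> g /hspan[c hgc]; exists c => x; rewrite hgc; split; last first.
    by move=> i; exact: bigmin_le.
  elim/big_ind: _ => [|a b [i ->] [j ->]|i _]; [by exists ord0| |by exists i].
  by rewrite /Order.min; case: ifP => _; [exists i|exists j].
- move=> g h Mg Mh.
  pose F (i : 'I_3) := if i == 0%N :> nat then g else if i == 1%N :> nat then h else fun=> 0.
  have MF i : M (F i) by rewrite /F; case: eqP => // _; case: eqP.
  have [c hcc] := hdep F MF.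
  (* The three coefficients matter only up to a common constant, so that of the function 0 is made
     0. The two indices attaining the minimum decide which of the three cases holds. *)
  exists (c (inord 0) - c (inord 2)), (c (inord 1) - c (inord 2)) => x.
  have ci k (hk : (k < 3)%N) : c (Ordinal hk) = c (inord k).
    by congr c; apply/val_inj; rewrite /= inordK.
  have [i [j [ij E H]]] := hcc x.
  have H0 := H (inord 0); have H1 := H (inord 1); have H2 := H (inord 2).
  rewrite /F !inordK //= in H0 H1 H2.
  case: i j ij E {H} H0 H1 H2 => -[|[|[|//]]] hi [[|[|[|//]]] hj] //= _; rewrite /F /= !ci => E H0 H1 H2.
  + by constructor 3; split; lra.
  + by constructor 1; split; lra.
  + by constructor 3; split; lra.
  + by constructor 2; split; lra.
  + by constructor 1; split; lra.
  + by constructor 2; split; lra.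
Qed.

Lemma rank1_series_refine (G' G : metric_graph R) (p : realization G' -> realization G)
    (D : realization G -> int) (M : set (realization G -> R)) n f : refines p ->
  @rank1_series G D M n f ->
  @rank1_series G' (D \o p) [set g \o p | g in M] n (fun i => f i \o p).
Proof.
move=> [[k pk kp] _ pRat pord] [h1 h2 h3 h4 h5 h6 h7 h8 h9]; split.
- by move=> c; exists (fun=> c).
- by move=> _ _ [g Mg <-] [h Mh <-]; exists (fun x => Num.min (g x) (h x)); first exact: h2.
- by move=> _ c [g Mg <-]; exists (fun x => g x + c); first exact: h3.
- by move=> _ [g Mg <-]; apply: pRat; exact: h4.
- by move=> _ x [g Mg <-]; rewrite pord; exact: h5.
- by move=> x; have [g Mg hg] := h6 (p x); exists (g \o p); [exists g|rewrite pord].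
- by move=> i; exists (f i).
- by move=> _ [g Mg <-]; have [c hc] := h8 g Mg; exists c => x; exact: hc.
- move=> _ _ [g Mg <-] [h Mh <-]; have [a [b hab]] := h9 g h Mg Mh.
  by exists a, b => x; exact: hab.
Qed.

(** The trees, the modified graph and [phi] stay the same; only the inclusion, the attaching points
    and the retraction are composed with the identification of [G'] with [G]. *)
Lemma pulled_from_tree_refine (G' G : metric_graph R) (p : realization G' -> realization G)
    d (M : set (realization G -> R)) : refines p ->
  pulled_from_tree d [set g \o p | g in M] -> pulled_from_tree d M.
Proof.
move=> [[k pk kp] piso _ _] [G2 [T [alpha [phi [hT hf hh hd [y0 hM]]]]]].
have kiso : isometric_embedding k by move=> x y; rewrite -piso !kp.
case: alpha hM => incl n tr emb root att ret h1 h2 h3 h4 h5 h6 h7 h8 h9 /= hM.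
have @alpha' : tropical_modification G G2.
  apply: (@TropicalModification R G G2 (incl \o k) n tr emb root (p \o att) (p \o ret)) => //.
  - by move=> x y; rewrite h2 kiso.
  - by move=> i; rewrite h4 /= pk.
  - by move=> z; have [[x ->]|] := h5 z; [left; exists (p x); rewrite /= pk|right].
  - by move=> i y x /h6.
  - by move=> x; rewrite /= h8 kp.
  - by move=> i y; rewrite /= h9.
exists G2, T, alpha', phi; split=> //; exists y0; apply/seteqP; split=> g.
  move=> Mg; have : [set g \o p | g in M] (g \o p) by exists g.
  rewrite hM => -[u hu E]; exists u => //; apply/funext => x /=.
  by have := congr1 (fun h => h (k x)) E; rewrite /= kp.
move=> [u hu <-].
have : [set g \o p | g in M] ((u \o phi) \o incl) by rewrite hM; exists u.
move=> [v Mv E]; rewrite (_ : _ \o _ = v) //; apply/funext => x /=.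
by have := congr1 (fun h => h (k x)) E; rewrite /= kp.
Qed.

End Series.

(** * Rooted trees *)

(** Strictly increasing heights exclude cycles and provide the edge lengths. The height of the root
    is arbitrary, so that a branch of a tree can keep the heights of the tree. *)
Record rooted_tree (R : realType) := RootedTree {
  rt_vertex :> finType;
  rt_root : rt_vertex;
  rt_par : rt_vertex -> rt_vertex;
  rt_ht : rt_vertex -> R;
  rt_par_root : rt_par rt_root = rt_root;
  rt_par_lt : forall v, v != rt_root -> rt_ht (rt_par v) < rt_ht v;
  rt_nontrivial : exists v, v != rt_root
}.

Section RootedTree.
Variables (R : realType) (T : rooted_tree R).
Local Notation root := (rt_root T).
Local Notation par := (@rt_par R T).
Local Notation ht := (@rt_ht R T).
Implicit Types u v w : T.

(** Well founded because the finite set of nodes lower than [v] shrinks when passing to the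
    parent. *)
Lemma rt_ind (P : T -> Prop) : P root -> (forall v, v != root -> P (par v) -> P v) ->
  forall v, P v.
Proof.
move=> h0 hs v; have [n] := ubnP #|[set u | ht u < ht v]%SET|.
elim: n v => // n IH v hn; have [->//|vr] := eqVneq v root.
apply: hs => //; apply: IH; rewrite -ltnS; apply: leq_trans hn; rewrite ltnS.
apply: proper_card; apply/properP; split.
  by apply/fintype.subsetP => u; rewrite !inE => /lt_trans; apply; exact: rt_par_lt.
by exists (par v); rewrite !inE ?ltxx // rt_par_lt.
Qed.

(** Induction from the leaves down, on the number of nodes higher than [v]. *)
Lemma rt_ind_up (P : T -> Prop) :
  (forall v, (forall w, w != root -> par w = v -> P w) -> P v) -> forall v, P v.
Proof.
move=> hs v; have [n] := ubnP #|[set u | ht v < ht u]%SET|.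
elim: n v => // n IH v hn; apply: hs => w wr pw.
apply: IH; rewrite -ltnS; apply: leq_trans hn; rewrite ltnS.
have vw : ht v < ht w by rewrite -pw rt_par_lt.
apply: proper_card; apply/properP; split.
  by apply/fintype.subsetP => u; rewrite !inE; exact: lt_trans.
by exists w; rewrite !inE ?ltxx.
Qed.

(** A node other than the root stands for the edge to its parent, which is oriented away from the
    root. *)
Definition rt_edge : finType := {v : T | v != root}.

Definition rt_src (b : rt_edge) : T := par (val b).
Definition rt_tgt (b : rt_edge) : T := val b.
Definition rt_len (b : rt_edge) : R := ht (val b) - ht (par (val b)).

Lemma rt_len_gt0 b : 0 < rt_len b.
Proof. by rewrite subr_gt0 rt_par_lt // (valP b). Qed.

Lemma rt_edge_gt0 : (0 < #|rt_edge|)%N.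
Proof. by have [v hv] := rt_nontrivial T; apply/card_gt0P; exists (exist _ v hv). Qed.

Lemma rt_connected u v : connect (graph_adj rt_src rt_tgt) u v.
Proof.
apply: (@connected_to_root _ _ _ _ root) => {u v}; apply: rt_ind => // v hv.
apply: connect_trans; rewrite (sym_connect_sym (graph_adj_sym _ _)).
exact: (connect_edge rt_src rt_tgt (exist _ v hv)).
Qed.

Definition rt_graph : metric_graph R := MetricGraph rt_len_gt0 rt_edge_gt0 rt_connected.

Lemma uniq_map_inj (A B : eqType) (f : A -> B) (s : seq A) : uniq (map f s) ->
  {in s &, injective f}.
Proof.
elim: s => // a s IH /= /andP[ha hs] x y; rewrite !inE.
move=> /predU1P[->|xs] /predU1P[->|ys] // E; last exact: IH.
  by move: ha; rewrite E map_f.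
by move: ha; rewrite -E map_f.
Qed.

(* The two darts of a cycle at a vertex of maximal height carry the same edge. *)
Lemma rt_is_tree : is_tree rt_graph.
Proof.
move=> c; apply/negP => /and4P[c0 hc hu _].
have [a0 ha0] : exists a, a \in c by case: c c0 {hc hu} => // a c _; exists a; rewrite inE eqxx.
pose M := [arg max_(a > a0 in c) ht (dtail a)]%O.
have [ha hmax] : M \in c /\ forall a, a \in c -> ht (dtail a) <= ht (dtail M).
  by rewrite /M; case: arg_maxP.
move: M ha hmax => a ha hmax.
have hb := prev_cycle hc ha; have hn := next_cycle hc ha.
have mb : prev c a \in c by rewrite mem_prev.
have mn : next c a \in c by rewrite mem_next.
have h1 := hmax _ mb; have h2 := hmax _ mn.
rewrite -(eqP hn) in h2; rewrite -(eqP hb) in h1.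
move: (prev c a) mb hb h1 => b mb /eqP hb h1.
have E : a.1 = b.1.
  move: a b ha mb hb h1 h2 {hmax hn mn} => [e s] [e' s'] /= _ _.
  rewrite /dhead /drev /dtail /=.
  have l1 := rt_len_gt0 e; have l2 := rt_len_gt0 e'.
  rewrite /rt_len !subr_gt0 in l1 l2.
  case: s; case: s' => /=; rewrite /rt_src /rt_tgt => E.
  - by rewrite -E leNgt l2.
  - by move=> _ _; apply/val_inj.
  - by rewrite -E leNgt l2.
  - by move=> _; rewrite leNgt l1.
have ab := uniq_map_inj hu ha mb E; rewrite -ab in hb.
have l1 := rt_len_gt0 a.1; rewrite /rt_len subr_gt0 in l1.
move: hb; rewrite /dhead /drev /dtail /=; case: a.2 => /= hb; rewrite /rt_src /rt_tgt in hb;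
by have E' := congr1 (@rt_ht R T) hb; lra.
Qed.

Definition rt_anc u w : bool := fconnect par w u.

Lemma rt_anc_refl w : rt_anc w w. Proof. exact: connect0. Qed.

Lemma rt_anc_trans v u w : rt_anc u v -> rt_anc v w -> rt_anc u w.
Proof. by move=> h1 h2; exact: connect_trans h2 h1. Qed.

Lemma rt_anc_par w : rt_anc (par w) w. Proof. exact: fconnect1. Qed.

Lemma rt_ancE u w : rt_anc u w = (u == w) || rt_anc u (par w).
Proof.
apply/idP/orP; last by case=> [/eqP ->|/rt_anc_trans]; [exact: rt_anc_refl|apply; exact: rt_anc_par].
move=> h; have := iter_findex h; case: findex => [|n] /=; first by move=> ->; left.
by move=> <-; right; rewrite -iterS iterSr; exact: fconnect_iter.
Qed.

Lemma rt_anc_root w : rt_anc root w.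
Proof.
move: w; apply: rt_ind; first exact: rt_anc_refl.
by move=> v _ h; rewrite rt_ancE h orbT.
Qed.

Lemma rt_anc_of_root u : rt_anc u root -> u = root.
Proof.
move=> h; rewrite -(iter_findex h); elim: findex => //= n ->; exact: rt_par_root.
Qed.

Lemma rt_par_le w : ht (par w) <= ht w.
Proof. by have [->|h] := eqVneq w root; [rewrite rt_par_root|exact/ltW/rt_par_lt]. Qed.

Lemma rt_anc_le u w : rt_anc u w -> ht u <= ht w.
Proof.
by move=> h; rewrite -(iter_findex h); elim: findex => //= n; apply: le_trans (rt_par_le _).
Qed.

Lemma rt_ancN_par b : b != root -> rt_anc b (par b) = false.
Proof.
by move=> hb; apply/negP => /rt_anc_le; rewrite leNgt rt_par_lt.
Qed.

Lemma rt_anc_chain u u' w : rt_anc u w -> rt_anc u' w -> rt_anc u u' || rt_anc u' u.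
Proof.
move: w; apply: rt_ind => [|w _ IH].
  by move=> /rt_anc_of_root -> _; rewrite rt_anc_root.
rewrite rt_ancE => /predU1P[->|h]; first by move=> ->; rewrite orbT.
rewrite rt_ancE => /predU1P[->|h']; last exact: IH.
by rewrite (rt_anc_trans h (rt_anc_par _)).
Qed.

Lemma rt_anc_child_uniq b b' w : b != root -> b' != root -> par b = par b' ->
  rt_anc b w -> rt_anc b' w -> b = b'.
Proof.
move=> hb hb' hp h h'; have /orP[|] := rt_anc_chain h h'; rewrite rt_ancE => /orP[/eqP //|].
  by rewrite -hp rt_ancN_par.
by rewrite hp rt_ancN_par.
Qed.

Lemma rt_exists_child : exists b : rt_edge, par (val b) = root.
Proof.
have [v hv] := rt_nontrivial T; move: v hv.
apply: rt_ind; first by rewrite eqxx.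
move=> v hv IH _; have [E|ne] := eqVneq (par v) root; last exact: IH.
by exists (exist _ v hv).
Qed.

Lemma rt_child_towards u w : rt_anc u w -> u != w ->
  exists b, [/\ b != root, par b = u & rt_anc b w].
Proof.
move: w; apply: rt_ind => [/rt_anc_of_root ->|w hw IH]; first by rewrite eqxx.
rewrite rt_ancE => /predU1P[->|h]; first by rewrite eqxx.
have [E _|ne _] := eqVneq u (par w); first by exists w; rewrite rt_anc_refl.
by have [b [h1 h2 h3]] := IH h ne; exists b; split=> //; rewrite rt_ancE h3 orbT.
Qed.

End RootedTree.

(** * The functions in [Rat(T, (y_0))] with [y_0] the root: profiles belong to this space *)

Section Profile.
Variables (R : realType) (T : rooted_tree R).
Local Notation root := (rt_root T).
Local Notation par := (@rt_par R T).
Local Notation ht := (@rt_ht R T).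
Local Notation TG := (rt_graph T).
Implicit Types (u v : T) (b w : rt_edge T) (g : realization TG -> R).

(** The length of the part of [b] lying on the path from the root to the point at distance [tau]
    from the lower end of [w]. *)
Definition active w (tau : R) b : R :=
  if b == w then tau else if rt_anc (val b) (val w) then rt_len b else 0.

(* [g] grows with slope 1 along the path from the root to the point [epoint w tau]
   and is constant along the other directions. *)
Definition profile g w (tau : R) := 0 <= tau <= rt_len w /\
  forall b s, 0 <= s <= rt_len b ->
    g (@epoint R TG b s) = g (@AtVertex R TG (par (val b))) + Num.min s (active w tau b).

Lemma active_bounds w tau b : 0 <= tau <= rt_len w -> 0 <= active w tau b <= rt_len b.
Proof.
rewrite /active; case: eqP => [->//|_] _.
by have := rt_len_gt0 b; case: ifP => _ h; rewrite ?lexx (ltW h).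
Qed.

Section FromProfile.
Variables (g : realization TG -> R) (w : rt_edge T) (tau : R).
Hypothesis P : profile g w tau.

Let ab b : 0 <= active w tau b <= rt_len b.
Proof. by apply: active_bounds; case: P. Qed.

Lemma profile_tgt b : g (@AtVertex R TG (val b)) = g (@AtVertex R TG (par (val b))) + active w tau b.
Proof.
case: P => _ /(_ b (rt_len b)); rewrite lexx (ltW (rt_len_gt0 b)) => /(_ isT).
rewrite (@epoint_len R TG b) /= /rt_tgt => ->; congr (_ + _).
by apply/min_idPr; case/andP: (ab b).
Qed.

Lemma profile_pt b s : 0 <= s <= rt_len b ->
    g (@epoint R TG b s) = g (@AtVertex R TG (par (val b))) + Num.min s (active w tau b).
Proof. by case: P => _; exact. Qed.

Lemma profile_Rat : Defs.Rat g.
Proof.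
move=> b; case/andP: (ab b) => a0 al; have bl := rt_len_gt0 b.
have [E|ne] := eqVneq (active w tau b) 0.
  exists 1%N, (fun i => if i is 0%N then 0 else rt_len b), (fun=> 0); split=> // -[|//] _.
  split=> // u hu; rewrite !profile_pt ?lexx ?(ltW bl) // E mul0r addr0.
  by rewrite minxx (min_idPr _) //; case/andP: hu.
have [E'|ne'] := eqVneq (active w tau b) (rt_len b).
  exists 1%N, (fun i => if i is 0%N then 0 else rt_len b), (fun=> 1); split=> // -[|//] _.
  split=> // u hu; rewrite !profile_pt ?lexx ?(ltW bl) // E' mul1r subr0.
  by rewrite (min_idPl (ltW bl)) addr0 (min_idPl _) //; case/andP: hu.
have a1 : 0 < active w tau b by rewrite lt_def ne a0.
have a2 : active w tau b < rt_len b by rewrite lt_def eq_sym ne' al.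
exists 2%N, (fun i => if i is 0%N then 0 else if i is 1%N then active w tau b else rt_len b),
  (fun i => if i is 0%N then 1 else 0); split=> // -[|[|//]] _; split=> // u /andP[u0 u1].
  rewrite !profile_pt ?lexx ?(ltW bl) ?u0 ?(le_trans u1) // mul1r subr0.
  by rewrite (min_idPl (ltW a1)) addr0 (min_idPl _).
rewrite !profile_pt ?a0 ?al // ?(le_trans a0 u0) // mul0r addr0 minxx.
by rewrite (min_idPr u0).
Qed.

Lemma profile_slope_up b :
  is_slope g (@AtVertex R TG (par (val b))) (b, false) (0 < active w tau b)%R%:Z.
Proof.
case/andP: (ab b) => a0 al; have bl := rt_len_gt0 b.
have [a1|] := ltP; last first.
  move=> a1; exists (rt_len b) => // s hs; rewrite /= /dpoint /= profile_pt //.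
  by rewrite mul0r (_ : active _ _ _ = 0) ?(min_idPr _) //; [case/andP: hs|lra].
exists (active w tau b) => // s /andP[s0 s1]; rewrite /= /dpoint /= profile_pt ?mul1r ?s0 ?(le_trans s1) //.
by rewrite (min_idPl s1).
Qed.

Lemma profile_slope_down b :
  is_slope g (@AtVertex R TG (val b)) (b, true) (- (active w tau b == rt_len b)%R%:Z).
Proof.
case/andP: (ab b) => a0 al; have bl := rt_len_gt0 b; have E := profile_tgt b.
have [e|ne] := eqVneq (active w tau b) (rt_len b).
  exists (rt_len b) => // s /andP[s0 s1]; rewrite /= /dpoint /= profile_pt; last by lra.
  by rewrite E e (min_idPl _) ?mulN1r; [ring|lra].
exists (rt_len b - active w tau b); first by rewrite subr_gt0 lt_def eq_sym ne al.
move=> s /andP[s0 s1]; rewrite /= /dpoint /= profile_pt; last by lra.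
by rewrite E (min_idPr _) ?oppr0 ?mul0r ?addr0 //; lra.
Qed.

Lemma profile_div_in b s (h : 0 < s < len (b : edge TG)) : 0 <= ord_at g (InEdge h).
Proof.
case/andP: (ab b) => a0 al; have bl := rt_len_gt0 b; case/andP: (h) => s0 s1.
rewrite /= in s1; rewrite /ord_at sum_tangent_edge oppr_ge0.
have [E|ne] := ltP s (active w tau b).
  have -> : slope g (InEdge h) (b, false) = 1.
    apply: slopeE; exists (active w tau b - s); rewrite ?subr_gt0 // => r /andP[r0 r1].
    rewrite /= -(epoint_in h) !profile_pt ?(ltW s0) ?(ltW s1) //; last by lra.
    by rewrite mul1r !(min_idPl _) ?addrA; lra.
  have -> : slope g (InEdge h) (b, true) = -1; last by [].
  apply: slopeE; exists s => // r /andP[r0 r1].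
  rewrite /= -(epoint_in h) !profile_pt ?(ltW s0) ?(ltW s1) //; last by lra.
  by rewrite mulN1r !(min_idPl _) ?addrA; lra.
have -> : slope g (InEdge h) (b, false) = 0.
  apply: slopeE; exists (rt_len b - s); rewrite ?subr_gt0 // => r /andP[r0 r1].
  rewrite /= -(epoint_in h) !profile_pt ?(ltW s0) ?(ltW s1) //; last by lra.
  by rewrite mul0r !(min_idPr _) ?addrA; lra.
(* Here [s] may be the breakpoint itself. The slope downwards is not computed: it exists by
   [profile_Rat], and it is not positive because [g] already has its largest value on the edge at
   [s]. *)
have hb : (b, true) \in tangent (InEdge h) by rewrite inE.
have [s' hs'] := Rat_slope profile_Rat hb.
rewrite (slopeE hs') add0r; case: hs' => eps e0 H.
have m0 : 0 < Num.min eps s by rewrite lt_min e0.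
have := H (Num.min eps s); rewrite (ltW m0) ge_min lexx => /(_ isT).
rewrite /= -(epoint_in h) !profile_pt ?(ltW s0) ?(ltW s1) //; last first.
  by have := m0; case: (leP eps s) => *; lra.
move=> H'; rewrite -(@ler_int R) -(pmulr_lle0 _ m0).
move: H'; rewrite (min_idPr ne) => H'.
have : Num.min (s - Num.min eps s) (active w tau b) <= active w tau b.
  by rewrite ge_min lexx orbT.
lra.
Qed.

(** At a node at most one upward edge is active, since two children of one node cannot both be
    ancestors of [w]. Its slope 1 is compensated by the edge towards the root, which is then active
    on its full length, or by [(y_0)] if the node is the root. *)
Lemma profile_RatD : RatD (point_div (@AtVertex R TG root)) g.
Proof.
split; first exact: profile_Rat.
case=> [v|b s h] /=; last first.
  by rewrite (_ : (InEdge h == _) = false) ?add0r ?profile_div_in //; apply/eqP.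
rewrite /ord_at sum_tangent_vertex /=.
rewrite (_ : (AtVertex v == _) = (v == root)); last first.
  by apply/eqP/eqP => [/AtVertex_inj|->].
rewrite (eq_bigr (fun b : rt_edge T => (0 < active w tau b)%R%:Z)); last first.
  by move=> b /eqP <-; exact/slopeE/profile_slope_up.
rewrite [X in - (_ + X)](eq_bigr (fun b : rt_edge T => - (active w tau b == rt_len b)%R%:Z)); last first.
  by move=> b /eqP <-; exact/slopeE/profile_slope_down.
rewrite sumrN opprD opprK.
have le1 : \sum_(b : rt_edge T | rt_src b == v) (0 < active w tau b)%R%:Z <= 1.
  have [/existsP[b1 /andP[/eqP h1 h2]]|/existsPn hn] :=
    boolP [exists b1 : rt_edge T, (rt_src b1 == v) && (0 < active w tau b1)].
    rewrite (bigD1 b1) ?h1 //= big1 ?addr0; first by case: (_ < _).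
    move=> b /andP[/eqP hb hbb]; case: ltP => // hact; exfalso.
    have an b' : 0 < active w tau b' -> rt_anc (val b') (val w).
      by rewrite /active; case: eqP => [->|_]; [rewrite rt_anc_refl|case: ifP; rewrite ?ltxx].
    move/eqP: hbb; apply; apply/val_inj; apply: (rt_anc_child_uniq (valP b) (valP b1) _ (an _ hact) (an _ h2)).
    by rewrite -[LHS]/(rt_src b) -[RHS]/(rt_src b1) hb h1.
  rewrite big1 // => b hb; have := hn b; rewrite hb /=; by case: ltP.
have [vr|vr] := eqVneq v root.
  rewrite [X in _ <= _ + (_ + X)]big1 ?addr0 ?subr_ge0 //.
  by move=> b /eqP hb; move: (valP b); rewrite /rt_tgt in hb; rewrite hb vr eqxx.
pose bv : rt_edge T := exist _ v vr.
rewrite [X in _ <= _ + (_ + X)](big_pred1 bv); last by move=> b; rewrite /= -val_eqE.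
have [E|ne] := eqVneq (active w tau bv) (rt_len bv); first by rewrite add0r addrC subr_ge0.
rewrite add0r addr0 oppr_ge0 big1 // => b /eqP hb; case: ltP => // hact.
have hb' : par (val b) = v by [].
have an : rt_anc (val b) (val w).
  by move: hact; rewrite /active; case: eqP => [->|_]; [rewrite rt_anc_refl|case: ifP; rewrite ?ltxx].
move: ne; rewrite /active -val_eqE /=.
have lt : ht v < ht (val w).
  by apply: lt_le_trans (rt_anc_le an); rewrite -hb' rt_par_lt // (valP b).
rewrite (_ : (v == sval w) = false); last first.
  by apply: contraTF lt => /eqP ->; rewrite ltxx.
by rewrite (rt_anc_trans _ an) ?eqxx // -hb' rt_anc_par.
Qed.

End FromProfile.

Lemma profile_exists w tau (c : R) : 0 <= tau <= rt_len w ->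
  exists g, profile g w tau /\ g (@AtVertex R TG root) = c.
Proof.
move=> ht0; pose gv v := c + \sum_(b : rt_edge T | rt_anc (val b) v) active w tau b.
pose g (x : realization TG) := match x with AtVertex v => gv v
  | InEdge b s _ => gv (par (val b)) + Num.min s (active w tau b) end.
exists g; split; last first.
  rewrite /= /gv big1 ?addr0 // => b /rt_anc_of_root hb.
  by move: (valP b); rewrite hb eqxx.
split=> // b s hs; case/andP: (active_bounds b ht0) => a0 al.
case: (@epointP R TG b s hs) => [->|->|h] //=; first by rewrite (min_idPl a0) addr0.
rewrite (min_idPr al) /gv -addrA; congr (_ + _).
rewrite (bigD1 b) ?rt_anc_refl //= addrC; congr (_ + _); apply: eq_bigl => b'.
have [->|ne] := eqVneq b' b; first by rewrite andbF rt_ancN_par // (valP b).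
by rewrite andbT rt_ancE (_ : (_ == _) = false) //; apply: contraNF ne => /eqP/val_inj ->.
Qed.

End Profile.

(** * The functions in [Rat(T, (y_0))] with [y_0] the root: all of them are profiles *)

Section ConcaveEdge.
Variables (R : realType) (G : metric_graph R) (g : realization G -> R) (e : edge G).
Hypothesis gR : Defs.Rat g.
Hypothesis ge0 : forall u (h : 0 < u < len e), 0 <= ord_at g (InEdge h).

Let a := slope g (AtVertex (src e)) (e, false).
Let z := - slope g (AtVertex (tgt e)) (e, true).

Lemma concave_slopes : z <= a.
Proof.
have [n [t [s P]]] := Rat_pieces e gR.
rewrite /a /z (slopeE (pieces_slope_src P)) (slopeE (pieces_slope_tgt P)) opprK.
have n0 := pieces_gt0 P.
have hs i : (i < n)%N -> s i <= s 0%N.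
  elim: i => // i IH hi; apply: le_trans (IH (ltnW hi)).
  by have := ge0 (pieces_break_in P hi); rewrite (pieces_ord_break P) // subr_ge0.
by apply: hs; rewrite prednK.
Qed.

(** Slopes decrease along the edge and are integers between [z] and [a], hence 1 up to some point
    [A] and 0 afterwards. *)
Lemma concave_edge : a <= 1 -> 0 <= z -> exists A : R,
  [/\ 0 <= A <= len e, (z = 1 -> A = len e), (a = 0 -> A = 0), (a = 1 -> 0 < A) &
  forall u, 0 <= u <= len e -> g (epoint e u) = g (AtVertex (src e)) + Num.min u A].
Proof.
have [n [t [s P]]] := Rat_pieces e gR.
rewrite /a /z (slopeE (pieces_slope_src P)) (slopeE (pieces_slope_tgt P)) opprK => a1 z0.
have [t0 tn _] := P; have n0 := pieces_gt0 P.
have sd i j : (i <= j)%N -> (j < n)%N -> s j <= s i.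
  elim: j => [|j IH]; first by rewrite leqn0 => /eqP ->.
  rewrite leq_eqVlt => /predU1P[->//|ij] jn.
  apply: le_trans (IH ij (ltnW jn)).
  by have := ge0 (pieces_break_in P jn); rewrite (pieces_ord_break P) // subr_ge0.
(* The least such [k] counts the initial pieces of slope 1; the first alternative covers the case in
   which there is no other piece. *)
have ex : exists k, (k == n) || (s k != 1) by exists n; rewrite eqxx.
case: (ex_minnP ex) => k hk kmin.
have kn : (k <= n)%N by apply: kmin; rewrite eqxx.
have s1 i : (i < k)%N -> s i = 1.
  by move=> ik; apply/eqP; apply: contraTT ik => h; rewrite -leqNgt kmin // h orbT.
have s0 i : (k <= i)%N -> (i < n)%N -> s i = 0.
  move=> ki hi; move: hk; rewrite (_ : (k == n) = false) /=; last first.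
    by apply/negbTE; rewrite neq_ltn (leq_ltn_trans ki).
  move=> hk; have h1 := sd k i ki hi; have h2 : s n.-1 <= s i by apply: sd; rewrite ?prednK // -ltnS prednK.
  have h3 : s k <= s 0%N by apply: sd => //; exact: leq_ltn_trans hi.
  apply/eqP; rewrite eq_le (le_trans z0 h2) andbT; apply: le_trans h1 _.
  by rewrite -ltzD1 add0r lt_neqAle hk (le_trans h3).
have k1 i : (i <= k)%N -> g (epoint e (t i)) = g (AtVertex (src e)) + t i.
  elim: i => [|i IH] hi; first by rewrite t0 addr0 epoint0.
  rewrite (pieces_aff P (i := i)) ?(leq_trans hi) ?lexx ?(pieces_le P) ?(leq_trans hi) //.
  by rewrite IH ?(ltnW hi) // s1 // mul1r; ring.
have k2 i : (i <= n)%N -> (k <= i)%N -> g (epoint e (t i)) = g (AtVertex (src e)) + t k.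
  elim: i => [|i IH] hi; first by rewrite leqn0 => /eqP ->; exact: k1.
  rewrite leq_eqVlt ltnS => /predU1P[<-|ki]; first exact: k1.
  rewrite (pieces_aff P (i := i)) ?lexx ?(pieces_le P) //.
  by rewrite IH ?(ltnW hi) // s0 // mul0r addr0.
exists (t k); split.
- by rewrite -{1}t0 -tn !(pieces_le P).
- move=> zz; rewrite -tn; congr t; apply/eqP; rewrite eqn_leq kn leqNgt; apply/negP => kn'.
  by move: zz; rewrite s0 // ?prednK // -ltnS prednK.
- by move=> az; case: k {hk kmin kn s0 k1 k2} s1 => // k /(_ 0%N isT); rewrite az.
- move=> az; case: k hk kmin kn {s1 s0 k1 k2} => [|k] hk kmin kn; last by rewrite -t0 (pieces_lt P).
  by move: hk; rewrite az eqxx orbF eq_sym (gtn_eqF n0).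
- move=> u /andP[u0 u1]; have [ul|ul] := ltP u (len e); last first.
    rewrite (le_anti (introT andP (conj u1 ul))) -tn k2 //.
    by rewrite (min_idPr (pieces_le P kn (leqnn n))).
  have hu : 0 <= u < len e by rewrite u0.
  have [i [hi /andP[h1 h2]]] := pieces_locate P hu.
  rewrite (pieces_aff P (i := i)) ?h1 ?(ltW h2) //.
  have [ik|ki] := ltnP i k.
    rewrite k1 ?(ltnW ik) // s1 // mul1r (min_idPl _); first by ring.
    by apply: le_trans (ltW h2) _; apply: (pieces_le P).
  rewrite k2 ?(ltnW hi) // s0 // mul0r addr0 (min_idPr _) //.
  by apply: le_trans h1; apply: (pieces_le P) => //; exact: ltnW.
Qed.

End ConcaveEdge.

Section ToProfile.
Variables (R : realType) (T : rooted_tree R).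
Local Notation root := (rt_root T).
Local Notation par := (@rt_par R T).
Local Notation ht := (@rt_ht R T).
Local Notation TG := (rt_graph T).

(** At a node, effectivity bounds the sum of the slopes going up by the slope arriving from below.
    With the slopes being integers, this leaves at each node at most one edge along which [g] starts
    to grow, and these edges form a path from the root. *)
Lemma profile_of_RatD g : RatD (point_div (@AtVertex R TG root)) g ->
  exists w tau, @profile R T g w tau.
Proof.
move=> [gR gD].
have ge0 (b : edge TG) u (h : 0 < u < len b) : 0 <= ord_at g (InEdge h).
  have := gD (InEdge h); rewrite /= (_ : (InEdge h == _) = false) ?add0r //.
  exact/eqP.
pose a (b : rt_edge T) := slope g (@AtVertex R TG (rt_src b)) (b, false).
pose z (b : rt_edge T) := - slope g (@AtVertex R TG (rt_tgt b)) (b, true).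
have za b : z b <= a b := concave_slopes gR (@ge0 b).
have hroot : \sum_(b : rt_edge T | rt_src b == root) a b <= 1.
  have := gD (@AtVertex R TG root); rewrite /= eqxx /ord_at sum_tangent_vertex /=.
  rewrite [X in - (_ + X)]big1; first by rewrite addr0 (eq_bigr a) ?subr_ge0 // => b /eqP hb; rewrite /a hb.
  by move=> b /eqP hb; have := valP b; rewrite -[val b]/(rt_tgt b) hb eqxx.
have hv (b0 : rt_edge T) : \sum_(b : rt_edge T | rt_src b == val b0) a b <= z b0.
  have := gD (@AtVertex R TG (val b0)).
  rewrite /= (_ : (AtVertex _ == _) = false); last first.
    by apply/eqP => /AtVertex_inj hb; case/eqP: (valP b0).
  rewrite add0r /ord_at sum_tangent_vertex /=.
  rewrite [X in - (_ + X)](big_pred1 b0); last by move=> b /=; rewrite -val_eqE.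
  by rewrite (eq_bigr a) ?oppr_ge0 -?lerBrDr ?sub0r // => b /eqP hb; rewrite /a hb.
(* From the leaves down; at a leaf the sum in [hv] is empty. *)
have z0 b : 0 <= z b.
  move: b => [v hv0]; move: v hv0; apply: rt_ind_up => v IH hv0.
  apply: le_trans (hv (exist _ v hv0)); apply: sumr_ge0 => -[b hb] /eqP hbv.
  by apply: le_trans (za _); exact: IH.
have a0 b : 0 <= a b by exact: le_trans (za b).
(* From the root up; at the root the bound 1 is the coefficient of [(y_0)]. *)
have le1 v : \sum_(b : rt_edge T | rt_src b == v) a b <= 1.
  move: v; apply: rt_ind => // v hv0 IH.
  apply: (le_trans (hv (exist _ v hv0))); apply: (le_trans (za _)).
  apply: le_trans IH; rewrite (bigD1 (exist _ v hv0 : rt_edge T)) //= lerDl.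
  exact: sumr_ge0.
have a1 b : a b <= 1.
  apply: le_trans (le1 (rt_src b)); rewrite (bigD1 b) //= lerDl.
  exact: sumr_ge0.
have /choice[A hA] : forall b : rt_edge T, exists A : R,
  [/\ 0 <= A <= rt_len b, (z b = 1 -> A = rt_len b), (a b = 0 -> A = 0), (a b = 1 -> 0 < A) &
  forall u, 0 <= u <= rt_len b ->
   g (@epoint R TG b u) = g (@AtVertex R TG (rt_src b)) + Num.min u A].
  by move=> b; exact: (concave_edge gR (@ge0 b) (a1 b) (z0 b)).
have a01 b : a b = 0 \/ a b = 1.
  have := a0 b; have := a1 b; case: (a b) => // -[|[|n]] //; by [left|right].
have apar (b b' : rt_edge T) : rt_src b' = val b -> a b' = 1 -> z b = 1.
  move=> hb ha; apply/eqP; rewrite eq_le (le_trans (za b) (a1 b)) /=.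
  apply: le_trans (hv b); rewrite (bigD1 b') ?hb //= ha lerDl; exact: sumr_ge0.
have auniq (b b' : rt_edge T) : rt_src b' = rt_src b -> a b = 1 -> a b' = 1 -> b = b'.
  move=> hb ha ha'; apply/eqP; apply/contraT => ne.
  have := le1 (rt_src b); rewrite (bigD1 b) //= (bigD1 b') /=; last by rewrite hb eqxx eq_sym.
  rewrite ha ha' gerDl => H; have : 1 + 0 <= (1 : int) + \sum_(i | (rt_src i == rt_src b) && (i != b) && (i != b')) a i.
    by apply: lerD => //; exact: sumr_ge0.
  by move=> /le_trans/(_ H).
have [/existsP[b0 hb0]|/existsPn hn] := boolP [exists b : rt_edge T, a b == 1]; last first.
  (* Then [g] is constant, which is the profile with [tau = 0] on any edge at the root. *)
  have {}hn b : a b = 0 by case: (a01 b) => // ab; have := hn b; rewrite ab eqxx.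
  have [w hw] := rt_exists_child T; exists w, 0; split; first by rewrite lexx ltW // rt_len_gt0.
  move=> b s hs; case: (hA b) => _ _ /(_ (hn b)) -> _ ->; rewrite // /active.
  case: eqP => // /eqP bw; case: ifP => // an; exfalso.
  move: an; rewrite rt_ancE val_eqE (negPf bw) hw => /rt_anc_of_root hb.
  by have := valP b; rewrite hb eqxx.
(* The path of growth ends in the highest edge on which [g] starts to grow. *)
pose w := [arg max_(b > b0 | a b == 1) ht (val b)]%O.
have [hw hmax] : a w = 1 /\ forall b, a b = 1 -> ht (val b) <= ht (val w).
  rewrite /w; case: arg_maxP => // b /eqP hb hm; split=> // b' hb'; apply: hm; exact/eqP.
(* An edge below a growing edge is growing too, and along its whole length. *)
have anc_act v (b b' : rt_edge T) : rt_anc v (val b') -> a b' = 1 -> v = val b -> a b = 1 /\ (b != b' -> z b = 1).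
  move: b'; have ind : forall u (hu : u != root), rt_anc v u -> a (exist _ u hu) = 1 -> v = val b ->
      a b = 1 /\ (v != u -> z b = 1).
    apply: rt_ind; first by move=> hu; case/eqP: (hu).
    move=> u hu IH hu' an au vb.
    move: an; rewrite rt_ancE => /predU1P[vu|an].
      have E : b = exist _ u hu' by apply/val_inj; rewrite -vb vu.
      by rewrite E vu eqxx au.
    have pr : par u != root.
      by apply: contraTneq an => ->; apply/negP => /rt_anc_of_root v0; move: (valP b); rewrite -vb v0 eqxx.
    have ap : z (exist _ (par u) pr) = 1 by apply: apar au.
    have aa : a (exist _ (par u) pr) = 1.
      by apply/eqP; rewrite eq_le a1 -ap za.
    have [h1 h2] := IH pr an aa vb; split=> // _.
    have [E|] := eqVneq v (par u); last exact: h2.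
    by rewrite -ap; congr z; apply/val_inj; rewrite -vb E.
  move=> [u hu] an au vb; have [h1 h2] := ind u hu an au vb; split=> // ne; apply: h2.
  by apply: contraNneq ne => vu; apply/eqP/val_inj; rewrite -vb vu.
(* A growing edge off the path to [w] would have a growing sibling on that path, against [auniq], or
   lie above [w], against the choice of [w]. *)
have act_anc (b : rt_edge T) : a b = 1 -> rt_anc (val b) (val w).
  move: b => [v hv0]; move: v hv0; apply: rt_ind; first by move=> hu; case/eqP: (hu).
  move=> v hv0 IH hv1 av.
  have anp : rt_anc (par v) (val w).
    have [->|pr] := eqVneq (par v) root; first exact: rt_anc_root.
    apply: (IH pr).
    have zz : z (exist _ (par v) pr) = 1 by apply: apar av.
    by apply/eqP; rewrite eq_le a1 -zz za.
  have [E|ne] := eqVneq (par v) (val w).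
    by have := hmax _ av; rewrite /= -E leNgt rt_par_lt.
  have [c [cr cp can]] := rt_child_towards anp ne.
  have [ac _] := anc_act c (exist _ c cr) w can hw erefl.
  have := auniq (exist _ c cr) (exist _ v hv1); rewrite /rt_src /= cp => /(_ erefl ac av).
  by case=> <-.
exists w, (A w); split; first by case: (hA w).
move=> b s hs; case: (hA b) => _ hz h0 _ ->; rewrite // /active.
congr (_ + Num.min _ _); case: eqP => [->//|/eqP bw].
case: ifP => [an|/negbT an].
  by apply: hz; have [_] := anc_act _ b w an hw erefl; apply.
by apply: h0; case: (a01 b) => // ab; rewrite act_anc in an.
Qed.

End ToProfile.

(** * Morphisms given on models *)

Section IdentityModel.
Variables (R : realType) (G : metric_graph R).

(** Kept transparent, since vertices and edges of this model are used as those of [G]. *)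
Definition model_id : model G.
Proof.
by apply: (@Model R G G id) => // x; exists x.
Defined.

End IdentityModel.

Section Darts.
Variables (R : realType) (G : metric_graph R).
Implicit Types (a nu : dart G).

Lemma drevK : involutive (@drev R G).
Proof. by case=> e b; rewrite /drev /= negbK. Qed.

Lemma drev_neq a : drev a != a.
Proof. by case: a => e []; rewrite /drev /= xpair_eqE eqxx. Qed.

Lemma dart_eqP a nu : a.1 = nu.1 -> a = nu \/ drev a = nu.
Proof. by case: a nu => e b [e' b'] /= <-; case: b; case: b'; rewrite /drev /=; auto. Qed.

Lemma dpoint_rev a t : dpoint (drev a) t = dpoint a (len a.1 - t).
Proof. by case: a => e []; rewrite /dpoint /= ?subKr. Qed.

Lemma sum_darts (V : nmodType) (F : dart G -> V) :
  \sum_a F a = \sum_e (F (e, false) + F (e, true)).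
Proof.
rewrite (eq_bigr (fun a => F (a.1, a.2))); last by case.
rewrite -(pair_bigA _ (fun e b => F (e, b))) /=; apply: eq_bigr => e _.
by rewrite big_bool addrC.
Qed.

Lemma dpoint_in a t : 0 < t < len a.1 -> exists t' (h : 0 < t' < len a.1),
  dpoint a t = InEdge h /\ t' = if a.2 then len a.1 - t else t.
Proof.
move=> ht; have h : 0 < (if a.2 then len a.1 - t else t) < len a.1 by case: a.2; lra.
by exists (if a.2 then len a.1 - t else t), h; rewrite /dpoint (epoint_in h).
Qed.

Lemma move_inj (y : realization G) nu nu' : nu \in tangent y -> nu' \in tangent y ->
  exists2 eps : R, 0 < eps & forall r r', 0 < r < eps -> 0 < r' < eps ->
    move y nu r = move y nu' r' -> nu = nu' /\ r = r'.
Proof.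
case: y => [v|e u h]; rewrite !inE /=; last first.
  move=> /eqP h1 /eqP h2; exists (Num.min u (len e - u)).
    by case/andP: h => u0 u1; rewrite lt_min u0 subr_gt0.
  move=> r r'; rewrite !lt_min => /andP[r0 /andP[r1 r2]] /andP[r0' /andP[r1' r2']].
  case: nu nu' h1 h2 => [e1 b1] [e2 b2] /= -> ->.
  case/andP: h => u0 u1.
  move=> /epoint_inj[]; first by case: b1; lra.
  by move=> _; case: b1; case: b2 => E; try (exfalso; lra); split=> //; lra.
(* Half the lengths, because the two darts of a loop meet at its midpoint. *)
move=> _ _; exists (Num.min (len nu.1 / 2) (len nu'.1 / 2)).
  by have := len_gt0 nu.1; have := len_gt0 nu'.1; rewrite lt_min => *; apply/andP; split; lra.
move=> r r'; rewrite !lt_min => /andP[r0 /andP[r1 r2]] /andP[r0' /andP[r1' r2']].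
case: nu nu' r1 r2 r1' r2' => [e1 b1] [e2 b2] /= r1 r2 r1' r2'.
rewrite /dpoint /= => /epoint_inj[]; first by case: b1; lra.
by move=> E; subst e2; case: b1; case: b2 => E; try (exfalso; lra); split=> //; lra.
Qed.

End Darts.

Section FiniteSums.

Lemma fsbig_finType_image (V : nmodType) (I : finType) (J : choiceType) (h : I -> J) (P : pred I)
    (A : set J) (F : J -> V) : {in P &, injective h} ->
  (forall y, A y <-> exists2 i, P i & y = h i) ->
  (\sum_(y \in A) F y = \sum_(i | P i) F (h i))%R.
Proof.
move=> hi hA.
rewrite (_ : A = [set h x | x in [set` [seq i <- enum I | P i]]]).
  rewrite fsbig_image; last first.
    move=> x y /set_mem /=; rewrite mem_filter => /andP[hx _] /set_mem /=.
    by rewrite mem_filter => /andP[hy _]; exact: hi.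
  rewrite -fsbig_seq; last by rewrite filter_uniq // enum_uniq.
  by rewrite big_filter big_enum_cond.
apply/seteqP; split=> y.
  by move=> /hA[i hP ->]; exists i => //=; rewrite mem_filter hP mem_enum.
by move=> [i /=]; rewrite mem_filter => /andP[hP _] <-; apply/hA; exists i.
Qed.

End FiniteSums.

(* A morphism given on a model: [fE e] is the oriented edge onto which [e] is mapped, and
   [p e] its dilation factor. *)
Section GraphMorphism.
Variables (R : realType) (G T : metric_graph R).
Variables (fV : vertex G -> vertex T) (fE : edge G -> dart T) (p : edge G -> nat).
Hypothesis p_gt0 : forall e, (0 < p e)%N.
Hypothesis fE_len : forall e, len (fE e).1 = (p e)%:R * len e.
Hypothesis fE_tail : forall e, dtail (fE e) = fV (src e).
Hypothesis fE_head : forall e, dhead (fE e) = fV (tgt e).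

Definition graph_map (x : realization G) : realization T :=
  match x with
  | AtVertex v => AtVertex (fV v)
  | InEdge e t _ => dpoint (fE e) ((p e)%:R * t)
  end.

Local Notation phi := graph_map.

Definition dart_map (mu : dart G) : dart T := if mu.2 then drev (fE mu.1) else fE mu.1.

Lemma dart_map_tail mu : dtail (dart_map mu) = fV (dtail mu).
Proof. by case: mu => e []; rewrite /dart_map /= ?fE_tail // -fE_head. Qed.

Let p_gt0R e : 0 < (p e)%:R :> R. Proof. by rewrite ltr0n. Qed.

Lemma graph_map_epoint e t : 0 <= t <= len e ->
  phi (epoint e t) = dpoint (fE e) ((p e)%:R * t).
Proof.
move=> /epointP[->|->|h] //=; first by rewrite mulr0 dpoint0 fE_tail.
rewrite -fE_len -fE_head -[fE e in RHS]drevK dpoint_rev.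
by rewrite subrr dpoint0.
Qed.

Lemma graph_map_finite : finite_morphism phi.
Proof.
exists (model_id G), (model_id T); split; first by move=> v; exists (fV v).
move=> e; exists (fE e), (p e)%:Z; split=> //; first by rewrite ltz_nat.
by move=> t ht; rewrite /= graph_map_epoint.
Qed.

Lemma scaled_in e s : 0 < s < len e -> 0 < (p e)%:R * s < len (fE e).1.
Proof. by move=> /andP[s0 s1]; rewrite fE_len mulr_gt0 //= ltr_pM2l. Qed.

Lemma tangent_dart_map x mu : mu \in tangent x -> dart_map mu \in tangent (phi x).
Proof.
case: x => [v|e s h]; rewrite !inE /=; first by move=> /eqP <-; rewrite ?inE; apply/eqP; exact: dart_map_tail.
move=> /eqP h1; have [t' [h' [-> _]]] := dpoint_in (scaled_in h).
by rewrite inE /dart_map; case: mu h1 => e' [] /= ->.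
Qed.

Lemma graph_map_move x mu : mu \in tangent x -> exists2 eps : R, 0 < eps &
  forall r, 0 <= r <= eps ->
    phi (move x mu r) = move (phi x) (dart_map mu) ((p mu.1)%:R * r).
Proof.
case: x => [v|e s h]; rewrite inE.
  case: mu => e b /eqP hv; exists (len e); first exact: len_gt0.
  move=> r /andP[r0 r1]; rewrite /dart_map /=; case: b hv => hv /=.
    rewrite [in LHS]/dpoint /= graph_map_epoint; last by lra.
    by rewrite dpoint_rev fE_len mulrBr.
  by rewrite [in LHS]/dpoint /= graph_map_epoint // r0.
case/andP: (h) => s0 s1.
case: mu => e' b /eqP /= hE; subst e'; exists (Num.min s (len e - s)).
  by rewrite lt_min s0 subr_gt0.
move=> r /andP[r0]; rewrite le_min => /andP[r1 r2].
have [t' [h' [-> Et]]] := dpoint_in (scaled_in h).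
rewrite /dart_map; case: b => /=; (rewrite graph_map_epoint; last by lra);
by rewrite Et /dpoint; case: (fE e).2 => /=; congr epoint; ring.
Qed.

Lemma graph_map_dilation x mu : mu \in tangent x ->
  is_dilation phi x mu (dart_map mu) (p mu.1).
Proof. by move=> /graph_map_move[eps e0 h]; split; [rewrite ltz_nat|exists eps]. Qed.

Lemma graph_map_dilation_uniq x mu nu m : mu \in tangent x -> nu \in tangent (phi x) ->
  is_dilation phi x mu nu m -> nu = dart_map mu /\ m = p mu.1.
Proof.
move=> hmu hnu [m0 [eps e0 h]].
have [eps' e0' h'] := graph_map_move hmu.
have [d d0 hd] := move_inj hnu (tangent_dart_map hmu).
have mR : 0 < m%:~R :> R by rewrite ltr0z.
pose q : R := (p mu.1)%:R; have q0 : 0 < q by exact: p_gt0R.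
(* With [M * r <= d] both dilated distances are below the bound [d] under which points in different
   directions differ. *)
pose M := 2 * (m%:~R + q).
have M0 : 0 < M by rewrite /M; lra.
pose r := Num.min (Num.min eps eps') (d / M).
have r0 : 0 < r by rewrite !lt_min e0 e0' divr_gt0.
have r1 : r <= eps by rewrite !ge_min lexx.
have r2 : r <= eps' by rewrite !ge_min lexx orbT.
have r3 : M * r <= d by rewrite mulrC -ler_pdivlMr // !ge_min lexx !orbT.
have a0 : 0 < m%:~R * r by exact: mulr_gt0.
have b0 : 0 < q * r by exact: mulr_gt0.
have E : M * r = 2 * (m%:~R * r) + 2 * (q * r) by rewrite /M; ring.
have h1 : 0 < m%:~R * r < d by apply/andP; split; lra.
have h2 : 0 < q * r < d by apply/andP; split; lra.
have h3 : move (phi x) nu (m%:~R * r) = move (phi x) (dart_map mu) (q * r).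
  by rewrite -h ?(ltW r0) // h' ?(ltW r0).
have [-> E'] := hd _ _ h1 h2 h3.
split=> //; move/(mulIf (lt0r_neq0 r0)): E'; rewrite /q -[_%:R]/((p mu.1)%:Z%:~R).
by move=> /eqP; rewrite eqr_int => /eqP.
Qed.

Lemma graph_map_dir_degree x nu : nu \in tangent (phi x) ->
  dir_degree phi x nu = \sum_(mu in tangent x | dart_map mu == nu) (p mu.1)%:Z.
Proof.
move=> hnu; rewrite /dir_degree.
rewrite (eq_bigl (fun mu => (mu \in tangent x) && (dart_map mu == nu))); last first.
  move=> mu; case: (boolP (mu \in tangent x)) => //= hmu; apply/asboolP/eqP.
    by move=> [m hm]; have [->] := graph_map_dilation_uniq hmu hnu hm.
  by move=> <-; exists (p mu.1); exact: graph_map_dilation.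
apply: eq_bigr => mu /andP[hmu /eqP hE].
rewrite /dilation; apply: xget_unique; first by rewrite -hE; exact: graph_map_dilation.
by move=> m hm; have [] := graph_map_dilation_uniq hmu hnu hm.
Qed.

Variable mult : vertex G -> int.
Hypothesis multP : forall v nu, dtail nu = fV v ->
  \sum_(mu in tangent (@AtVertex R G v) | dart_map mu == nu) (p mu.1)%:Z = mult v.

Lemma dir_degree_vertex v nu : nu \in tangent (@AtVertex R T (fV v)) ->
  dir_degree phi (AtVertex v) nu = mult v.
Proof. by move=> h; rewrite graph_map_dir_degree // multP //; move: h; rewrite inE => /eqP. Qed.

Lemma dir_degree_edge e s (h : 0 < s < len e) nu : nu \in tangent (phi (InEdge h)) ->
  dir_degree phi (InEdge h) nu = p e.
Proof.
move=> hnu; rewrite graph_map_dir_degree // big_mkcondr (sum_tangent_edge h) /=.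
have [t' [h' [E _]]] := dpoint_in (scaled_in h).
move: hnu; rewrite /= E inE /dart_map /= => /eqP hnu.
have [<-|<-] := dart_eqP (esym hnu).
  by rewrite eqxx (negPf (drev_neq _)) addr0.
by rewrite eqxx eq_sym (negPf (drev_neq _)) add0r.
Qed.

Lemma graph_map_harmonic : harmonic_morphism phi.
Proof.
case=> [v|e s h] nu nu' hnu hnu'; first by rewrite !dir_degree_vertex.
by rewrite !dir_degree_edge.
Qed.

Lemma local_degree_vertex v : local_degree phi (AtVertex v) = mult v.
Proof.
rewrite /local_degree; case: pickP => [nu hnu|hn]; first by rewrite dir_degree_vertex.
have [a ha] := exists_dart (fV v).
by have := hn a; rewrite inE ha eqxx.
Qed.

Lemma local_degree_edge e s (h : 0 < s < len e) : local_degree phi (InEdge h) = p e.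
Proof.
rewrite /local_degree; case: pickP => [nu hnu|hn]; first by rewrite dir_degree_edge.
have ht : (e, false) \in tangent (InEdge h) by rewrite inE.
by have := hn (dart_map (e, false)); rewrite tangent_dart_map.
Qed.

(** Both sides count the darts over [nu] with their dilation factors: on the left by their tails, on
    the right by their edges, where each edge over that of [nu] has exactly one orientation over
    [nu]. *)
Lemma fiber_over_dart nu : \sum_(v | fV v == dtail nu) mult v =
  \sum_(e | (fE e).1 == nu.1) (p e)%:Z.
Proof.
transitivity (\sum_(mu | dart_map mu == nu) (p mu.1)%:Z).
  rewrite (partition_big (@dtail R G) (fun v => fV v == dtail nu)) /=; last first.
    by move=> mu /eqP <-; rewrite dart_map_tail.
  apply: eq_bigr => v /eqP hv; rewrite -(multP (esym hv)).
  by apply: eq_bigl => mu; rewrite inE andbC.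
rewrite big_mkcond sum_darts [RHS]big_mkcond /=; apply: eq_bigr => e _.
rewrite /dart_map /=; have [hE|hE] := eqVneq (fE e).1 nu.1.
  have [<-|<-] := dart_eqP hE.
    by rewrite eqxx (negPf (drev_neq _)) addr0.
  by rewrite eqxx eq_sym (negPf (drev_neq _)) add0r.
by rewrite !ifF ?addr0 //; apply/eqP => hh; case/eqP: hE; rewrite -hh.
Qed.

(** By [fiber_over_dart] the two ends of an edge of [T] have the same count, and [T] is
    connected. *)
Lemma fiber_over_vertex u w :
  \sum_(v | fV v == u) mult v = \sum_(v | fV v == w) mult v.
Proof.
have step e : \sum_(v | fV v == src e) mult v = \sum_(v | fV v == tgt e) mult v.
  by rewrite (fiber_over_dart (e, false)) (fiber_over_dart (e, true)).
have /connectP[q] := graph_connected u w.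
elim: q u => [|u' q IH] u /=; first by move=> _ ->.
move=> /andP[/existsP[e he] hq] hl; rewrite -(IH _ hq hl).
by case/orP: he => /andP[/eqP <- /eqP <-]; rewrite step.
Qed.

Lemma graph_map_has_degree w0 (d : int) : \sum_(v | fV v == w0) mult v = d ->
  has_degree phi d.
Proof.
move=> hd y; case: (realizationP y) => [[w ->]|[b [u [hu ->]]]].
  rewrite (fsbig_finType_image (h := @AtVertex R G) (P := fun v => fV v == w)).
  - by rewrite -hd (fiber_over_vertex w0 w); apply: eq_bigr => v _; exact: local_degree_vertex.
  - by move=> v v' _ _; exact: AtVertex_inj.
  - move=> x; split; last by move=> [v /eqP <- ->].
    case: x => [v|e s h] /=; first by move=> /AtVertex_inj <-; exists v.
    by have [t' [h' [-> _]]] := dpoint_in (scaled_in h).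
(* The parameter of the only point of [e] over the given point of [b]. *)
pose s e := (if (fE e).2 then len b - u else u) / (p e)%:R.
have hs e : (fE e).1 = b -> 0 < s e < len e.
  move=> hE; rewrite /s divr_gt0 ?ltr_pdivrMr //= ?(mulrC _ (p e)%:R) -?fE_len ?hE; by case: (fE e).2; lra.
have hps e : (p e)%:R * s e = if (fE e).2 then len b - u else u.
  by rewrite /s mulrC divfK // gt_eqF.
have img e : (fE e).1 = b -> phi (epoint e (s e)) = epoint b u.
  move=> hE; rewrite graph_map_epoint; last by have /andP[/ltW -> /ltW ->] := hs _ hE.
  by rewrite hps /dpoint hE; case: (fE e).2; rewrite // subKr.
rewrite -hd (fiber_over_vertex w0 (src b)) (fiber_over_dart (b, false)) /=.
rewrite (fsbig_finType_image (h := fun e => epoint e (s e)) (P := fun e => (fE e).1 == b)).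
- apply: eq_bigr => e /eqP hE; have hse := hs _ hE.
  by rewrite (epoint_in hse) local_degree_edge.
- move=> e e' /eqP hE _ /=; have hse := hs _ hE.
  by move=> /(epoint_inj hse)[].
- move=> x; split; last by move=> [e /eqP hE ->]; exact: img.
  rewrite /preimage /=; case: (realizationP x) => [[v ->] /= E|[e [t [ht ->]]]].
    by case: (epointNvertex hu (esym E)).
  rewrite graph_map_epoint; last by have /andP[/ltW -> /ltW ->] := ht.
  have := scaled_in ht => hpt.
  rewrite /dpoint => /esym/(epoint_inj hu)[E1 E2]; exists e; first by rewrite E1.
  congr epoint; have pe := p_gt0R e; apply: (mulfI (lt0r_neq0 pe)).
  by rewrite hps E2 E1; case: (fE e).2; rewrite ?subKr.
Qed.

End GraphMorphism.

(** * Attaching trees *)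

Section Wedge.
Variables (R : realType) (G : metric_graph R) (A : finType) (Tr : A -> metric_graph R).
Variables (q : forall a, vertex (Tr a)) (v0 : A -> vertex G).

(** No quotient is formed: [q a] is replaced by [v0 a], and only the other vertices of [Tr a] are
    added. *)
Definition wedge_new a : finType := {x : vertex (Tr a) | x != q a}.
Definition wedge_vertex : finType := (vertex G + {a : A & wedge_new a})%type.
Definition wedge_edge : finType := (edge G + {a : A & edge (Tr a)})%type.

Definition wedge_tree_vertex a (x : vertex (Tr a)) : wedge_vertex :=
  if (insub x : option (wedge_new a)) is Some y then inr (existT _ a y) else inl (v0 a).

Local Notation jv := wedge_tree_vertex.

Definition wedge_src (e : wedge_edge) : wedge_vertex :=
  match e with inl e => inl (src e) | inr (existT a e) => jv (src e) end.
Definition wedge_tgt (e : wedge_edge) : wedge_vertex :=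
  match e with inl e => inl (tgt e) | inr (existT a e) => jv (tgt e) end.
Definition wedge_len (e : wedge_edge) : R :=
  match e with inl e => len e | inr (existT a e) => len e end.

Lemma jv_q a : jv (q a) = inl (v0 a).
Proof. by rewrite /jv insubN // eqxx. Qed.

Lemma jv_val a (y : wedge_new a) : jv (val y) = inr (existT _ a y).
Proof. by rewrite /jv valK. Qed.

Lemma jv_inl a (x : vertex (Tr a)) u : jv x = inl u -> x = q a /\ u = v0 a.
Proof.
rewrite /jv; case: insubP => // hx [->]; split=> //.
by move: hx; rewrite negbK => /eqP.
Qed.

Lemma jv_inj a : injective (@jv a).
Proof.
move=> x x'; rewrite {1}/jv; case: insubP => [y _ <-|hx].
  move=> /esym; rewrite /jv; case: insubP => // y' _ <- [E].
  have := congr1 (tagged_as (existT _ a y)) E.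
  by rewrite !tagged_asE => ->.
move=> /esym/jv_inl[-> _]; by move: hx; rewrite negbK => /eqP.
Qed.

Lemma jv_meet a a' (x : vertex (Tr a)) (x' : vertex (Tr a')) : a != a' -> jv x = jv x' ->
  x = q a /\ x' = q a'.
Proof.
move=> ne; rewrite {1}/jv; case: insubP => [y _ <-|hx].
  move=> /esym; rewrite /jv; case: insubP => // y' _ <- [E _].
  by rewrite E eqxx in ne.
move=> /esym/jv_inl[-> _]; by move: hx; rewrite negbK => /eqP.
Qed.

Lemma wedge_len_gt0 e : 0 < wedge_len e.
Proof. by case: e => [e|[a e]]; exact: len_gt0. Qed.

Lemma wedge_edge_gt0 : (0 < #|wedge_edge|)%N.
Proof. by have /card_gt0P[e _] := edge_gt0 G; apply/card_gt0P; exists (inl e). Qed.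

Lemma wedge_connected u v : connect (graph_adj wedge_src wedge_tgt) u v.
Proof.
have [a0 _] : exists e : edge G, true.
  by have /card_gt0P[e _] := edge_gt0 G; exists e.
have base x : connect (graph_adj wedge_src wedge_tgt) (inl x) (inl (src a0)).
  apply: (connect_morph (s := @src R G) (t := @tgt R G)) => [e|]; last exact: graph_connected.
  exact: (connect_edge wedge_src wedge_tgt (inl e)).
apply: (@connected_to_root _ _ _ _ (inl (src a0))) => {u v} -[x|[a y]]; first exact: base.
apply: connect_trans (base (v0 a)); rewrite -jv_q -jv_val.
apply: (connect_morph (s := @src R (Tr a)) (t := @tgt R (Tr a))) => [e|]; last exact: graph_connected.
exact: (connect_edge wedge_src wedge_tgt (inr (existT _ a e))).
Qed.

Definition wedge : metric_graph R := MetricGraph wedge_len_gt0 wedge_edge_gt0 wedge_connected.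

Definition wedge_incl (x : realization G) : realization wedge :=
  match x with
  | AtVertex u => @AtVertex R wedge (inl u)
  | InEdge e t h => @InEdge R wedge (inl e) t h
  end.

Definition wedge_emb a (x : realization (Tr a)) : realization wedge :=
  match x with
  | AtVertex u => @AtVertex R wedge (jv u)
  | InEdge e t h => @InEdge R wedge (inr (existT _ a e)) t h
  end.

Definition wedge_retract (z : realization wedge) : realization G :=
  match z with
  | AtVertex (inl u) => AtVertex u
  | AtVertex (inr (existT a _)) => AtVertex (v0 a)
  | InEdge (inl e) t _ => epoint e t
  | InEdge (inr (existT a _)) _ _ => AtVertex (v0 a)
  end.

Lemma wedge_incl_epoint e t : 0 <= t <= len e ->
  wedge_incl (epoint e t) = @epoint R wedge (inl e) t.
Proof.
move=> /epointP[->|->|h] /=; first by rewrite (@epoint0 R wedge).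
  by rewrite (@epoint_len R wedge (inl e)).
by rewrite -(@epoint_in R wedge (inl e)).
Qed.

Lemma wedge_emb_epoint a (e : edge (Tr a)) t : 0 <= t <= len e ->
  wedge_emb (epoint e t) = @epoint R wedge (inr (existT _ a e)) t.
Proof.
move=> /epointP[->|->|h] /=; first by rewrite (@epoint0 R wedge).
  by rewrite (@epoint_len R wedge (inr (existT _ a e))).
by rewrite -(@epoint_in R wedge (inr (existT _ a e))).
Qed.

Lemma wedge_retract_incl : cancel wedge_incl wedge_retract.
Proof. by case=> [//|e t h] /=; rewrite (epoint_in h). Qed.

Lemma wedge_retract_vertex a (x : vertex (Tr a)) :
  wedge_retract (@AtVertex R wedge (jv x)) = AtVertex (v0 a).
Proof. by rewrite /= /jv; case: insubP. Qed.

Lemma wedge_retract_emb a (y : realization (Tr a)) : wedge_retract (wedge_emb y) = AtVertex (v0 a).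
Proof. by case: y => [x|e t h] //; exact: wedge_retract_vertex. Qed.

Lemma wedge_meet_base a (y : realization (Tr a)) x : wedge_emb y = wedge_incl x ->
  y = AtVertex (q a).
Proof.
case: y x => [u|e t h] [w|e' t' h'] //=.
by move=> /AtVertex_inj/jv_inl[-> _].
Qed.

Lemma wedge_meet_tree a a' (y : realization (Tr a)) (y' : realization (Tr a')) : a != a' ->
  wedge_emb y = wedge_emb y' -> y = AtVertex (q a) /\ y' = AtVertex (q a').
Proof.
move=> ne; case: y y' => [u|e t h] [w|e' t' h'] //=.
  by move=> /AtVertex_inj/(jv_meet ne)[-> ->].
by move=> /InEdge_inj[[E _] _]; rewrite E eqxx in ne.
Qed.

Lemma wedge_emb_inj a : injective (@wedge_emb a).
Proof.
case=> [u|e t h] [w|e' t' h'] //=; first by move=> /AtVertex_inj/jv_inj ->.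
move=> /InEdge_inj[[E] Et]; have := congr1 (tagged_as (existT (fun a => edge (Tr a)) a e)) E.
rewrite !tagged_asE => {}E; subst e'; exact: InEdge_eq.
Qed.

Lemma wedge_incl_isometric : isometric_embedding wedge_incl.
Proof.
apply: isometric_from_retraction wedge_retract_incl _ _.
  apply: lipschitz_from_edges => e s t hs ht; rewrite !wedge_incl_epoint //.
  exact: path_dist_edge.
apply: lipschitz_from_edges => -[e|[a e]] s t hs ht.
  by rewrite -!wedge_incl_epoint // !wedge_retract_incl; exact: path_dist_edge.
by rewrite -!wedge_emb_epoint // !wedge_retract_emb (le_trans (path_distxx _)).
Qed.

Lemma wedge_emb_isometric a : isometric_embedding (@wedge_emb a).
Proof.
(* [K] inverts the embedding; by the default of [xget] it collapses everything outside the tree to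
   the attaching point. *)
pose K (z : realization wedge) := xget (AtVertex (q a)) [set y | wedge_emb y = z].
have KE y : K (wedge_emb y) = y.
  by apply: xget_unique => // y' /wedge_emb_inj.
have Kroot z : (forall y : realization (Tr a), wedge_emb y = z -> y = AtVertex (q a)) ->
    K z = AtVertex (q a).
  by move=> h; rewrite /K; case: xgetP => // y _ hy; exact: h.
apply: (isometric_from_retraction KE).
  apply: lipschitz_from_edges => e s t hs ht; rewrite !wedge_emb_epoint //.
  exact: path_dist_edge.
apply: lipschitz_from_edges => -[e|[a' e]] s t hs ht.
  rewrite -!wedge_incl_epoint // !Kroot ?(le_trans (path_distxx _)) //;
  by move=> y; exact: wedge_meet_base.
have [E|ne] := eqVneq a a'.
  by subst a'; rewrite -!wedge_emb_epoint // !KE; exact: path_dist_edge.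
rewrite -!wedge_emb_epoint // !Kroot ?(le_trans (path_distxx _)) //;
by move=> y /(wedge_meet_tree ne)[].
Qed.

Lemma wedge_cover z : (exists x, z = wedge_incl x) \/ (exists a (y : realization (Tr a)), z = wedge_emb y).
Proof.
case: z => [[u|[a y]]|[e|[a e]] t h].
- by left; exists (AtVertex u).
- by right; exists a, (AtVertex (val y)); rewrite /= jv_val.
- by left; exists (@InEdge R G e t h).
- by right; exists a, (@InEdge R (Tr a) e t h).
Qed.

(** Kept transparent, so that [tm_incl] reduces to [wedge_incl]. *)
Definition wedge_modification : (forall a, is_tree (Tr a)) -> tropical_modification G wedge.
Proof.
move=> htree.
apply: (@TropicalModification R G wedge wedge_incl #|A| (fun i => Tr (enum_val i))
  (fun i => @wedge_emb (enum_val i)) (fun i => AtVertex (q (enum_val i)))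
  (fun i => AtVertex (v0 (enum_val i))) wedge_retract).
- by move=> i; exact: htree.
- exact: wedge_incl_isometric.
- by move=> i; exact: wedge_emb_isometric.
- by move=> i; rewrite /= jv_q.
- move=> z; have [[x ->]|[a [y ->]]] := wedge_cover z; first by left; exists x.
  right; exists (enum_rank a).
  have [i E] : exists i : 'I_#|A|, a = enum_val i by exists (enum_rank a); rewrite enum_rankK.
  by subst a; rewrite enum_valK; exists y.
- by move=> i; exact: wedge_meet_base.
- move=> i j y y' ij; apply: wedge_meet_tree; apply: contraNneq ij.
  by move=> /enum_val_inj ->.
- exact: wedge_retract_incl.
- by move=> i; exact: wedge_retract_emb.
Defined.

End Wedge.

(** * Completion to a harmonic morphism *)

Section Branch.
Variables (R : realType) (T : rooted_tree R) (nu : dart (rt_graph T)).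
Local Notation root := (rt_root T).
Local Notation par := (@rt_par R T).
Local Notation anc := (@rt_anc R T).
Local Notation b := (val (nu.1 : rt_edge T) : T).

(* The part of the tree seen from the tail of [nu] in the direction [nu]. *)
Definition in_branch (x : T) : bool :=
  if nu.2 then (x == b) || ~~ anc b x else (x == par b) || anc b x.

(** Heights are inherited from [T], so a branch is rooted at its lowest node. For a direction
    towards the root this differs from the attaching point [branch_tail]. *)
Definition branch_bottom : T := if nu.2 then root else par b.

Let bP : b != root := valP (nu.1 : rt_edge T).

Lemma in_branch_bottom : in_branch branch_bottom.
Proof.
rewrite /in_branch /branch_bottom; case: nu.2; rewrite ?eqxx //.
by rewrite [X in _ || ~~ X](_ : _ = false) ?orbT //; apply: contraNF bP => /rt_anc_of_root ->.
Qed.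

Lemma in_branch_par x : in_branch x -> x != branch_bottom -> in_branch (par x).
Proof.
rewrite /in_branch /branch_bottom; case: nu.2.
  case/predU1P=> [->|nx] _; first by rewrite rt_ancN_par ?orbT.
  by apply/orP; right; apply: contraNN nx => h; rewrite rt_ancE h orbT.
case/predU1P=> [->|]; first by rewrite eqxx.
by rewrite rt_ancE => /predU1P[<-|->]; rewrite ?eqxx ?orbT.
Qed.

Lemma in_branchN_root x : in_branch x -> x != branch_bottom -> x != root.
Proof.
rewrite /in_branch /branch_bottom; case: nu.2 => //.
case/predU1P=> [->|]; first by rewrite eqxx.
by move=> h _; apply: contraTneq h => ->; apply: contraNN bP => /rt_anc_of_root ->.
Qed.

Definition branch_vertex : finType := {x : T | in_branch x}.
Definition branch_root : branch_vertex := exist _ branch_bottom in_branch_bottom.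
Definition branch_par (x : branch_vertex) : branch_vertex :=
  insubd branch_root (if val x == branch_bottom then branch_bottom else par (val x)).
Definition branch_ht (x : branch_vertex) : R := rt_ht (val x).

Lemma val_branch_par x :
  val (branch_par x) = if val x == branch_bottom then branch_bottom else par (val x).
Proof.
rewrite insubdK // -topredE /=; case: eqP => [_|/eqP ne]; first exact: in_branch_bottom.
by apply: in_branch_par => //; exact: (valP x).
Qed.

Lemma branch_par_root : branch_par branch_root = branch_root.
Proof. by apply/val_inj; rewrite val_branch_par eqxx. Qed.

Lemma branch_neq x : x != branch_root -> val x != branch_bottom.
Proof. by apply: contraNneq => h; apply/eqP/val_inj. Qed.

Lemma branch_par_lt x : x != branch_root -> branch_ht (branch_par x) < branch_ht x.
Proof.
move=> /branch_neq hx; rewrite /branch_ht val_branch_par (negPf hx) rt_par_lt //.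
by apply: in_branchN_root hx; exact: (valP x).
Qed.

Lemma in_branch_b : in_branch b.
Proof. by rewrite /in_branch eqxx rt_anc_refl orbT; case: nu.2. Qed.

Lemma b_bottom : b != branch_bottom.
Proof.
rewrite /branch_bottom; case: nu.2 => //.
by have := rt_par_lt bP; apply: contraTneq => <-; rewrite ltxx.
Qed.

Lemma branch_nontrivial : exists x, x != branch_root.
Proof.
by exists (exist _ b in_branch_b); rewrite -val_eqE; exact: b_bottom.
Qed.

Definition branch : rooted_tree R :=
  RootedTree branch_par_root branch_par_lt branch_nontrivial.

Lemma in_branch_tail : in_branch (dtail nu).
Proof.
rewrite /in_branch /dtail /= /rt_tgt /rt_src.
by case: nu.2; rewrite eqxx.
Qed.

Definition branch_tail : branch := exist _ (dtail nu) in_branch_tail.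

Lemma branch_edge_proof (e : rt_edge branch) : val (val e) != root.
Proof. by apply: in_branchN_root (branch_neq (valP e)); exact: (valP (val e)). Qed.

Definition branch_edge (e : rt_edge branch) : rt_edge T := exist _ (val (val e)) (branch_edge_proof e).

Lemma branch_edge_src e : val (rt_src e : branch) = rt_src (branch_edge e).
Proof. by rewrite /rt_src /= val_branch_par (negPf (branch_neq (valP e))). Qed.

Lemma branch_edge_len e : rt_len e = rt_len (branch_edge e).
Proof. by rewrite /rt_len /= /branch_ht val_branch_par (negPf (branch_neq (valP e))). Qed.

Lemma branch_edge_inj : injective branch_edge.
Proof. by move=> e e' [] h; apply/val_inj/val_inj. Qed.

Lemma branch_edge_mem (c : rt_edge T) :
  reflect (exists e, branch_edge e = c) (in_branch (val c) && (val c != branch_bottom)).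
Proof.
apply: (iffP andP) => [[h1 h2]|[e <-]]; last first.
  by split; [exact: (valP (val e))|exact: (branch_neq (valP e))].
have h3 : (exist _ (val c) h1 : branch_vertex) != branch_root by rewrite -val_eqE.
by exists (exist _ (exist _ (val c) h1 : branch_vertex) h3); apply/val_inj.
Qed.

Lemma branch_directions (x : T) (mu : dart (rt_graph T)) : in_branch x -> dtail mu = x ->
  (in_branch (val (mu.1 : rt_edge T)) && (val (mu.1 : rt_edge T) != branch_bottom)) =
  (x != dtail nu) || (mu == nu).
Proof.
move=> hx E; move: hx; rewrite -E {x E} /in_branch /branch_bottom.
case: mu => c s; have cP := valP (c : rt_edge T).
have -> : ((c, s) == nu) = (val (c : rt_edge T) == b) && (s == nu.2).
  by rewrite val_eqE -xpair_eqE -surjective_pairing.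
rewrite /dtail /= /rt_src /rt_tgt.
case: (nu.2) => /=; case: s => /=; rewrite ?cP ?andbT ?andbF ?orbF.
- by move=> ->; case: eqP.
- case/predU1P=> [E|hx].
    rewrite E eqxx /= -E rt_anc_par orbF; apply/negbTE; apply/negP => /eqP h.
    by have := rt_par_lt cP; rewrite -h ltxx.
  have -> : (par (val c) != b) by apply: contraNneq hx => ->; exact: rt_anc_refl.
  by rewrite rt_ancE (negPf hx) orbF eq_sym; case: eqP.
- case/predU1P=> [E|hx].
    rewrite E !eqxx andbF; by [].
  have -> : val c != par b.
    by apply: contraTneq hx => ->; rewrite rt_ancN_par.
  by rewrite hx orbT.
- have npar : (val c == par b) && anc b (val c) = false.
    by apply/negP => /andP[/eqP ->]; rewrite rt_ancN_par.
  case/predU1P=> [E|hx].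
    rewrite E eqxx /= -E rt_ancE.
    have -> : (val c == par (val c)) = false.
      by apply/negP => /eqP h; have := rt_par_lt cP; rewrite -h ltxx.
    by rewrite E rt_ancN_par // orbF eq_sym andbT.
  have h1 : anc b (val c) by rewrite rt_ancE hx orbT.
  rewrite h1 orbT /=; move: npar; rewrite h1 andbT => /negbT ->.
  by rewrite (_ : par (val c) != par b) //; apply: contraTneq hx => ->; rewrite rt_ancN_par.
Qed.

End Branch.

Section Completion.
Variables (R : realType) (G : metric_graph R) (T : rooted_tree R).
Local Notation TG := (rt_graph T).
Local Notation root := (rt_root T).
Variables (fV : vertex G -> T) (fE : edge G -> dart TG) (p : edge G -> nat).
Hypothesis p_gt0 : forall e, (0 < p e)%N.
Hypothesis fE_len : forall e, len (fE e).1 = (p e)%:R * len e.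
Hypothesis fE_tail : forall e, dtail (fE e) = fV (src e).
Hypothesis fE_head : forall e, dhead (fE e) = fV (tgt e).

Implicit Types (nu : dart TG).

Definition local_sum v nu : int :=
  \sum_(mu in tangent (@AtVertex R G v) | dart_map fE mu == nu) (p mu.1)%:Z.

Variable mult : vertex G -> int.
Hypothesis mult_ge : forall v nu, dtail nu = fV v -> local_sum v nu <= mult v.

(* The number of copies of the branch in direction [y.2] to be attached at [y.1]. *)
Definition defect (y : vertex G * dart TG) : nat :=
  if dtail y.2 == fV y.1 then `|mult y.1 - local_sum y.1 y.2|%N else 0%N.

Definition attachment : finType := {y : (vertex G * dart TG)%type & 'I_(defect y)}.

Lemma attachment_tail (a : attachment) : dtail (tag a).2 = fV (tag a).1.
Proof.
case: a => y [j hj] /=; move: hj; rewrite /defect; by case: eqP.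
Qed.

Definition attached (a : attachment) : metric_graph R := rt_graph (branch (tag a).2).
Definition completion_graph : metric_graph R :=
  wedge (Tr := attached) (fun a => branch_tail (tag a).2) (fun a => (tag a).1).

Local Notation W := completion_graph.
Local Notation jv := (wedge_tree_vertex (Tr := attached) (fun a => branch_tail (tag a).2) (fun a => (tag a).1)).

Definition compl_V (v : vertex W) : T :=
  match v with inl v => fV v | inr (existT a y) => val (val y : branch (tag a).2) end.
Definition compl_E (e : edge W) : dart TG :=
  match e with inl e => fE e | inr (existT a e) => (branch_edge e, false) end.
Definition compl_p (e : edge W) : nat := if e is inl e then p e else 1%N.
Definition compl_mult (v : vertex W) : int := if v is inl v then mult v else 1.

Lemma compl_V_jv a (x : branch (tag a).2) : compl_V (jv x) = val x.
Proof.
have [->|ne] := eqVneq x (branch_tail (tag a).2).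
  by rewrite jv_q /= -attachment_tail.
have -> : x = val (exist _ x ne : wedge_new (Tr := attached) (fun a => branch_tail (tag a).2) a) by [].
by rewrite jv_val.
Qed.

Lemma compl_p_gt0 e : (0 < compl_p e)%N.
Proof. by case: e => //=. Qed.

Lemma compl_E_len e : len (compl_E e).1 = (compl_p e)%:R * len e.
Proof. by case: e => [e|[a e]] /=; [exact: fE_len|rewrite branch_edge_len; exact/esym/mul1r]. Qed.

Lemma compl_E_tail e : dtail (compl_E e) = compl_V (src e).
Proof.
case: e => [e|[a e]] /=; first exact: fE_tail.
by rewrite compl_V_jv branch_edge_src.
Qed.

Lemma compl_E_head e : dhead (compl_E e) = compl_V (tgt e).
Proof.
case: e => [e|[a e]] /=; first exact: fE_head.
by rewrite compl_V_jv.
Qed.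

Definition in_attached (a : attachment) (nu : dart TG) : bool :=
  in_branch (tag a).2 (val (nu.1 : rt_edge T)) && (val (nu.1 : rt_edge T) != branch_bottom (tag a).2).

(** A copy embeds into [T], so it has at most one dart over [nu], and that dart starts at the copy
    of the tail of [nu]. *)
Lemma attached_sum (a : attachment) (v : vertex W) nu :
  \sum_(d : dart (attached a)) ((jv (dtail d) == v) && ((branch_edge d.1, d.2) == nu))%:Z =
  (if in_attached a nu then [exists x : branch (tag a).2, (val x == dtail nu) && (jv x == v)]
   else false)%:Z.
Proof.
rewrite /in_attached; case: ifP => [/branch_edge_mem[e he]|hn]; last first.
  rewrite big1 // => d _; case: eqP => //= _; case: eqP => //= hd.
  by move: hn => /branch_edge_mem[]; exists d.1; rewrite -hd.
have hd : (branch_edge e, nu.2) = nu by rewrite he -surjective_pairing.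
rewrite (bigD1 (e, nu.2)) //= hd eqxx andbT big1 ?addr0; last first.
  move=> d hne; case: (jv _ == v) => //=; case: eqP => //= hd'.
  case/eqP: hne; move/eqP: hd'; rewrite -{1}hd xpair_eqE => /andP[/eqP/branch_edge_inj h1 /eqP h2].
  by rewrite [d]surjective_pairing h1 h2.
have tl : val (dtail ((e, nu.2) : dart (attached a)) : branch (tag a).2) = dtail nu.
  by rewrite -hd /dtail /=; case: nu.2 => //=; rewrite branch_edge_src.
congr (nat_of_bool _)%:Z; apply/idP/existsP.
  by move=> hv; exists (dtail ((e, nu.2) : dart (attached a))); rewrite tl eqxx.
move=> [x /andP[/eqP hx hv]].
by rewrite (_ : dtail ((e, nu.2) : dart (attached a)) = x) //; apply/val_inj; exact: etrans tl (esym hx).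
Qed.

Lemma compl_sum v nu :
  \sum_(mu in tangent (@AtVertex R W v) | dart_map compl_E mu == nu) (compl_p mu.1)%:Z =
  (if v is inl v then local_sum v nu else 0) +
  \sum_(a : attachment)
   (if in_attached a nu then [exists x : branch (tag a).2, (val x == dtail nu) && (jv x == v)]
   else false)%:Z.
Proof.
have E (H : metric_graph R) (hE : edge H -> dart TG) (hp : edge H -> nat) (u : vertex H) :
    \sum_(mu in tangent (@AtVertex R H u) | dart_map hE mu == nu) (hp mu.1)%:Z =
    \sum_e \sum_(s : bool) (if (dtail (e, s) == u) && (dart_map hE (e, s) == nu) then (hp e)%:Z else 0).
  rewrite pair_big big_mkcond /=; apply: eq_bigr => -[e s] _.
  by rewrite inE /=.
rewrite E big_sumType /=; congr (_ + _).
  case: v => [v|v] /=; last first.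
    rewrite big1 // => e _; rewrite big1 // => s _; case: ifP => //.
    by rewrite /dtail /=; case: s.
  rewrite /local_sum E; apply: eq_bigr => e _; apply: eq_bigr => s _.
  by rewrite /dart_map /dtail /=; case: s.
rewrite [RHS](eq_bigr _ (fun a _ => esym (attached_sum a v nu))).
transitivity (\sum_(a : attachment) \sum_(e : edge (attached a)) \sum_(s : bool)
   ((jv (dtail ((e, s) : dart (attached a))) == v) && ((branch_edge e, s) == nu))%:Z).
  rewrite (sig_big_dep (J := fun a => edge (attached a)) xpredT (fun _ => xpredT) (fun a e => \sum_(s : bool)
   ((jv (dtail ((e, s) : dart (attached a))) == v) && ((branch_edge e, s) == nu))%:Z)) /=.
  apply: eq_bigr => -[a e] _ /=; apply: eq_bigr => s _.
  rewrite /dart_map /=.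
  have -> : (if s then drev ((branch_edge e, false) : dart TG) else ((branch_edge e, false) : dart TG)) = (branch_edge e, s).
    by case: s.
  have -> : dtail ((inr (existT (fun a => edge (attached a)) a e), s) : dart W) = jv (dtail ((e, s) : dart (attached a))).
    by case: s.
  by case: ifP.
apply: eq_bigr => a _; rewrite pair_big /=.
by apply: eq_bigr => -[e s].
Qed.

Lemma compl_multP v nu : dtail nu = compl_V v ->
  \sum_(mu in tangent (@AtVertex R W v) | dart_map compl_E mu == nu) (compl_p mu.1)%:Z =
  compl_mult v.
Proof.
move=> hnu; rewrite compl_sum; case: v hnu => [v|[a0 y]] /= hnu.
  (* At an old vertex only the copies attached there in the direction [nu] have a dart over [nu];
     their number is the defect. *)
  rewrite (eq_bigr (fun a : attachment => (tag a == (v, nu))%:Z)); last first.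
    move=> a _; congr (nat_of_bool _)%:Z.
    have [av|av] := eqVneq (tag a).1 v; last first.
      rewrite (_ : (tag a == _) = false); last by apply: contraNF av => /eqP ->.
      case: ifP => // _; apply/existsP => -[x /andP[_ /eqP/jv_inl[_ h]]].
      by rewrite h eqxx in av.
    have hx : dtail nu = dtail (tag a).2 by rewrite attachment_tail av.
    rewrite /in_attached (@branch_directions _ _ _ (dtail nu)) //; last first.
      by rewrite hx; exact: in_branch_tail.
    rewrite hx eqxx /= -av (_ : (_ == (_, _)) = (nu == (tag a).2)); last first.
      by rewrite {1}(surjective_pairing (tag a)) xpair_eqE eqxx eq_sym.
    case: ifP => // _; apply/existsP; exists (branch_tail (tag a).2).
    by rewrite /= eqxx jv_q /=.
  rewrite -(sig_big_dep (J := fun y => 'I_(defect y)) xpredT (fun _ => xpredT)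
    (fun y _ => (y == (v, nu))%:Z)) /=.
  rewrite (bigD1 (v, nu)) //= eqxx [X in _ + (_ + X)]big1 ?addr0; last first.
    by move=> y hy; rewrite big1 // => j _; rewrite (negPf hy).
  rewrite sumr_const card_ord /defect /= hnu eqxx -mulr_natr mul1r natz.
  by rewrite gez0_abs ?subr_ge0 ?mult_ge //; ring.
(* A new vertex belongs to its own copy only, which looks there like [T] itself. *)
rewrite add0r (bigD1 a0) //= big1 ?addr0; last first.
  move=> a ne; case: ifP => // _; rewrite (_ : [exists _, _] = false) //.
  apply/existsP => -[x /andP[_ /eqP hj]].
  have [_ hy] := jv_meet ne (etrans hj (esym (jv_val _ y))).
  by have := valP y; rewrite hy eqxx.
have hb : in_branch (tag a0).2 (val (val y)) by exact: (valP (val y)).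
rewrite /in_attached (@branch_directions _ _ _ (dtail nu)) //; last by rewrite hnu.
have -> : dtail nu != dtail (tag a0).2.
  rewrite hnu; apply: contraNneq (valP y) => h; apply/eqP/val_inj; exact: h.
rewrite /= (_ : [exists _, _] = true) //; apply/existsP; exists (val y).
by rewrite hnu eqxx /=; apply/eqP; exact: jv_val.
Qed.

Variable D : vertex G -> int.
Hypothesis mult_down : forall v (b : rt_edge T), val b = fV v ->
  mult v = local_sum v (b, true) + D v.
Hypothesis mult_root : forall v, fV v = root -> mult v = D v.

Lemma compl_root_sum : \sum_(v | compl_V v == root) compl_mult v = \sum_v D v.
Proof.
rewrite big_sumType /= (bigID (fun v => fV v == root) xpredT) /=; congr (_ + _).
  by apply: eq_bigr => v /eqP; exact: mult_root.
transitivity (\sum_(a : attachment) \sum_(y : wedge_new (Tr := attached) (fun a => branch_tail (tag a).2) a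
     | val (val y : branch (tag a).2) == root) (1 : int)).
  by rewrite sig_big_dep /=; apply: eq_bigl => -[a y].
(* A copy has a new vertex over the root exactly when its direction points towards the root;
   otherwise the root could only be its attaching point. *)
transitivity (\sum_(a : attachment) ((tag a).2.2)%:Z).
  apply: eq_bigr => a _.
  have /esym Et := attachment_tail a; have bP := valP ((tag a).2.1 : rt_edge T).
  case E2 : (tag a).2.2.
    have hr : in_branch (tag a).2 root.
      rewrite /in_branch E2; apply/orP; right; apply: contraNN bP => /rt_anc_of_root ->.
      by rewrite eqxx.
    have hy : (exist _ root hr : branch (tag a).2) != branch_tail (tag a).2.
      by rewrite -val_eqE /= /dtail E2 eq_sym.
    rewrite (big_pred1 (exist _ (exist _ root hr : branch (tag a).2) hy)) //.
  rewrite big_pred0 // => y; apply/negbTE/negP => /eqP yr.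
  have : in_branch (tag a).2 (val (val y)) by exact: (valP (val y)).
  rewrite yr /in_branch E2 => /orP[/eqP h|/rt_anc_of_root h].
    case/eqP: (valP y); apply/val_inj; apply: (etrans yr).
    by rewrite /= /dtail E2; exact: h.
  by move: bP; rewrite h eqxx.
rewrite -(sig_big_dep (J := fun y => 'I_(defect y)) xpredT (fun _ => xpredT)
    (fun y _ => (y.2.2)%:Z)) /=.
transitivity (\sum_(v : vertex G) \sum_(nu : dart TG) (defect (v, nu))%:Z * (nu.2)%:Z).
  rewrite pair_big /=; apply: eq_bigr => -[v nu] _ /=.
  by rewrite sumr_const card_ord -mulr_natl natz.
rewrite [RHS]big_mkcond; apply: eq_bigr => v _.
have E nu : (defect (v, nu))%:Z * (nu.2)%:Z =
    if (nu.2 && (val (nu.1 : rt_edge T) == fV v)) then D v else 0.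
  case: nu => b []; rewrite /= ?mulr0 // mulr1 /defect /=.
  rewrite -[dtail _]/(val b); case: eqP => // hb.
  rewrite gez0_abs ?subr_ge0 ?mult_ge // (mult_down hb); ring.
rewrite (eq_bigr _ (fun nu _ => E nu)) -big_mkcond /=.
have [r|nr] := eqVneq (fV v) root.
  rewrite big_pred0 // => nu; apply/negbTE/negP => /andP[_ /eqP h].
  by case/eqP: (valP (nu.1 : rt_edge T)); exact: etrans h r.
rewrite (big_pred1 ((exist _ (fV v) nr, true) : dart TG)) // => -[b s].
by rewrite /= xpair_eqE -val_eqE andbC; case: s.
Qed.

Theorem harmonic_completion : exists (G' : metric_graph R) (alpha : tropical_modification G G')
    (phi : realization G' -> realization TG),
  [/\ finite_morphism phi, harmonic_morphism phi, has_degree phi (\sum_v D v) &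
    forall x, phi (tm_incl alpha x) = @graph_map R G TG fV fE p x].
Proof.
exists W, (wedge_modification (Tr := attached) (fun a => branch_tail (tag a).2) (fun a => (tag a).1)
  (fun a => @rt_is_tree R (branch (tag a).2))), (@graph_map R W TG compl_V compl_E compl_p).
split.
- exact: (graph_map_finite compl_p_gt0 compl_E_len compl_E_tail compl_E_head).
- exact: (graph_map_harmonic compl_p_gt0 compl_E_len compl_E_tail compl_E_head compl_multP).
- apply: (graph_map_has_degree compl_p_gt0 compl_E_len compl_E_tail compl_E_head compl_multP).
  exact: compl_root_sum.
- by case.
Qed.

End Completion.

(** * The tree of a series *)

Section Affine.
Variables (R : realType) (G : metric_graph R).
Implicit Types (g : realization G -> R) (e : edge G).

Lemma affine_tgt g e s : edge_affine g e s ->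
  g (AtVertex (tgt e)) = g (AtVertex (src e)) + s%:~R * len e.
Proof. by move=> h; rewrite -epoint_len h // lexx ltW // len_gt0. Qed.

Lemma affine_ge g e s m : edge_affine g e s -> m <= g (AtVertex (src e)) ->
  m <= g (AtVertex (tgt e)) -> forall u, 0 <= u <= len e -> m <= g (epoint e u).
Proof.
move=> h m1 m2 u hu; rewrite h //; rewrite (affine_tgt h) in m2.
case/andP: hu => u0 u1; have [s0|s0] := leP 0 (s%:~R : R); first by nra.
by nra.
Qed.

Lemma affine_le_end g e s u : edge_affine g e s -> 0 <= u <= len e ->
  exists v, g (epoint e u) <= g (AtVertex v).
Proof.
move=> h hu; rewrite h //; case/andP: hu => u0 u1.
have [s0|s0] := leP 0 (s%:~R : R).
  by exists (tgt e); rewrite (affine_tgt h) lerD2l ler_wpM2l.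
by exists (src e); rewrite gerDl mulr_le0_ge0 // ltW.
Qed.

(** An affine function with its minimum in the interior of an edge is constant. *)
Lemma affine_zero g e s : edge_affine g e s -> (forall x, 0 <= g x) ->
  g (epoint e (len e / 2)) = 0 -> forall u, 0 <= u <= len e -> g (epoint e u) = 0.
Proof.
move=> h g0 gm u hu; have l0 := len_gt0 e.
have hm : 0 <= len e / 2 <= len e by lra.
have := g0 (AtVertex (src e)); have := g0 (AtVertex (tgt e)); rewrite (affine_tgt h).
move: gm; rewrite !h // => gm gt gs.
have E : s%:~R * len e = 2 * (s%:~R * (len e / 2)) by field.
have E0 : s%:~R * (len e / 2) = 0 :> R by lra.
have s0 : s%:~R = 0 :> R.
  by apply/eqP; move/eqP: E0; rewrite mulf_eq0 => /orP[//|/eqP]; lra.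
by move: gm; rewrite s0 !mul0r.
Qed.

Lemma affine_div g e s u (h : 0 < u < len e) : edge_affine g e s -> ord_at g (InEdge h) = 0.
Proof.
move=> hg; rewrite /ord_at sum_tangent_edge; case/andP: (h) => u0 u1.
have -> : slope g (InEdge h) (e, false) = s.
  apply: slopeE; exists (len e - u); rewrite ?subr_gt0 // => r /andP[r0 r1].
  rewrite /= -(epoint_in h) !hg; first by ring.
    by lra.
  by lra.
have -> : slope g (InEdge h) (e, true) = - s; last by rewrite subrr oppr0.
apply: slopeE; exists u => // r /andP[r0 r1].
rewrite /= -(epoint_in h) !hg; first by rewrite mulrNz; ring.
  by lra.
by lra.
Qed.

Lemma vertex_min g : exists v0, forall v, g (AtVertex v0) <= g (AtVertex v).
Proof.
have /card_gt0P[e _] := edge_gt0 G.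
exists [arg min_(v < src e) g (AtVertex v)]%O.
by case: arg_minP => // v _ h v'; exact: h.
Qed.

End Affine.

Section MinTriple.
Variable R : realType.
Implicit Types p q t : R.

Lemma min_triple1 p q t : p = t -> t <= q ->
  Num.min p q = Num.min p t /\ Num.min p q = Num.min q t.
Proof. by move=> -> tq; rewrite minxx (min_idPl tq) (min_idPr tq). Qed.

Lemma min_triple2 p q t : q = t -> t <= p ->
  Num.min p q = Num.min p t /\ Num.min p q = Num.min q t.
Proof. by move=> -> tp; rewrite minxx (min_idPr tp). Qed.

Lemma min_triple3 p q t : p = q -> p <= t ->
  Num.min p q = Num.min p t /\ Num.min p q = Num.min q t.
Proof. by move=> -> qt; rewrite minxx (min_idPl qt). Qed.

End MinTriple.

Section MinSemimodule.
Variables (R : realType) (G : metric_graph R) (D : realization G -> int).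
Variables (M : set (realization G -> R)) (n : nat) (f : 'I_n.+1 -> realization G -> R).
Hypothesis H : rank1_series D M f.
Implicit Types (g z : realization G -> R).

Definition normalized g := [/\ M g, forall x, 0 <= g x & exists x, g x = 0].

(* The members of M, up to constants, form a tree in which [min] is the meet. *)
Lemma meet_truncation a b : normalized a -> normalized b ->
  exists2 t : R, 0 <= t & forall x,
    Num.min (a x) (b x) = Num.min (a x) t /\ Num.min (a x) (b x) = Num.min (b x) t.
Proof.
move=> [Ma a0 [xa ha]] [Mb b0 [xb hb]].
have [al [be hab]] := r1_dep H Ma Mb.
(* If the common minimum is negative somewhere, both shifts are negative; comparing at the zeros of
   [a] and [b] makes them equal, and [- al] is the height of the meet. Otherwise the minimum is 0
   everywhere and the two functions meet at the root. *)
have [[x hx]|hn] := pselect (exists x, a x + al < 0 \/ b x + be < 0).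
  have lx : a x + al < 0 /\ b x + be < 0.
    by have := hab x; case: hx => hx [[]|[]|[]]; lra.
  have al0 : al < 0 by have := a0 x; lra.
  have be0 : be < 0 by have := b0 x; lra.
  have E : al = be.
    have := hab xa; have := hab xb; have := b0 xa; have := a0 xb.
    by move=> ? ? [[? ?]|[? ?]|[? ?]] [[? ?]|[? ?]|[? ?]]; lra.
  exists (- al); first by lra.
  move=> y; have := hab y; rewrite -E => -[[h1 h2]|[h1 h2]|[h1 h2]].
  - by apply: min_triple1; lra.
  - by apply: min_triple2; lra.
  - by apply: min_triple3; lra.
exists 0 => // y.
have ha' : 0 <= al by rewrite leNgt; apply/negP => h; apply: hn; exists xa; left; lra.
have hb' : 0 <= be by rewrite leNgt; apply/negP => h; apply: hn; exists xb; right; lra.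
have := hab y; have := a0 y; have := b0 y.
have nn : ~ (a y + al < 0) by move=> h; apply: hn; exists y; left.
move=> by0 ay0 [[h1 h2]|[h1 h2]|[h1 h2]].
- by apply: min_triple1; lra.
- by apply: min_triple2; lra.
- by apply: min_triple3; lra.
Qed.

Lemma truncation_normalized z (t : R) : normalized z -> 0 <= t ->
  normalized (fun x => Num.min (z x) t).
Proof.
move=> [Mz z0 [x hx]] t0; split; first exact: (r1_min H Mz (r1_const H t)).
  by move=> y; rewrite le_min z0.
by exists x; rewrite hx; apply/min_idPl.
Qed.

(** If [a] and [b] agree at [x], their meet is at least as high as their value there. This makes the
    image of a point in the tree well defined. *)
Lemma truncation_eq a b x : normalized a -> normalized b -> a x = b x ->
  (fun y => Num.min (a y) (a x)) = (fun y => Num.min (b y) (a x)).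
Proof.
move=> na nb E; have [t t0 h] := meet_truncation na nb.
have xt : a x <= t by apply/min_idPl; have := h x; rewrite -E minxx => -[<-].
apply/funext => y; rewrite -(min_idPr xt) !minA.
by have [<- <-] := h y.
Qed.

Hypothesis fN : forall i, normalized (f i).

Lemma normalized_span z : normalized z ->
  exists i, exists2 t : R, 0 <= t & forall x, z x = Num.min (f i x) t.
Proof.
move=> nz; have [Mz z0 [x0 hx0]] := nz; have [c hc] := r1_span H Mz.
have [[i Ei] _] := hc x0.
have [_ f0 [y0 hy0]] := fN i.
(* Compare at a zero of [z] where [f i + c i] attains the minimum, and at a zero of [f i]. *)
have ci : c i = 0.
  have := f0 x0; have [_ /(_ i)] := hc y0; have := z0 y0; lra.
have le x : z x <= f i x by have [_ /(_ i)] := hc x; rewrite ci addr0.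
have [t t0 h] := meet_truncation nz (fN i); exists i, t => // x.
by have [_ <-] := h x; rewrite (min_idPl (le x)).
Qed.

Hypothesis fA : forall i e, exists s, edge_affine (f i) e s.
Hypothesis fmA : forall i j e, exists s, edge_affine (fun x => Num.min (f i x) (f j x)) e s.
Hypothesis DV : forall e u (h : 0 < u < len e), D (InEdge h) = 0.

Definition top_on i e := forall u, 0 <= u <= len e -> forall j, f j (epoint e u) <= f i (epoint e u).

(** The generator that is largest at the midpoint is largest on all of [e]: its deficit against
    another one is affine on [e], by the condition on pairwise minima, and vanishes at the
    midpoint. *)
Lemma top_exists e : exists i, top_on i e.
Proof.
have hm := mid_in e; pose m := epoint e (len e / 2).
have hm' : 0 <= len e / 2 <= len e by move: hm; lra.
pose i := [arg max_(i > ord0) f i m]%O.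
have hi j : f j m <= f i m by rewrite /i; case: arg_maxP => // k _; exact.
exists i => u hu j; have [s hs] := fmA i j e; have [s1 h1] := fA i e; have [s2 h2] := fA j e.
have E : Num.min (f i m) (f j m) = f j m by apply/min_idPr.
have gm : edge_affine (fun x => f j x - Num.min (f i x) (f j x)) e (s2 - s).
  by move=> r hr; rewrite hs // h2 // intrB; ring.
have g0 x : 0 <= f j x - Num.min (f i x) (f j x) by rewrite subr_ge0 ge_min lexx orbT.
have gz : f j m - Num.min (f i m) (f j m) = 0 by rewrite E subrr.
have := affine_zero gm g0 gz hu => /eqP; rewrite subr_eq0 => /eqP ->.
by rewrite ge_min lexx.
Qed.

Lemma edge_truncation z i e : normalized z -> top_on i e -> exists2 t : R, 0 <= t &
  forall u, 0 <= u <= len e -> z (epoint e u) = Num.min (f i (epoint e u)) t.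
Proof.
move=> nz hi; have [t t0 h] := meet_truncation nz (fN i); exists t => // u hu.
have [j [t' _ hz]] := normalized_span nz.
have le : z (epoint e u) <= f i (epoint e u).
  by rewrite hz; apply: le_trans (hi u hu j); rewrite ge_min lexx.
by have [_ <-] := h (epoint e u); rewrite (min_idPl le).
Qed.

(** The minimum of [g] is attained at a vertex: the value at any point is that of some [f i + c i],
    which is affine on the edge and at least [g] at its ends. *)
Lemma normalize g : M g -> exists c z, normalized z /\ g = (fun x => z x + c).
Proof.
move=> Mg; have [v0 hv0] := vertex_min g.
exists (g (AtVertex v0)), (fun x => g x - g (AtVertex v0)); split; last first.
  by apply/funext => x; rewrite subrK.
split; first exact: (r1_add H).
  move=> x; rewrite subr_ge0; have [c hc] := r1_span H Mg.
  have [[v ->]//|[e [u [hu ->]]]] := realizationP x.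
  have [[i ->] _] := hc (epoint e u).
  have [s hs] := fA i e.
  have le v : g (AtVertex v0) - c i <= f i (AtVertex v).
    by rewrite lerBlDr; have [_ /(_ i)] := hc (AtVertex v); apply: le_trans.
  rewrite -lerBlDr; apply: (affine_ge hs) => //; by case/andP: hu => /ltW -> /ltW.
by exists (AtVertex v0); rewrite subrr.
Qed.

(* If the highest generator were constant on [e], so would be all of [M], contradicting the
   rank condition at the midpoint of [e]. *)
Lemma top_slope_neq0 i e s : top_on i e -> edge_affine (f i) e s -> s != 0.
Proof.
move=> hi hs; apply/eqP => s0; have hm := mid_in e.
have [g Mg] := r1_rank H (InEdge hm); rewrite DV add0r.
have [c [z [nz ->]]] := normalize Mg; rewrite ord_addc.
have [t t0 hz] := edge_truncation nz hi.
have cst u : 0 <= u <= len e -> z (epoint e u) = Num.min (f i (AtVertex (src e))) t.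
  by move=> hu; rewrite hz // hs // s0 mul0r addr0.
rewrite (@affine_div _ _ z e 0) // => u hu.
by rewrite -epoint0 !cst ?mul0r ?addr0 // lexx ltW // len_gt0.
Qed.

(** For the generators and their truncations the maximum is attained at a vertex. They are
    nonnegative, so the default 0 does not interfere. *)
Definition height (g : realization G -> R) : R := \big[Num.max/0]_v g (AtVertex v).

Definition levels : seq R := [seq f a.1 (AtVertex a.2) | a <- enum {: 'I_n.+1 * vertex G}].

Lemma levels_f i v : f i (AtVertex v) \in levels.
Proof. by apply/mapP; exists (i, v); rewrite ?mem_enum. Qed.

Lemma levelsP l : l \in levels -> exists i v, l = f i (AtVertex v).
Proof. by move=> /mapP[[i v] _ ->]; exists i, v. Qed.

Definition top_at i x := forall j, f j x <= f i x.

Lemma top_at_exists x : exists i, top_at i x.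
Proof.
exists [arg max_(i > ord0) f i x]%O => j.
by case: arg_maxP => // k _; exact.
Qed.

(** The largest generator has nonzero slope on each edge, so it takes each level there at most once.
    These points are the new vertices of the last subdivision. *)
Lemma level_points_finite : finite_set [set x | exists2 i, top_at i x & f i x \in levels].
Proof.
have /choice[I hI] := top_exists.
have /choice[S hS] : forall e, exists s, edge_affine (f (I e)) e s by move=> e; exact: fA.
apply: (@sub_finite_set _ _ ((@AtVertex R G) @` [set: vertex G] `|`
  (fun a : edge G * R => epoint a.1 ((a.2 - f (I a.1) (AtVertex (src a.1))) / (S a.1)%:~R)) @`
    ([set: edge G] `*` [set` levels]))).
  move=> x [i hi hl]; case: (realizationP x) => [[v ->]|[e [u [hu E]]]]; first by left; exists v.
  right; exists (e, f i x) => //=.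
  have hu' : 0 <= u <= len e by case/andP: hu => /ltW -> /ltW.
  have -> : f i x = f (I e) x.
    by apply/eqP; rewrite eq_le hi E hI.
  rewrite E hS // addrAC subrr add0r mulrAC divff ?mul1r // intr_eq0.
  exact: top_slope_neq0 (hI e) (hS e).
rewrite finite_setU; split; first exact: finite_image (@finite_finset _ _).
by apply: finite_image; apply: finite_setX => //; exact: finite_finset.
Qed.

(** On the edge, [f j] is the truncation at some [t] of the largest generator. Either it agrees with
    that generator at [x], or it equals [t] there and still does at the end towards which that
    generator grows; in both cases the value is a level. *)
Lemma level_points_values i x : top_at i x -> f i x \in levels -> forall j, f j x \in levels.
Proof.
move=> hi hl j; have [[v ->]|[e [u [hu E]]]] := realizationP x; first exact: levels_f.
have hu' : 0 <= u <= len e by case/andP: hu => /ltW -> /ltW.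
have [k hk] := top_exists e; have [t t0 ht] := edge_truncation (fN j) hk.
have Ek : f i x = f k x by apply/eqP; rewrite eq_le hi E hk.
have [le|lt] := leP (f k x) t; first by rewrite E ht // -E (min_idPl le) -Ek.
have [s hs] := fA k e.
have h0 : 0 <= (0 : R) <= len e by rewrite lexx ltW // len_gt0.
have h1 : 0 <= len e <= len e by rewrite lexx andbT ltW // len_gt0.
have fx : f j x = t by rewrite E ht // -E (min_idPr (ltW lt)).
have [s0|s0] := leP 0 (s%:~R : R).
  have := levels_f j (tgt e); rewrite -epoint_len ht // (min_idPr _) -?fx //.
  by rewrite fx; apply: (le_trans (ltW lt)); rewrite E !hs // lerD2l ler_wpM2l //; case/andP: hu'.
have := levels_f j (src e); rewrite -epoint0 ht // (min_idPr _) -?fx //.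
rewrite fx; apply: (le_trans (ltW lt)); rewrite E !hs // lerD2l mulr0.
by rewrite mulr_le0_ge0 ?(ltW s0) //; case/andP: hu'.
Qed.

End MinSemimodule.

(** * The finite tree of truncations at levels *)

Section LevelTree.
Variables (R : realType) (G : metric_graph R) (D : realization G -> int).
Variables (M : set (realization G -> R)) (n : nat) (f : 'I_n.+1 -> realization G -> R).
Hypothesis H : rank1_series D M f.
Hypothesis f_ge0 : forall i x, 0 <= f i x.
Hypothesis f_zero : forall i, exists v, f i (AtVertex v) = 0.
Hypothesis fA : forall i e, exists s, edge_affine (f i) e s.
Hypothesis fmA : forall i j e, exists s, edge_affine (fun x => Num.min (f i x) (f j x)) e s.
Hypothesis DV : forall e u (h : 0 < u < len e), D (InEdge h) = 0.
Implicit Types (g z : realization G -> R) (l : R).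

Local Notation levels := (levels f).
Local Notation top_on := (top_on f).
Local Notation top_at := (top_at f).
Local Notation height := (@height R G).
Local Notation normalized := (@normalized R G M).

Definition trunc g l : realization G -> R := fun x => Num.min (g x) l.

Lemma truncK g l l' : l' <= l -> trunc (trunc g l) l' = trunc g l'.
Proof. by move=> h; apply/funext => x; rewrite /trunc -minA (min_idPr h). Qed.

Lemma truncT g l l' : trunc (trunc g l) l' = trunc g (Num.min l l').
Proof. by apply/funext => x; rewrite /trunc -minA. Qed.

Lemma fN i : normalized (f i).
Proof.
split; [exact: (r1_gen H)|exact: f_ge0|].
by have [v hv] := f_zero i; exists (AtVertex v).
Qed.

Lemma levels_ge0 l : l \in levels -> 0 <= l.
Proof. by move=> /levelsP[i [v ->]]. Qed.

Lemma levels0 : 0 \in levels.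
Proof. by have [v <-] := f_zero ord0; exact: levels_f. Qed.

Lemma height_ge g v : g (AtVertex v) <= height g.
Proof. exact: le_bigmax. Qed.

Lemma height_ge0 g : 0 <= height g.
Proof. exact: bigmax_ge_id. Qed.

Lemma height_attained g : (forall x, 0 <= g x) -> exists v, height g = g (AtVertex v).
Proof.
move=> g0; have /card_gt0P[e _] := edge_gt0 G.
have [v _ hv] := @eq_bigmax _ _ _ 0 (src e) xpredT (fun v => g (AtVertex v)) isT (fun v _ => g0 _).
by exists v.
Qed.

Lemma height_le g c : 0 <= c -> (forall v, g (AtVertex v) <= c) -> height g <= c.
Proof. by move=> c0 h; apply/bigmax_leP; split=> // v _; exact: h. Qed.

Lemma height_trunc g l : (forall x, 0 <= g x) -> 0 <= l <= height g -> height (trunc g l) = l.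
Proof.
move=> g0 /andP[l0 l1]; apply/eqP; rewrite eq_le; apply/andP; split.
  by apply: height_le => // v; rewrite /trunc ge_min lexx orbT.
have [v hv] := height_attained g0.
by apply: le_trans (height_ge _ v); rewrite /trunc le_min lexx -hv l1.
Qed.

Lemma f_le_height i x : f i x <= height (f i).
Proof.
have [[v ->]|[e [u [hu ->]]]] := realizationP x; first exact: height_ge.
have hu' : 0 <= u <= len e by case/andP: hu => /ltW -> /ltW.
have [s hs] := fA i e; have [v hv] := affine_le_end hs hu'.
exact: le_trans (height_ge _ v).
Qed.

Lemma trunc_height i : trunc (f i) (height (f i)) = f i.
Proof. by apply/funext => x; apply/min_idPl; exact: f_le_height. Qed.

Lemma height_level g : (forall x, 0 <= g x) -> (forall v, g (AtVertex v) \in levels) ->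
  height g \in levels.
Proof. by move=> /height_attained[v ->]. Qed.

(** The default 0 is itself the lowest level, and [below 0 = 0] makes the root its own parent. *)
Definition below l : R := \big[Num.max/0]_(l' <- levels | l' < l) l'.

Lemma below_ge l l' : l' \in levels -> l' < l -> l' <= below l.
Proof. by move=> h h'; exact: le_bigmax_seq. Qed.

Lemma below_ge0 l : 0 <= below l.
Proof. exact: bigmax_ge_id. Qed.

Lemma below_level l : below l \in levels.
Proof.
rewrite /below big_seq_cond; elim/big_ind: _ => [|a b ha hb|l' /andP[]//]; first exact: levels0.
by rewrite /Order.max; case: ifP.
Qed.

Lemma below_lt l : 0 < l -> below l < l.
Proof.
move=> l0; rewrite /below; elim/big_ind: _ => // a b ha hb.
by rewrite /Order.max; case: ifP.
Qed.

(** The condition on heights ensures that the truncation at [l] has height [l], so that a node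
    determines its level. *)
Definition nodes : seq (realization G -> R) :=
  [seq trunc (f a.1) a.2 | a <- [seq (i, l) | i <- enum 'I_n.+1, l <- levels] & a.2 <= height (f a.1)].

Lemma nodesP w : reflect (exists i l, [/\ l \in levels, l <= height (f i) & w = trunc (f i) l])
  (w \in nodes).
Proof.
apply: (iffP mapP) => [[[i l]]|[i [l [h1 h2 ->]]]].
  rewrite mem_filter => /andP[h /allpairsP[[i' l'] [_ /= hl [E1 E2]]]] /= ->.
  by subst i' l'; exists i, l; split.
exists (i, l) => //; rewrite mem_filter h2; apply/allpairsP; exists (i, l).
by split=> //; rewrite mem_enum.
Qed.

Definition node : finType := seq_sub nodes.
Definition nfun (w : node) : realization G -> R := ssval w.

Lemma nodeP (w : node) : exists i, [/\ nfun w = trunc (f i) (height (nfun w)),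
  height (nfun w) \in levels & height (nfun w) <= height (f i)].
Proof.
have /nodesP[i [l [h1 h2 E]]] := ssvalP w; exists i.
have -> : height (nfun w) = l.
  by rewrite /nfun E height_trunc // ?h2 ?levels_ge0 // => x; exact: f_ge0.
by split.
Qed.

Lemma node_exists i l : l \in levels -> l <= height (f i) ->
  exists w : node, nfun w = trunc (f i) l.
Proof.
move=> h1 h2; have hw : trunc (f i) l \in nodes by apply/nodesP; exists i, l.
by exists (SeqSub hw).
Qed.

Lemma nfun_inj : injective nfun.
Proof. by move=> w w' h; apply: val_inj; exact: h. Qed.

Lemma nfun_normalized w : normalized (nfun w).
Proof.
have [i [E _ _]] := nodeP w; rewrite E; apply: (truncation_normalized H (fN i)).
exact: height_ge0.
Qed.

Lemma nfun_ge0 w x : 0 <= nfun w x.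
Proof. by have [_ h _] := nfun_normalized w. Qed.

Lemma nfun_le w x : nfun w x <= height (nfun w).
Proof. by have [i [E _ _]] := nodeP w; rewrite {1}E /trunc ge_min lexx orbT. Qed.

Lemma nfun_level w v : nfun w (AtVertex v) \in levels.
Proof.
have [i [E hl _]] := nodeP w; rewrite E /trunc /Order.min.
by case: ifP => _; [exact: levels_f|].
Qed.

Lemma nroot_proof : (fun=> 0) \in nodes.
Proof.
apply/nodesP; exists ord0, 0; split; [exact: levels0|exact: height_ge0|].
by apply/funext => x; apply/esym/min_idPr.
Qed.

Definition nroot : node := SeqSub nroot_proof.

Lemma height_root : height (nfun nroot) = 0.
Proof. by apply/eqP; rewrite eq_le height_ge0 andbT height_le. Qed.

Lemma height_eq0 w : height (nfun w) = 0 -> w = nroot.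
Proof.
move=> h; apply: nfun_inj; have [i [E _ _]] := nodeP w; rewrite E h.
by apply/funext => x; apply/min_idPr.
Qed.

Lemma height_gt0 w : w != nroot -> 0 < height (nfun w).
Proof. by move=> hw; rewrite lt_def height_ge0 andbT; apply: contraNneq hw => /height_eq0 ->. Qed.

Definition npar (w : node) : node := insubd nroot (trunc (nfun w) (below (height (nfun w)))).

Lemma below0 : below 0 = 0.
Proof.
apply/eqP; rewrite eq_le below_ge0 andbT /below; elim/big_ind: _ => [//|a b ha hb|l /ltW //].
by rewrite /Order.max; case: ifP.
Qed.

Lemma below_le w : below (height (nfun w)) <= height (nfun w).
Proof.
have [->|/height_gt0/below_lt/ltW//] := eqVneq w nroot.
by rewrite height_root below0.
Qed.

Lemma nfun_npar w : nfun (npar w) = trunc (nfun w) (below (height (nfun w))).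
Proof.
rewrite /npar /nfun -[ssval (insubd _ _)]/(val (insubd _ _)) insubdK // -/(nfun w).
have [i [hw hl hh]] := nodeP w; rewrite /in_mem /=; apply/nodesP.
exists i, (below (height (nfun w))); split; first exact: below_level.
  exact: le_trans (below_le w) hh.
by rewrite {1}hw truncK // below_le.
Qed.

Lemma height_npar w : height (nfun (npar w)) = below (height (nfun w)).
Proof.
by rewrite nfun_npar height_trunc // ?below_ge0 ?below_le //; exact: nfun_ge0.
Qed.

Lemma npar_root : npar nroot = nroot.
Proof. by apply: height_eq0; rewrite height_npar height_root below0. Qed.

Lemma npar_lt w : w != nroot -> height (nfun (npar w)) < height (nfun w).
Proof. by move=> /height_gt0 h; rewrite height_npar below_lt. Qed.

(** The largest generator on any edge is not constant there, so it has positive height. *)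
Lemma node_nontrivial : exists w, w != nroot.
Proof.
have /card_gt0P[e _] := edge_gt0 G.
have [i hi] := top_exists fA fmA e; have [s hs] := fA i e.
have s0 := top_slope_neq0 H fN fA DV hi hs.
have hpos : 0 < height (f i).
  rewrite lt_def height_ge0 andbT; apply: contraNneq s0 => h0.
  have E v : f i (AtVertex v) = 0.
    by apply/eqP; rewrite eq_le f_ge0 andbT -h0 height_ge.
  have := affine_tgt hs; rewrite !E add0r => /esym/eqP.
  by rewrite mulf_eq0 intr_eq0 (gt_eqF (len_gt0 e)) orbF.
have hl : height (f i) \in levels by apply: height_level => // v; exact: levels_f.
have [w hw] := node_exists hl (lexx _); exists w; apply: contraTneq hpos => E.
by rewrite -trunc_height -hw E height_root ltxx.
Qed.

Definition level_tree : rooted_tree R :=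
  @RootedTree R node nroot npar (fun w => height (nfun w)) npar_root npar_lt node_nontrivial.

Local Notation T := level_tree.
Local Notation TG := (rt_graph T).

Lemma level_tree_anc (x w : T) : rt_anc x w = (nfun x == trunc (nfun w) (height (nfun x))).
Proof.
apply/idP/eqP; move: w; apply: (@rt_ind R T).
- by move=> /rt_anc_of_root ->; apply/funext => y; rewrite /trunc height_root minxx.
- move=> w hw IH; rewrite rt_ancE => /predU1P[->|h].
    by apply/funext => y; apply/esym/min_idPl; exact: nfun_le.
  rewrite [LHS](IH h) /= nfun_npar truncT; congr trunc; apply/min_idPr.
  by have := rt_anc_le h; rewrite /= height_npar.
- move=> E; rewrite (_ : x = nroot) ?rt_anc_refl //; apply: height_eq0.
  apply/eqP; rewrite eq_le height_ge0 andbT E; apply: height_le => // v.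
  by rewrite /trunc ge_min lexx.
- move=> w hw IH E; have hle : height (nfun x) <= height (nfun w).
    rewrite E; apply: height_le; first exact: height_ge0.
    by move=> v; rewrite /trunc ge_min nfun_le.
  have [Eh|ne] := eqVneq (height (nfun x)) (height (nfun w)).
    rewrite (_ : x = w) ?rt_anc_refl //; apply: nfun_inj; rewrite E Eh.
    by apply/funext => y; apply/min_idPl; exact: nfun_le.
  have hb : height (nfun x) <= below (height (nfun w)).
    by apply: below_ge; [have [i []] := nodeP x|rewrite lt_neqAle ne].
  by rewrite rt_ancE IH ?orbT //= nfun_npar truncK // -E.
Qed.

(* The height at which the path to [z] leaves the path to the node [w]. *)
Definition meet_height (w : T) z : R := height (fun x => Num.min (nfun w x) (z x)).

Lemma meet_heightE (w : T) z (t : R) : 0 <= t <= height (nfun w) ->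
  (forall x, Num.min (nfun w x) (z x) = Num.min (nfun w x) t) -> meet_height w z = t.
Proof.
move=> ht h; rewrite /meet_height (_ : (fun x => _) = trunc (nfun w) t); last exact/funext.
by rewrite height_trunc //; exact: nfun_ge0.
Qed.

Lemma meet_heightP (w : T) z : normalized z ->
  [/\ 0 <= meet_height w z <= height (nfun w),
      forall x, Num.min (nfun w x) (z x) = Num.min (nfun w x) (meet_height w z) &
      forall x, Num.min (nfun w x) (z x) = Num.min (z x) (meet_height w z)].
Proof.
move=> nz; have [t t0 h] := meet_truncation H (nfun_normalized w) nz.
pose t' := Num.min t (height (nfun w)).
have b : 0 <= t' <= height (nfun w) by rewrite le_min t0 height_ge0 ge_min lexx orbT.
have h1 x : Num.min (nfun w x) (z x) = Num.min (nfun w x) t'.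
  by rewrite /t' (minC t) minA (min_idPl (nfun_le w x)); have [] := h x.
have E := meet_heightE b h1; rewrite E; split=> // x.
rewrite /t' minA; have [_ <-] := h x.
by apply/esym/min_idPl; rewrite ge_min nfun_le.
Qed.

Lemma meet_height_par (w : T) z : normalized z ->
  meet_height (npar w) z = Num.min (meet_height w z) (height (nfun (npar w))).
Proof.
move=> nz; have [/andP[b1 b2] h _] := meet_heightP w nz.
apply: meet_heightE; first by rewrite le_min b1 height_ge0 ge_min lexx orbT.
move=> x; rewrite nfun_npar height_trunc ?below_ge0 ?below_le //; last exact: nfun_ge0.
by rewrite /trunc minAC h -!minA; congr Num.min; rewrite [RHS]minCA minxx.
Qed.

Section Profile.
Variables (w : rt_edge T) (tau : R).
Hypothesis htau : 0 <= tau <= rt_len w.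

(** The member of [M] for which the point at distance [tau] above the parent of [w] stands. *)
Definition profile_fun := trunc (nfun (val w)) (height (nfun (npar (val w))) + tau).
Local Notation z := profile_fun.

Let top_bound : 0 <= height (nfun (npar (val w))) + tau <= height (nfun (val w)).
Proof.
by move: htau; rewrite /rt_len /=; have := height_ge0 (nfun (npar (val w))); lra.
Qed.

Lemma profile_fun_normalized : normalized z.
Proof. by apply: (truncation_normalized H (nfun_normalized _)); case/andP: top_bound. Qed.

(** This identifies heights of meets with values of a profile: both increase along [b] by the part
    of [b] on the path to the point. *)
Lemma meet_height_step (b : rt_edge T) :
  meet_height (val b) z = meet_height (npar (val b)) z + active w tau b.
Proof.
have nz := profile_fun_normalized; have bl := npar_lt (valP b).
have wl := npar_lt (valP w); case/andP: (htau) => tau0 _; case/andP: (top_bound) => tb0 tb1.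
rewrite meet_height_par // /active; case: eqP => [->|/eqP bw].
  have -> : meet_height (val w) z = height (nfun (npar (val w))) + tau.
    apply: meet_heightE => // x; rewrite /z /trunc minA minxx //.
  by rewrite (min_idPr _) // lerDl.
case: ifP => [an|/negbT nan].
  have anp : rt_anc (val b) (npar (val w)) by move: an; rewrite rt_ancE val_eqE (negPf bw).
  have lb := rt_anc_le anp; rewrite /= in lb.
  have -> : meet_height (val b) z = height (nfun (val b)).
    apply: meet_heightE; first by rewrite lexx height_ge0.
    move=> x; rewrite (min_idPl (nfun_le _ _)); apply/min_idPl.
    move: an; rewrite level_tree_anc => /eqP ->; rewrite /z /trunc le_min.
    rewrite ge_min lexx /= ge_min; apply/orP; right.
    by apply: (le_trans lb); rewrite lerDl.
  by rewrite (min_idPr (ltW bl)) /rt_len /=; ring.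
(* If the meet were above the parent of [b], so would be that of the nodes [val b] and [val w]. The
   latter has a level as its height, hence is [val b] itself, which would then be an ancestor of
   [val w]. *)
rewrite addr0; apply/esym/min_idPl; rewrite leNgt; apply/negP => hlt.
have [/andP[t0 t1] h1 h2] := meet_heightP (val b) nz.
have [/andP[m0 m1] k1 k2] := meet_heightP (val b) (nfun_normalized (val w)).
have hm : meet_height (val b) (nfun (val w)) \in levels.
  apply: height_level => [x|v]; first by rewrite le_min !nfun_ge0.
  by rewrite /Order.min; case: ifP => _; exact: nfun_level.
have le : meet_height (val b) z <= meet_height (val b) (nfun (val w)).
  apply: height_le => // v; apply: le_trans (height_ge _ v).
  by rewrite le_min ge_min lexx /= /z /trunc ge_min; apply/orP; right; rewrite ge_min lexx.
have E : meet_height (val b) (nfun (val w)) = height (nfun (val b)).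
  apply/eqP; rewrite eq_le m1 leNgt; apply/negP => lt.
  have := below_ge hm lt; rewrite -height_npar leNgt.
  by rewrite (lt_le_trans hlt le).
case/negP: nan; rewrite level_tree_anc; apply/eqP/funext => x.
by rewrite /trunc -E -k2 k1 E (min_idPl (nfun_le _ _)).
Qed.

Lemma profile_vertex (g : realization TG -> R) : profile g w tau ->
  forall x : T, g (@AtVertex R TG x) = g (@AtVertex R TG nroot) + meet_height x z.
Proof.
move=> P; apply: (@rt_ind R T).
  rewrite (_ : meet_height _ _ = 0) ?addr0 //; apply: meet_heightE; rewrite ?height_root ?lexx //.
  move=> x; rewrite minxx; apply/min_idPl; have [_ z0 _] := profile_fun_normalized; exact: z0.
move=> x hx IH; rewrite (profile_tgt P (exist _ x hx)) /= IH -addrA.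
by rewrite -(meet_height_step (exist _ x hx)).
Qed.

End Profile.

End LevelTree.

(** * The map to the tree *)

(** Truncating at [t] a function that grows from [l] to [l + L]: it keeps growing for the length
    [min (l + L) t - min l t]. *)
Lemma min_affine_step (R : realType) (l X L t : R) : 0 <= X <= L ->
  Num.min (l + X) t = Num.min l t + Num.min X (Num.min (l + L) t - Num.min l t).
Proof.
move=> /andP[X0 XL]; have [tl|lt] := leP t l.
  by rewrite !(min_idPr _) ?subrr ?addr0 //; lra.
have [h1|h1] := leP (l + L) t.
  by rewrite addrAC subrr add0r !(min_idPl _) //; lra.
have [h2|h2] := leP (l + X) t; first by rewrite (min_idPl _) //; lra.
by rewrite (min_idPr _); lra.
Qed.

Section LevelMap.
Variables (R : realType) (G : metric_graph R) (D : realization G -> int).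
Variables (M : set (realization G -> R)) (n : nat) (f : 'I_n.+1 -> realization G -> R).
Hypothesis H : rank1_series D M f.
Hypothesis f_ge0 : forall i x, 0 <= f i x.
Hypothesis f_zero : forall i, exists v, f i (AtVertex v) = 0.
Hypothesis fA : forall i e, exists s, edge_affine (f i) e s.
Hypothesis fmA : forall i j e, exists s, edge_affine (fun x => Num.min (f i x) (f j x)) e s.
Hypothesis DV : forall e u (h : 0 < u < len e), D (InEdge h) = 0.
Hypothesis fL : forall e u (h : 0 < u < len e) i, top_at f i (InEdge h) ->
  f i (InEdge h) \notin levels f.

Local Notation levels := (levels f).
Local Notation top_on := (top_on f).
Local Notation top_at := (top_at f).
Local Notation height := (@height R G).
Local Notation normalized := (@normalized R G M).
Local Notation T := (level_tree H f_ge0 f_zero fA fmA DV).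
Local Notation TG := (rt_graph T).
Local Notation nfun := (@nfun R G n f).
Local Notation npar := (npar f_ge0 f_zero).
Local Notation nroot := (nroot f_ge0 f_zero).
Local Notation meet_height := (@meet_height R G D M n f H f_ge0 f_zero fA fmA DV).
Let fN := fN H f_ge0 f_zero.
Implicit Types (e : edge G) (v : vertex G) (a : dart G).

(** By [truncation_eq] all generators that are largest at [v] have the same truncation at their
    value there; it is the image of [v]. *)
Lemma vertex_node v : exists w : T, forall i, top_at i (AtVertex v) ->
  nfun w = trunc (f i) (f i (AtVertex v)).
Proof.
have [i0 h0] := top_at_exists f (AtVertex v).
have [w hw] := node_exists (levels_f f i0 v) (height_ge (f i0) v).
exists w => i hi; rewrite hw.
have E : f i0 (AtVertex v) = f i (AtVertex v) by apply/eqP; rewrite eq_le hi h0.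
rewrite -E; exact: (truncation_eq H (fN i0) (fN i) E).
Qed.

Definition level_V v : T := sval (cid (vertex_node v)).

Lemma level_VP v i : top_at i (AtVertex v) ->
  nfun (level_V v) = trunc (f i) (f i (AtVertex v)).
Proof. exact: (svalP (cid (vertex_node v))). Qed.

Lemma level_V_height v i : top_at i (AtVertex v) ->
  height (nfun (level_V v)) = f i (AtVertex v).
Proof.
by move=> hi; rewrite (level_VP hi) height_trunc ?f_ge0 ?height_ge // => x; exact: f_ge0.
Qed.

Lemma normalized_le_top z x i : normalized z -> top_at i x -> z x <= f i x.
Proof.
move=> nz hi; have [j [t _ ->]] := normalized_span H fN nz.
by rewrite ge_min hi.
Qed.

(** The evaluation formula behind the pullback. The value of [z] at [v] does not exceed that of a
    largest generator, whose truncation is the image of [v]. *)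
Lemma meet_height_level_V z v : normalized z -> meet_height (level_V v) z = z (AtVertex v).
Proof.
move=> nz; have [i hi] := top_at_exists f (AtVertex v).
have [/andP[m0 m1] h _] := meet_heightP (level_V v) nz.
have := h (AtVertex v); rewrite (level_VP hi) {1 2}/trunc minxx.
rewrite (min_idPr (normalized_le_top nz hi)) (min_idPr _) //.
by rewrite -(level_V_height hi).
Qed.

Lemma top_on_epoint i e u : top_on i e -> 0 <= u <= len e -> top_at i (epoint e u).
Proof. by move=> h hu j; exact: h. Qed.

Let zero_in e : 0 <= (0 : R) <= len e.
Proof. by rewrite lexx ltW // len_gt0. Qed.

Let len_in e : 0 <= len e <= len e.
Proof. by rewrite lexx andbT ltW // len_gt0. Qed.

Lemma top_on_src i e : top_on i e -> top_at i (AtVertex (src e)).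
Proof. by move=> h; rewrite -epoint0; exact: top_on_epoint. Qed.

Lemma top_on_tgt i e : top_on i e -> top_at i (AtVertex (tgt e)).
Proof. by move=> h; rewrite -epoint_len; exact: top_on_epoint. Qed.

(** A level strictly between the two values would be taken at an interior point of [e], against
    [fL]. Hence the image of [e] passes over no node. *)
Lemma below_end i e s u u' : top_on i e -> edge_affine (f i) e s ->
  0 <= u <= len e -> 0 <= u' <= len e ->
  (exists v, AtVertex v = epoint e u) -> (exists v, AtVertex v = epoint e u') ->
  f i (epoint e u) < f i (epoint e u') -> below f (f i (epoint e u')) = f i (epoint e u).
Proof.
move=> hi hs hu hu' [v hv] [v' hv'] lt; apply/eqP; rewrite eq_le andbC.
have hl : f i (epoint e u) \in levels by rewrite -hv; exact: levels_f.
rewrite below_ge //= leNgt; apply/negP => lt2.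
have hb := below_level f_zero (f i (epoint e u')).
have lt3 : below f (f i (epoint e u')) < f i (epoint e u').
  apply: (below_lt f); exact: le_lt_trans lt.
move: hb lt2 lt3; set l := below f _ => hb lt2 lt3.
have s0 : s%:~R != 0 :> R.
  by apply: contraTneq lt => s0; rewrite !hs // s0 !mul0r ltxx.
pose r := (l - f i (AtVertex (src e))) / s%:~R.
have hr : f i (AtVertex (src e)) + s%:~R * r = l by rewrite /r mulrC divfK // addrC subrK.
have hin : 0 < r < len e.
  case/andP: hu => u0 u1; case/andP: hu' => u0' u1'.
  move: lt2 lt3; rewrite !hs ?u0 ?u0' // -hr !ltrD2l.
  have [sp|sn|E] := ltgtP 0 (s%:~R : R); last by rewrite -E eqxx in s0.
    by rewrite !ltr_pM2l // => lt2 lt3; rewrite (le_lt_trans u0 lt2) (lt_le_trans lt3 u1').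
  by rewrite !ltr_nM2l // => lt2 lt3; rewrite (le_lt_trans u0' lt3) (lt_le_trans lt2 u1).
have ht : top_at i (InEdge hin).
  by rewrite -epoint_in; apply: top_on_epoint => //; case/andP: (hin) => /ltW -> /ltW.
have := fL ht; rewrite -epoint_in hs ?hr ?hb //.
by case/andP: (hin) => /ltW -> /ltW.
Qed.

Lemma level_V_par v v' i : top_at i (AtVertex v) -> top_at i (AtVertex v') ->
  below f (f i (AtVertex v')) = f i (AtVertex v) -> f i (AtVertex v) < f i (AtVertex v') ->
  (level_V v' != nroot) && (npar (level_V v') == level_V v).
Proof.
move=> hv hv' hb lt; apply/andP; split.
  apply: contraTneq lt => E; rewrite -(level_V_height hv') E height_root -leNgt; exact: f_ge0.
apply/eqP/nfun_inj; rewrite nfun_npar // (level_V_height hv') hb.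
by rewrite (level_VP hv') (level_VP hv) truncK // ltW.
Qed.

(** The slope of the largest generator gives the dilation factor by its absolute value and the
    orientation by its sign. *)
Lemma edge_image e : exists y : dart TG * nat,
  [/\ (0 < y.2)%N, rt_len y.1.1 = y.2%:R * len e,
      dtail y.1 = level_V (src e), dhead y.1 = level_V (tgt e) &
      exists2 i, top_on i e & forall u, 0 <= u <= len e ->
        f i (epoint e u) = height (nfun (npar (val (y.1.1 : rt_edge T)))) +
          (if y.1.2 then rt_len y.1.1 - y.2%:R * u else y.2%:R * u)].
Proof.
have [i hi] := top_exists fA fmA e; have [s hs] := fA i e.
have s0 := top_slope_neq0 H fN fA DV hi hs.
have sR : s%:~R != 0 :> R by rewrite intr_eq0.
have es : exists v, AtVertex v = epoint e 0 by exists (src e); rewrite epoint0.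
have et : exists v, AtVertex v = epoint e (len e) by exists (tgt e); rewrite epoint_len.
have p0 : (0 < `|s|)%N by rewrite absz_gt0.
have pE : (`|s|%N)%:R = `|s%:~R| :> R by rewrite natr_absz intr_norm.
have ts := top_on_src hi; have tt := top_on_tgt hi; have l0 := len_gt0 e.
have [sp|sn|E] := ltgtP 0 (s%:~R : R); last by rewrite -E eqxx in sR.
  have lt : f i (epoint e 0) < f i (epoint e (len e)).
    by rewrite !hs // ltrD2l ltr_pM2l.
  have hb := below_end hi hs (zero_in e) (len_in e) es et lt.
  rewrite epoint0 epoint_len in hb lt.
  have /andP[nr /eqP hp] := level_V_par ts tt hb lt.
  rewrite ger0_norm ?(ltW sp) // in pE.
  exists (((exist _ (level_V (tgt e)) nr : rt_edge T), false), `|s|%N); split=> //=.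
    by rewrite /rt_len /= hp (level_V_height tt) (level_V_height ts) (affine_tgt hs) pE; ring.
  by exists i => // u hu; rewrite hs // hp (level_V_height ts) pE.
have lt : f i (epoint e (len e)) < f i (epoint e 0).
  by rewrite !hs // ltrD2l ltr_nM2l.
have hb := below_end hi hs (len_in e) (zero_in e) et es lt.
rewrite epoint0 epoint_len in hb lt.
have /andP[nr /eqP hp] := level_V_par tt ts hb lt.
rewrite ltr0_norm // in pE.
exists (((exist _ (level_V (src e)) nr : rt_edge T), true), `|s|%N); split=> //=.
  by rewrite /rt_len /= hp (level_V_height tt) (level_V_height ts) (affine_tgt hs) pE; ring.
exists i => // u hu; rewrite hs // /rt_len /= hp (level_V_height tt) (level_V_height ts).
by rewrite (affine_tgt hs) pE; ring.
Qed.

Definition level_E e : dart TG := (sval (cid (edge_image e))).1.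
Definition level_p e : nat := (sval (cid (edge_image e))).2.

Lemma level_p_gt0 e : (0 < level_p e)%N.
Proof. by have [] := svalP (cid (edge_image e)). Qed.

Lemma level_E_len e : len (level_E e).1 = (level_p e)%:R * len e.
Proof. by have [] := svalP (cid (edge_image e)). Qed.

Lemma level_E_tail e : dtail (level_E e) = level_V (src e).
Proof. by have [] := svalP (cid (edge_image e)). Qed.

Lemma level_E_head e : dhead (level_E e) = level_V (tgt e).
Proof. by have [] := svalP (cid (edge_image e)). Qed.

Lemma level_E_top e : exists2 i, top_on i e & forall u, 0 <= u <= len e ->
  f i (epoint e u) = height (nfun (npar (val ((level_E e).1 : rt_edge T)))) +
    (if (level_E e).2 then rt_len (level_E e).1 - (level_p e)%:R * u else (level_p e)%:R * u).
Proof. by have [] := svalP (cid (edge_image e)). Qed.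

Local Notation image a := (dart_map (T := TG) level_E a).

Lemma level_dart_top a : exists2 i, top_on i a.1 & forall r, 0 <= r <= len a.1 ->
  f i (dpoint a r) = f i (AtVertex (dtail a)) +
    (if (image a).2 then - (level_p a.1)%:R else (level_p a.1)%:R) * r.
Proof.
case: a => e b; have [i hi hu] := level_E_top e; exists i => // r /andP[/= r0 r1].
have hl := level_E_len e; rewrite /= in hl.
have i1 : 0 <= len e - r <= len e by lra.
have i2 : 0 <= r <= len e by rewrite r0.
rewrite -dpoint0 /dart_map; case: b; rewrite /dpoint /= hu // ?subr0 hu //.
  by rewrite hl; case: (level_E e).2 => /=; ring.
by rewrite hl; case: (level_E e).2 => /=; ring.
Qed.

(** Along the edge [z] is a truncation of the largest generator: it falls at most as fast as that
    generator, and does not fall where the latter grows. *)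
Lemma level_slope_ge a z (s : int) : normalized z -> is_slope z (AtVertex (dtail a)) a s ->
  (if (image a).2 then - (level_p a.1)%:Z else 0) <= s /\
  ((image a).2 = false -> z = nfun (val ((image a).1 : rt_edge T)) -> (level_p a.1)%:Z <= s).
Proof.
move=> nz [eps e0 hs]; have [i hi hr] := level_dart_top a.
have [t t0 ht] := edge_truncation H fN nz hi.
have l0 := len_gt0 a.1.
have htd r : 0 <= r <= len a.1 -> z (dpoint a r) = Num.min (f i (dpoint a r)) t.
  by move=> h; rewrite /dpoint ht //; case: a.2 => //; move: h; lra.
pose r := Num.min eps (len a.1).
have r0 : 0 < r by rewrite lt_min e0.
have rin : 0 <= r <= len a.1 by rewrite (ltW r0) ge_min lexx orbT.
have := hs r; rewrite (ltW r0) ge_min lexx => /(_ isT) /=.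
have -> : z (AtVertex (dtail a)) = Num.min (f i (AtVertex (dtail a))) t.
  by rewrite -dpoint0 htd // lexx ltW.
rewrite htd // hr // => E.
have pR : 0 < (level_p a.1)%:R :> R by rewrite ltr0n level_p_gt0.
move: E; set A := f i _; set q := (level_p a.1)%:R => E.
have qr : 0 < q * r by exact: mulr_gt0.
split.
  rewrite -(ler_int R) -(ler_pM2r r0); move: E; case: (image a).2; last first.
    rewrite mul0r => E.
    have : Num.min A t <= Num.min (A + q * r) t.
      by rewrite le_min !ge_min lexx orbT andbT; apply/orP; left; lra.
    by lra.
  rewrite mulrNz mulNr => E.
  have : Num.min A t - q * r <= Num.min (A - q * r) t.
    rewrite le_min; apply/andP; split; first by rewrite lerD2r ge_min lexx.
    by rewrite lerBlDr ge_min; apply/orP; right; lra.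
  by rewrite -/q; lra.
move=> up zE; move: E; rewrite up => E.
have lin : 0 <= len a.1 <= len a.1 by rewrite lexx andbT ltW.
have hd : dpoint a (len a.1) = AtVertex (dhead a).
  by rewrite -[a in LHS]drevK dpoint_rev /= subrr dpoint0.
have hV : val ((image a).1 : rt_edge T) = level_V (dhead a).
  have := dart_map_tail (T := TG) level_E_tail level_E_head (drev a).
  have -> : dart_map (T := TG) level_E (drev a) = drev (image a).
    by rewrite /dart_map /=; case: a.2; rewrite //= drevK.
  by rewrite /dtail /= up.
have th : top_at i (AtVertex (dhead a)).
  by move: hi; rewrite /dhead /dtail /=; case: a.2 => /= hi; [exact: top_on_src|exact: top_on_tgt].
(* As [z] is the image of the far end, it is truncated no lower than the value there, so it follows
   the largest generator along the whole edge. *)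
have tlarge : f i (AtVertex (dhead a)) <= t.
  apply/min_idPl; rewrite -hd -htd // hd zE hV (level_VP th) /trunc minxx //.
have := hr _ lin; rewrite up hd -/A -/q => Eh.
have rl : q * r <= q * len a.1 by rewrite ler_pM2l //; case/andP: rin.
have ql : 0 < q * len a.1 by exact: mulr_gt0.
rewrite -(ler_int R) -(ler_pM2r r0) -/q.
move: E; rewrite !(min_idPl _); lra.
Qed.

Definition level_mult v : int := D (AtVertex v) +
  \sum_(a in tangent (@AtVertex R G v) | (image a).2) (level_p a.1)%:Z.

Lemma level_mult_down v (b : rt_edge T) : val b = level_V v ->
  level_mult v = local_sum (T := T) level_E level_p v (b, true) + D (AtVertex v).
Proof.
move=> hb; rewrite addrC; congr (_ + _); apply: eq_bigl => a.
case: (boolP (a \in tangent (AtVertex v))) => //=; rewrite inE => /eqP ha.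
apply/idP/eqP => [h|->//]; have := dart_map_tail (T := TG) level_E_tail level_E_head a.
rewrite ha -hb /dtail h => hv; rewrite [image a]surjective_pairing h; congr (_, _).
by apply/val_inj.
Qed.

Lemma level_mult_root v : level_V v = nroot -> level_mult v = D (AtVertex v).
Proof.
move=> hv; rewrite /level_mult big1 ?addr0 // => a /andP[]; rewrite inE => /eqP ha h.
have := dart_map_tail (T := TG) level_E_tail level_E_head a; rewrite ha hv /dtail h => E.
by case/eqP: (valP ((image a).1 : rt_edge T)).
Qed.

Lemma level_mult_ge v (nu : dart TG) : dtail nu = level_V v ->
  local_sum (T := T) level_E level_p v nu <= level_mult v.
Proof.
have D0 : 0 <= D (AtVertex v) by have := r1_div H (AtVertex v) (r1_const H 0); rewrite ord_const addr0.
case: nu => b [] hb.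
  by rewrite (@level_mult_down v b hb) lerDl.
(* A function growing along all of [b]: it rises with the dilation factor on the darts over
   [(b, false)], falls at most with it on the darts towards the root, and falls on no other. *)
pose z := nfun (val b).
have nz : normalized z := nfun_normalized H f_ge0 f_zero (val b).
have [Mz _ _] := nz; have zR := r1_Rat H Mz.
have := r1_div H (AtVertex v) Mz; rewrite /ord_at subr_ge0; apply: contraTT; rewrite -!ltNge.
rewrite /level_mult /local_sum => lt.
suff : \sum_(a in tangent (@AtVertex R G v) | image a == (b, false)) (level_p a.1)%:Z -
    \sum_(a in tangent (@AtVertex R G v) | (image a).2) (level_p a.1)%:Z <=
    \sum_(a in tangent (@AtVertex R G v)) slope z (AtVertex v) a.
  by apply: lt_le_trans; rewrite ltrBrDr.
rewrite !big_mkcondr -sumrB; apply: ler_sum => a ha.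
have [s hs] := Rat_slope zR ha; rewrite (slopeE hs).
move: ha; rewrite inE => /eqP ha; rewrite -ha in hs.
have [h1 h2] := level_slope_ge nz hs.
case: eqP => [E|_]; last by rewrite sub0r; move: h1; case: ifP; rewrite ?oppr0.
by rewrite E /= subr0; apply: h2; rewrite E.
Qed.

(** At vertices this is [meet_height_level_V]. On an edge, the height in the tree is the value of
    the largest generator, and both sides truncate it at the same [t]. *)
Lemma profile_on_graph (g : realization TG -> R) (w : rt_edge T) tau : profile g w tau ->
  forall x, g (graph_map (T := TG) level_V level_E level_p x) =
    g (@AtVertex R TG nroot) + profile_fun w tau x.
Proof.
move=> P x; have ht : 0 <= tau <= rt_len w by case: P.
have nz : normalized (profile_fun w tau) := profile_fun_normalized ht.
have V (y : T) := profile_vertex ht P y.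
have [[v ->]|[e [u [hu ->]]]] := realizationP x.
  by rewrite /= V (meet_height_level_V v nz).
have hu' : 0 <= u <= len e by case/andP: hu => /ltW -> /ltW.
rewrite (graph_map_epoint level_E_len level_E_tail level_E_head) //.
have [i hi hf] := level_E_top e; have hE := hf u hu'.
have [t t0 hz] := edge_truncation H fN nz hi.
have hl := level_E_len e; have pR : 0 < (level_p e)%:R :> R by rewrite ltr0n level_p_gt0.
have /andP[pu0 pu1] : 0 <= (level_p e)%:R * u <= rt_len (level_E e).1.
  rewrite [rt_len _]hl; case/andP: hu' => u0 u1.
  by rewrite mulr_ge0 ?(ltW pR) //= ler_pM2l.
have mh v : top_at i (AtVertex v) -> (exists2 r, 0 <= r <= len e & AtVertex v = epoint e r) ->
    meet_height (level_V v) (profile_fun w tau) = Num.min (height (nfun (level_V v))) t.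
  by move=> hv [r hr E]; rewrite (meet_height_level_V v nz) (level_V_height hv) E hz.
have ms := mh _ (top_on_src hi) (ex_intro2 _ _ 0 (zero_in e) (esym (epoint0 e))).
have mt := mh _ (top_on_tgt hi) (ex_intro2 _ _ (len e) (len_in e) (esym (epoint_len e))).
pose b : rt_edge T := (level_E e).1.
have [hp hb] : meet_height (npar (val b)) (profile_fun w tau) = Num.min (height (nfun (npar (val b)))) t /\
    meet_height (val b) (profile_fun w tau) = Num.min (height (nfun (val b))) t.
  have h1 := level_E_tail e; have h2 := level_E_head e; rewrite /dhead /dtail /drev in h1 h2.
  case E : (level_E e).2 h1 h2 => h1 h2.
    have {}h1 : val b = level_V (src e) := h1; have {}h2 : npar (val b) = level_V (tgt e) := h2.
    by rewrite h2 h1.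
  have {}h1 : npar (val b) = level_V (src e) := h1; have {}h2 : val b = level_V (tgt e) := h2.
  by rewrite h1 h2.
pose X : R := if (level_E e).2 then rt_len b - (level_p e)%:R * u else (level_p e)%:R * u.
have hX : 0 <= X <= rt_len b by rewrite /X /b; case: (level_E e).2; lra.
have -> : dpoint (level_E e) ((level_p e)%:R * u) = @epoint R TG b X by [].
rewrite (profile_pt P) // hz // hE -/b -/X (V (npar (val b))) -addrA hp; congr (_ + _).
have -> : active w tau b = meet_height (val b) (profile_fun w tau) - meet_height (npar (val b)) (profile_fun w tau).
  by rewrite (meet_height_step ht) addrAC subrr add0r.
rewrite hp hb (min_affine_step _ _ hX); congr (_ + Num.min _ (Num.min _ _ - _)).
by rewrite /rt_len addrC subrK.
Qed.

Lemma profile_fun_surj z : normalized z -> exists (w : rt_edge T) (tau : R),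
  0 <= tau <= rt_len w /\ profile_fun w tau = z.
Proof.
move=> nz; have [i [t0 t00 hz0]] := normalized_span H fN nz.
pose t := Num.min t0 (height (f i)).
have hz : z = trunc (f i) t.
  by apply/funext => x; rewrite hz0 /trunc /t (minC t0) minA (min_idPl (f_le_height fA i x)).
have tb : t <= height (f i) by rewrite ge_min lexx orbT.
have : 0 <= t by rewrite le_min t00 height_ge0.
rewrite le_eqVlt => /predU1P[t_0|tpos].
  have [w hw] := rt_exists_child T; exists w, 0; split; first by rewrite lexx ltW // rt_len_gt0.
  rewrite hz -t_0 /profile_fun addr0; have {}hw : npar (val w) = nroot := hw.
  rewrite hw height_root; apply/funext => x; rewrite /trunc !(min_idPr _) //.
  exact: (nfun_ge0 H f_ge0 f_zero).
(* The upper end of the edge is the truncation of [f i] at the least level not below [t]; the level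
   before it is smaller than [t]. *)
pose l := \big[Num.min/height (f i)]_(l' <- levels | t <= l') l'.
have hl : height (f i) \in levels.
  by apply: height_level => [x|v]; [exact: f_ge0|exact: levels_f].
have [l1 l2] : l \in levels /\ t <= l.
  rewrite /l big_seq_cond; elim/big_ind: _ => // [a b [? ?] [? ?]|l' /andP[]//].
  by rewrite /Order.min; case: ifP.
have l3 : l <= height (f i) by exact: bigmin_le_id.
have [w0 hw0] := node_exists l1 l3.
have hh : height (nfun w0) = l.
  by rewrite hw0 height_trunc ?l3 ?(le_trans (ltW tpos)) // => x; exact: f_ge0.
have nr : (w0 : T) != nroot.
  by apply: contraTneq tpos => E; rewrite -leNgt (le_trans l2) // -hh E height_root.
have hp : height (nfun (npar w0)) = below f l by rewrite (height_npar H) hh.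
have lt : below f l < t.
  rewrite ltNge; apply/negP => h.
  have := @ge_bigmin_seq _ _ _ _ (height (f i)) _ (fun l => t <= l) id (below_level f_zero l) h.
  by rewrite -/l leNgt below_lt // (lt_le_trans tpos).
exists (exist _ w0 nr), (t - below f l); split.
  by rewrite /rt_len /= hp hh; apply/andP; split; lra.
by rewrite /profile_fun /= hp addrC subrK hw0 truncK.
Qed.

Theorem level_pulled : pulled_from_tree (\sum_v D (AtVertex v)) M.
Proof.
have [G' [alpha [phi [h1 h2 h3 h4]]]] := harmonic_completion level_p_gt0 level_E_len
  level_E_tail level_E_head level_mult_ge level_mult_down level_mult_root.
exists G', TG, alpha, phi; split=> //; first exact: rt_is_tree.
exists (@AtVertex R TG nroot); apply/seteqP; split=> g.
  move=> Mg; have [c [z [nz ->]]] := normalize H fA Mg.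
  have [w [tau [ht <-]]] := profile_fun_surj nz.
  have [u [P hu]] := profile_exists c ht.
  exists u; first exact: profile_RatD P.
  apply/funext => x /=; rewrite h4 (profile_on_graph P) addrC; congr (_ + _); exact: hu.
move=> [u /profile_of_RatD[w [tau P]] <-].
have -> : (u \o phi) \o tm_incl alpha = fun x => profile_fun w tau x + u (@AtVertex R TG nroot).
  by apply/funext => x /=; rewrite h4 (profile_on_graph P) addrC.
have ht : 0 <= tau <= rt_len w by case: P.
have [Mz _ _] := profile_fun_normalized ht.
exact: (r1_add H).
Qed.

End LevelMap.

(** * Passing to an adapted model *)

Section Refining.
Variable R : realType.

Definition vertex_supported (G : metric_graph R) (F : realization G -> int) :=
  forall e u (h : 0 < u < len e), F (InEdge h) = 0.

Lemma vertex_supported_ord (G : metric_graph R) (g : realization G -> R) : Defs.Rat g ->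
  vertex_supported (ord_at g) <-> forall e, exists s, edge_affine g e s.
Proof.
move=> hg; split; first exact: Rat_affine hg.
by move=> h e u hu; have [s hs] := h e; exact: affine_div hs.
Qed.

Lemma interior_image (G' G : metric_graph R) (p : realization G' -> realization G) v' e u
    (h : 0 < u < len e) : injective p -> p (AtVertex v') <> p (InEdge h).
Proof. by move=> pi /pi. Qed.

Lemma refine_vertex_supported (G' G : metric_graph R) (p : realization G' -> realization G)
    (F : realization G -> int) : injective p ->
  (forall v, exists v', p (AtVertex v') = AtVertex v) ->
  vertex_supported F -> vertex_supported (F \o p).
Proof.
move=> pi hv hF e u h /=; case E : (p (InEdge h)) => [v|e1 u1 h1]; last exact: hF.
by have [v' hv'] := hv v; case: (interior_image (v' := v') (h := h) pi); rewrite hv' E.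
Qed.

Lemma refine_supports (G : metric_graph R) (I : finType) (F : I -> realization G -> int) :
  (forall i, finite_set [set x | F i x != 0]) ->
  exists (G' : metric_graph R) (p : realization G' -> realization G),
    [/\ refines p, forall v, exists v', p (AtVertex v') = AtVertex v &
        forall i, vertex_supported (F i \o p)].
Proof.
move=> hfin.
have /finite_seqP[s hs] : finite_set (\bigcup_(i in [set: I]) [set x | F i x != 0]).
  by apply: bigcup_finite => //; exact: finite_finset.
have [G' [p [hp _ h2 h3]]] := refine_points s; exists G', p; split=> // i e u h /=.
have [//|ne] := eqVneq (F i (p (InEdge h))) 0.
have [|v' hv'] := h2 (p (InEdge h)).
  have : [set` s] (p (InEdge h)) by rewrite -hs; exists i.
  by [].
have [[k pk _] _ _ _] := hp.
by case: (interior_image (v' := v') (h := h) (can_inj pk)).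
Qed.

Lemma affine_refine (G' G : metric_graph R) (p : realization G' -> realization G) g : refines p ->
  (forall v, exists v', p (AtVertex v') = AtVertex v) -> Defs.Rat g ->
  (forall e, exists s, edge_affine g e s) -> forall e, exists s, edge_affine (g \o p) e s.
Proof.
move=> [[k pk _] _ pRat pord] hv hg /(vertex_supported_ord hg) h.
apply/(vertex_supported_ord (pRat _ hg)) => e u hu.
by rewrite pord; exact: (refine_vertex_supported (can_inj pk) hv h).
Qed.

Lemma normalize_generators (G : metric_graph R) (D : realization G -> int) M n f :
  @rank1_series R G D M n f -> (forall i e, exists s, edge_affine (f i) e s) ->
  exists f' : 'I_n.+1 -> realization G -> R,
    [/\ rank1_series D M f', forall i x, 0 <= f' i x,
        forall i, exists v, f' i (AtVertex v) = 0 & forall i e, exists s, edge_affine (f' i) e s].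
Proof.
move=> [h1 h2 h3 h4 h5 h6 h7 h8 h9] fA.
have /choice[m hm] := fun i => vertex_min (f i).
exists (fun i x => f i x - f i (AtVertex (m i))); split.
- split=> //; first by move=> i; exact: (h3 _ (- _)).
  move=> g /h8[c hc]; exists (fun i => c i + f i (AtVertex (m i))) => x.
  have [[i Ei] H] := hc x; split; first by exists i; rewrite Ei; ring.
  by move=> j; have := H j; lra.
- move=> i x; rewrite subr_ge0; have [[v ->]//|[e [u [hu ->]]]] := realizationP x.
  have [s hs] := fA i e; apply: (affine_ge hs) => //.
  by case/andP: hu => /ltW -> /ltW.
- by move=> i; exists (m i); rewrite subrr.
- by move=> i e; have [s hs] := fA i e; exists s => u hu; rewrite hs // addrAC.
Qed.

End Refining.

Theorem theorem1p5 (R : realType) (Gamma : metric_graph R) (d : int)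
    (D : divisor Gamma) (M : set (realization Gamma -> R))
    (hDM : linear_series 1 d D M)
    (hconst : forall c : R, M (fun=> c)) :
  exists (Gamma' T : metric_graph R) (alpha : tropical_modification Gamma Gamma')
         (phi : realization Gamma' -> realization T),
    [/\ is_tree T, finite_morphism phi, harmonic_morphism phi, has_degree phi d &
      exists y0 : realization T,
        M = [set ((g \o phi) \o tm_incl alpha) | g in RatD (point_div y0)]].
Proof.
have [n [f0 H0]] := linear_series_rank1 hDM hconst.
(* First subdivision: the supports of [D], indexed by [None], and of the divisors of the generators
   become vertices. *)
have [G1 [p1 [r1 v1 s1]]] := @refine_supports R Gamma (option 'I_n.+1)
  (fun i => if i is Some i then ord_at (f0 i) else D)
  (fun i => if i is Some i then Rat_ord_finite (r1_Rat H0 (r1_gen H0 i)) else dcoef_finite D).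
have H1 := rank1_series_refine r1 H0.
have A1 i : forall e, exists s, edge_affine (f0 i \o p1) e s.
  apply/(vertex_supported_ord (r1_Rat H1 (r1_gen H1 i))) => e u h.
  by case: r1 => _ _ _ ->; exact: (s1 (Some i)).
have [f1 [{}H1 ge1 z1 {}A1]] := normalize_generators H1 A1.
have M1 i j := r1_min H1 (r1_gen H1 i) (r1_gen H1 j).
(* Second subdivision: the pairwise minima of the normalized generators become affine on edges. The
   generators are normalized before, since shifting them changes these minima. *)
have [G2 [p2 [r2 v2 s2]]] := @refine_supports R G1 ('I_n.+1 * 'I_n.+1)%type
  (fun a => ord_at (fun x => Num.min (f1 a.1 x) (f1 a.2 x)))
  (fun a => Rat_ord_finite (r1_Rat H1 (M1 a.1 a.2))).
have H2 := rank1_series_refine r2 H1.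
have A2 i : forall e, exists s, edge_affine (f1 i \o p2) e s.
  by apply: (affine_refine r2 v2) => //; exact: r1_Rat H1 _ (r1_gen H1 i).
have B2 i j : forall e, exists s,
    edge_affine (fun x => Num.min ((f1 i \o p2) x) ((f1 j \o p2) x)) e s.
  apply/(vertex_supported_ord (r1_Rat H2 (r1_min H2 (r1_gen H2 i) (r1_gen H2 j)))) => e u h.
  by case: r2 => _ _ _ pord; rewrite (pord (fun x => Num.min (f1 i x) (f1 j x))); exact: (s2 (i, j)).
have D2 : vertex_supported ((D \o p1) \o p2).
  case: (r2) => -[k pk _] _ _ _.
  by apply: (refine_vertex_supported (can_inj pk) v2); exact: (s1 None).
have ge2 i x : 0 <= (f1 i \o p2) x by exact: ge1.
have z2 i : exists v, (f1 i \o p2) (AtVertex v) = 0.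
  by have [v hv] := z1 i; have [v' hv'] := v2 v; exists v'; rewrite /= hv'.
have N2 i := fN H2 ge2 z2 i.
(* Third subdivision: the points where a largest generator takes a level become vertices. *)
have /finite_seqP[s hs] := level_points_finite H2 N2 A2 B2 D2.
have [G3 [p3 [r3 w3 m3 v3]]] := refine_points s.
have H3 := rank1_series_refine r3 H2.
pose f3 i := (f1 i \o p2) \o p3.
have A3 i : forall e, exists s, edge_affine (f3 i) e s.
  by apply: (affine_refine r3 v3) => //; exact: r1_Rat H2 _ (r1_gen H2 i).
have B3 i j : forall e, exists s, edge_affine (fun x => Num.min (f3 i x) (f3 j x)) e s.
  apply: (@affine_refine _ _ _ p3 (fun x => Num.min ((f1 i \o p2) x) ((f1 j \o p2) x)) r3 v3) => //.
  exact: r1_Rat H2 _ (r1_min H2 (r1_gen H2 i) (r1_gen H2 j)).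
have p3i : injective p3 by case: r3 => -[k pk _] _ _ _; exact: can_inj pk.
have D3 : vertex_supported (((D \o p1) \o p2) \o p3) := refine_vertex_supported p3i v3 D2.
have ge3 i x : 0 <= f3 i x by exact: ge1.
have z3 i : exists v, f3 i (AtVertex v) = 0.
  by have [v hv] := z2 i; have [v' hv'] := v3 v; exists v'; rewrite /f3 /= hv'.
(* No level is new: at the added vertices every generator takes a value that already was a level. *)
have L3 i v : f3 i (AtVertex v) \in levels (fun i => f1 i \o p2).
  have [[v' hv']|hin] := w3 v; first by rewrite /f3 /= hv'; exact: levels_f.
  have : [set` s] (p3 (AtVertex v)) by [].
  rewrite -hs => -[k hk hl].
  exact: (level_points_values H2 N2 A2 B2 hk hl).
have F3 e u (h : 0 < u < len e) i : top_at f3 i (InEdge h) -> f3 i (InEdge h) \notin levels f3.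
  move=> ht; apply/negP => /levelsP[j [v E]].
  have : [set` s] (p3 (InEdge h)).
    by rewrite -hs; exists i; [exact: ht|move: (L3 j v); rewrite -E].
  by move=> /m3[v' hv']; exact: (interior_image p3i hv').
have key := level_pulled H3 ge3 z3 A3 B3 D3 F3.
have := pulled_from_tree_refine r1 (pulled_from_tree_refine r2 (pulled_from_tree_refine r3 key)).
(* The support of [D] lies in the image of the vertices of the last model, so the sum over these is
   the degree. *)
rewrite (_ : \sum_v _ = d) //.
have [<- _ _ _] := hDM; rewrite /deg; apply/esym.
pose p x := p1 (p2 (p3 x)).
have [[k1 p1k k1p] _ _ _] := r1; have [[k2 p2k k2p] _ _ _] := r2; have [[k3 p3k k3p] _ _ _] := r3.
rewrite (fsbigE [seq p (AtVertex v) | v <- enum (vertex G3)]) //=.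
- by rewrite big_map big_enum_cond /=; apply: eq_bigl => v; rewrite in_setT.
- rewrite map_inj_uniq ?enum_uniq // => v v' /(can_inj p1k)/(can_inj p2k)/(can_inj p3k).
  exact: AtVertex_inj.
- move=> x _; apply: contraNeq => Dx.
  have E : x = p (k3 (k2 (k1 x))) by rewrite /p k3p k2p k1p.
  rewrite E; move: Dx; rewrite {1}E; case: (k3 _) => [v _|e u h].
    by apply: map_f; rewrite mem_enum.
  by rewrite -[D _]/((((D \o p1) \o p2) \o p3) (InEdge h)) D3 eqxx.
Qed.
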